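(* Let $1\le p<2$. Let $(Y_i)_{i\in\mathbb Z}$ be a strictly stationary sequence of real-valued random variables with marginal density $f$ with respect to Lebesgue measure $\lambda$ on $\mathbb R$. Let $K\in\mathbb L^1(\mathbb R,\lambda)$ be a function of bounded variation; write $K_h(\cdot)=h^{-1}K(\cdot/h)$, and assume that for some positive integer $r$ there is a constant $C_1$, depending only on $r$, such that, for every $h>0$ and every $g\in W^r(\mathbb L^p(\mathbb R,\lambda))$, $$\int_{\mathbb R}|g(x)-g*K_h(x)|^p\,dx\le C_1h^{pr}\|g^{(r)}\|_{p,\lambda}^p.$$ Assume that $Y_0$ has a moment of order $q(2-p)/p+\varepsilon$ for some $q>1$ and $\varepsilon>0$, and that $\sum_{k=0}^n(k+1)^{1/(q-1)}\beta_{1,Y}(k)=O(n^{\delta q/(q-1)})$ for some $\delta\in[0,1)$. Assume that either $f\in \mathrm{Lip}^*(s,\mathbb L^p(\mathbb R,\lambda))$ with $s\in[r-1,r)$, $s>0$, or $f\in W^s(\mathbb L^p(\mathbb R,\lambda))$ with $s=r$. Then, taking $h_n=Cn^{-(1-\delta)/(2s+1)}$ with a constant $C>0$, the kernel estimator $f_n(x)=\frac1{nh_n}\sum_{k=1}^nK(h_n^{-1}(x-Y_k))$ satisfies $$\mathbb E\Big(\int_{\mathbb R}|f_n(x)-f(x)|^p\,dx\Big)=O\Big(n^{\frac{-ps(1-\delta)}{2s+1}}\Big).$$ Hence, if $\sum_{k=0}^\infty(k+1)^{1/(q-1)}\beta_{1,Y}(k)<\infty$ (case $\delta=0$), one obtains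 the same rate as in the iid situation. In the particular case $p=1$, let $\mu$ be the probability measure with density $f$ and $\hat\mu_n$ the random (signed) measure with density $f_n$. Then $$\mathbb E\|\hat\mu_n-\mu\|=O\Big(n^{\frac{-s(1-\delta)}{2s+1}}\Big),$$ where $\|\cdot\|$ is the variation norm of measures. Moreover, $\hat\mu_n$ can be modified (by taking the positive part of $f_n$ and renormalizing) to get a random probability measure $\mu_n^*$ that converges to $\mu$ at the same rate.
   Context: $\|\cdot\|_{p,\lambda}$ is the $\mathbb L^p(\mathbb R,\lambda)$-norm. For a positive integer $s$, $W^s(\mathbb L^p(\mathbb R,\lambda))$ is the Sobolev space of functions (in $\mathbb L^p$) such that $g^{(s-1)}$ is absolutely continuous with almost everywhere derivative $g^{(s)}\in\mathbb L^p(\mathbb R,\lambda)$. For $s>0$, $\mathrm{Lip}^*(s,\mathbb L^p(\mathbb R,\lambda))$ is the generalized Lipschitz space of DeVore and Lorentz (equal to the Besov space $B_{s,p,\infty}(\mathbb R)$): functions $g\in\mathbb L^p$ with $\sup_{t>0}t^{-s}\omega_m(g,t)_p<\infty$, where $m=[s]+1$ and $\omega_m(g,t)_p=\sup_{0<u\le t}\|\Delta_u^mg\|_{p,\lambda}$ is the $m$-th modulus of smoothness in $\mathbb L^p$, $\Delta_u^m$ being the $m$-th order forward difference with step $u$. Dependence coefficients: let $P$ be the law of $Y_0$, $\mathcal F_\ell=\sigma(Y_i,i\le\ell)$, and let $P_{Y_k|\mathcal F_\ell}$ be the conditional distribution of $Y_k$ given $\mathcal F_\ell$. With $f_t=\mathbf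 1_{]-\infty,t]}$ for $t\in\mathbb R$ and $Q(g)=\int g\,dQ$ for a probability measure $Q$, let $b_\ell(k)=\sup_{t\in\mathbb R}|P_{Y_k|\mathcal F_\ell}(f_t)-P(f_t)|$ and $\beta_{1,Y}(k)=\mathbb E(b_0(k))$. *)

(* Defs.v *)
From HB Require Import structures.
From mathcomp Require Import all_boot all_order all_algebra.
From mathcomp Require Import all_classical all_reals all_analysis.
From mathcomp Require Import measurable_realfun.

Set Implicit Arguments.
Unset Strict Implicit.
Unset Printing Implicit Defensive.

Import Order.TTheory GRing.Theory Num.Theory.
Import numFieldNormedType.Exports.

Local Open Scope classical_set_scope.
Local Open Scope ring_scope.

Section real_line.
Context {R : realType}.
Local Notation mu := (@lebesgue_measure R).

Definition inLp (p : R) (g : R -> R) : Prop :=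
  measurable_fun [set: R] g /\ finite_norm mu p%:E g.

(* Absolute continuity on every compact interval.  If the a.e. derivative is
   moreover in some L^p, p >= 1, then Hoelder's inequality makes this equivalent
   to absolute continuity on the whole line. *)
Definition abs_continuous (g : R -> R) : Prop :=
  forall M e : R, 0 < e -> exists2 dl : R, 0 < dl &
    forall (n : nat) (a b : 'I_n -> R),
      (forall i, - M <= a i /\ a i <= b i /\ b i <= M) ->
      trivIset [set: 'I_n] (fun i => `]a i, b i[%classic) ->
      \sum_(i < n) (b i - a i) < dl ->
      \sum_(i < n) `|g (b i) - g (a i)| < e.

(* [gs] is the s-th derivative of [g], for s >= 1.  As [g] is an element of L^p,
   regularity is required of one representative [g0] of its a.e. class. *)
Definition sobolev_derivative (s : nat) (g gs : R -> R) : Prop :=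
  exists g0 : R -> R,
    [/\ {ae mu, forall x, g x = g0 x},
        forall k x, (k < s.-1)%N -> derivable (derive1n k g0) x 1,
        abs_continuous (derive1n s.-1 g0) &
        {ae mu, forall x, is_derive x (1 : R) (derive1n s.-1 g0) (gs x)}].

Definition sobolev (s : nat) (p : R) (g : R -> R) : Prop :=
  inLp p g /\ exists2 gs, inLp p gs & sobolev_derivative s g gs.

Definition forward_diff (u : R) (g : R -> R) : R -> R :=
  fun x => g (x + u) - g x.

Definition modulus_smoothness (m : nat) (p : R) (g : R -> R) (t : R) : \bar R :=
  ereal_sup [set ('N[mu]_(p%:E)[EFin \o iter m (forward_diff u) g])%E
            | u in [set u : R | 0 < u <= t]].

Definition gen_lipschitz (s p : R) (g : R -> R) : Prop :=
  inLp p g /\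
  (ereal_sup [set (t `^ (- s))%:E *
                  modulus_smoothness (Num.truncn s).+1 p g t
             | t in [set t : R | (0 < t)%R]] < +oo)%E.

Definition bounded_variation_line (K : R -> R) : Prop :=
  exists M : R, forall a b : R, a <= b -> (total_variation a b K <= M%:E)%E.

Definition scaled_kernel (K : R -> R) (h : R) : R -> R :=
  fun x => h^-1 * K (x / h).

Definition convolution (g k : R -> R) : R -> R :=
  fun x => \int[mu]_y (g y * k (x - y)).

Definition approximation_order (K : R -> R) (p : R) (r : nat) : Prop :=
  exists C1 : R, forall (h : R) (g gr : R -> R), 0 < h ->
    inLp p g -> inLp p gr -> sobolev_derivative r g gr ->
    (\int[mu]_x (`|g x - convolution g (scaled_kernel K h) x| `^ p)%:E
     <= (C1 * h `^ (p * r%:R))%:E * 'N[mu]_(p%:E)[EFin \o gr] `^ p)%E.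

Definition has_density (nu : set R -> \bar R) (g : R -> R) : Prop :=
  forall A : set R, measurable A -> nu A = (\int[mu]_(x in A) (g x)%:E)%E.

(* Total mass |nu|(R) of the variation measure of [nu]. *)
Definition variation_norm (nu : {charge set R -> \bar R}) : \bar R :=
  let P := cid (Hahn_decomposition nu) in
  let N := cid (projT2 P) in
  charge_variation (projT2 N) [set: R].

(* Big O at infinity for nonnegative sequences.  The left-hand side takes
   extended values so that the bound also asserts that it is finite. *)
Definition is_bigO (u : nat -> \bar R) (v : nat -> R) : Prop :=
  exists M : R, \forall n \near \oo, (u n <= (M * v n)%:E)%E.

End real_line.

Section process.
Context {R : realType} {d : measure_display} {T : measurableType d}.
Context {Pr : probability T R}.

Definition strictly_stationary (Y : int -> {RV Pr >-> R}) : Prop :=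
  forall (n : nat) (i : n.-tuple int) (h : int) (B : set (n.-tuple R)),
    measurable B ->
    Pr [set w | B [tuple Y (tnth i j) w | j < n]] =
    Pr [set w | B [tuple Y (tnth i j + h) w | j < n]].

(* F_l = sigma(Y_i, i <= l) is the sigma-algebra generated by [past Y l]. *)
Definition past (Y : int -> {RV Pr >-> R}) (l : int) : set (set T) :=
  \bigcup_(i in [set i : int | i <= l])
    preimage_set_system [set: T] (Y i) measurable.

(* [kappa] is a regular version of the conditional distribution of [X] given
   the sigma-algebra generated by [G]. *)
Definition cond_distribution (G : set (set T)) (X : {RV Pr >-> R})
    (kappa : R.-pker (g_sigma_algebraType G) ~> R) : Prop :=
  forall (A : set T) (B : set R),
    G.-sigma.-measurable A -> measurable B ->
    (\int[Pr]_(w in A) kappa w B)%E = Pr (A `&` X @^-1` B).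

(* [Q `]-oo, t]] is Q(f_t), the integral of the indicator f_t. *)
Definition dep_b (G : set (set T)) (kappa : R.-pker (g_sigma_algebraType G) ~> R)
    (Q : probability R R) (w : T) : \bar R :=
  ereal_sup (range (fun t : R =>
    `|kappa w `]-oo, t]%classic - Q `]-oo, t]%classic|%E)).

(* Here [kappa] is the conditional distribution of Y_k given F_0. *)
Definition dep_beta1 (Y : int -> {RV Pr >-> R})
    (kappa : R.-pker (g_sigma_algebraType (past Y 0)) ~> R) : \bar R :=
  (\int[Pr]_w dep_b kappa (distribution Pr (Y 0%R)) w)%E.

Definition bandwidth (C delta s : R) (n : nat) : R :=
  C * n%:R `^ (- ((1 - delta) / (2 * s + 1))).

Definition kernel_estimator (K : R -> R) (h : nat -> R)
    (Y : int -> {RV Pr >-> R}) (n : nat) (w : T) (x : R) : R :=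
  (n%:R * h n)^-1 * \sum_(1 <= k < n.+1) K ((h n)^-1 * (x - Y k%:Z w)).

Definition Lp_risk (p : R) (f : R -> R) (fn : nat -> T -> R -> R) (n : nat) :
    \bar R :=
  (\int[Pr]_w \int[lebesgue_measure]_x (`|fn n w x - f x| `^ p)%:E)%E.

Definition normalized_pos_part (g : R -> R) : R -> R :=
  fun x => Num.max (g x) 0 / \int[lebesgue_measure]_y Num.max (g y) 0.

Definition random_charge (nu : T -> {charge set R -> \bar R}) : Prop :=
  forall A : set R, measurable A ->
    measurable_fun [set: T] (fun w => nu w A).

Definition variation_risk (Q : probability R R)
    (nu : nat -> T -> {charge set R -> \bar R}) (n : nat) : \bar R :=
  (\int[Pr]_w variation_norm (cadd (nu n w)
     (copp (charge_of_finite_measure Q))))%E.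

End process.

Arguments Lp_risk {R d T} Pr p f fn n.
Arguments variation_risk {R d T} Pr Q nu n.

(* Main.v *)
Require Import Defs.
From HB Require Import structures.
From mathcomp Require Import all_boot all_order all_algebra.
From mathcomp Require Import all_classical all_reals all_analysis.
From mathcomp Require Import measurable_realfun.
From mathcomp Require Import ring lra.

Import Order.TTheory GRing.Theory Num.Theory.
Import numFieldNormedType.Exports.

Local Open Scope classical_set_scope.
Local Open Scope ring_scope.

(** The error splits into a stochastic part and a bias,
    fn - f = (fn - f * K_h) + (f * K_h - f), where K_h is the rescaled kernel and
    f * K_h the mean of fn.

    Stochastic part.  Cut the kernel into the pieces K 1_[c, c+1).  Each piece is
    a difference of two nondecreasing functions with values in [0, V_c], where
    V_c is of the order of |K(c)| plus the variation of K on the cell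
    (cell_monotone_split), and the V_c are summable because K is integrable and of
    bounded variation.  For a monotone function u with values in [0, V], the level
    sets are half lines, so a layer-cake argument gives
    |Cov(psi(Y_0), u(Y_k))| <= V E[psi(Y_0) b(k)], where b(k) is the distance between
    the conditional and the marginal distribution functions (covariance_gap).
    Hence the variance of a centred sum of n terms is at most
    4 V n E[|phi(Y_0)| B] with B = b(0) + ... + b(n) (variance_le).  Integrated in x
    against the weight (1 + |x - hc|)^alpha, the deviation of a single cell has
    second moment at most 4 V_c^2 n h E[B (1 + |Y_0| + h)^alpha]
    (cell_second_moment).  Young's inequality converts these weighted second
    moments into p-th moments (p < 2), the dual weight being integrable for the
    chosen alpha; summing over the cells with the convexity inequality sum_powR_le
    and letting the truncation grow gives Lp_deviation.  Finally
    E[B (1 + |Y_0| + h)^alpha] = O(n^delta): Young with exponents q and q/(q-1)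
    separates the moment of Y_0 from E[B^(q/(q-1))], and the latter is controlled by
    the weighted sum of the beta coefficients (power_of_sum_le, gap_moment).

    Bias.  If f has r derivatives in L^p, the approximation property of K applies
    to f itself.  In the Lipschitz case it applies to the means
    F_j(x) = int f(x + j h v) dP(v), j = 1..r, where P is the law of a sum of r
    independent uniform variables: F_j is an r-fold Steklov mean, so its r-th
    derivative is (jh)^(-r) times the r-th difference of f with step jh
    (steklov_sobolev).  The alternating combination of f and the F_j is the mean of
    the r-th differences of f with steps hv (averaged_differenceE), which is
    O(h^s) in L^p; convolution with K_h keeps that bound by Young's convolution
    inequality (lipschitz_bias).

    With h of order n^(-(1-delta)/(2s+1)) the two parts balance (risk_rate).

    Total variation.  For p = 1 the variation norm of a signed measure with density
    g is at most the L^1 norm of g.  Since the risk tends to 0 while every fn has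
    integral equal to that of K, the kernel has integral 1 (kernel_mass_one); so the
    positive part of fn has mass at least 1, and normalizing it at most doubles the
    L^1 distance to f (normalized_error). *)

Set Implicit Arguments.
Unset Strict Implicit.
Unset Printing Implicit Defensive.

(** * Convexity and integration inequalities *)

(** The integral of a nonnegative function is a supremum over simple
    functions below it, hence monotone on all nonnegative functions, which
    spares measurability proofs for integrals with a parameter. *)
Lemma le_integral_nomeas d (T : measurableType d) (R : realType)
    (mu : {measure set T -> \bar R}) (f g : T -> \bar R) :
  (forall x, 0 <= f x)%E -> (forall x, f x <= g x)%E ->
  (\int[mu]_x f x <= \int[mu]_x g x)%E.
Proof.
move=> f0 fg; have g0 x : (0 <= g x)%E by exact: le_trans (f0 x) (fg x).
rewrite !ge0_integralTE//; apply: le_ereal_sup => _ [h hf <-].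
by exists h => // x; exact: le_trans (hf x) (fg x).
Qed.

(** By uniqueness of Lebesgue measure, its image under an affine map is a
    multiple of itself. *)
Lemma ge0_integral_affine (R : realType) (c a : R) (g : R -> \bar R) :
  c != 0 -> measurable_fun [set: R] g -> (forall x, 0 <= g x)%E ->
  (\int[lebesgue_measure]_x g (c * x + a)%R =
   `|c|^-1%:E * \int[lebesgue_measure]_x g x)%E.
Proof.
move=> c0 mg g0.
have mphi : measurable_fun [set: measurableTypeR R]
    (fun x : R => c * x + a : measurableTypeR R).
  by apply: measurable_funD => //; exact: measurable_funM.
pose m : {measure set (measurableTypeR R) -> \bar R} :=
  mscale (NngNum (normr_ge0 c)) (measure_function_pushforward__canonical__measure_function_Measure (@lebesgue_measure R) mphi).
have mE A : measurable A -> lebesgue_measure A = m A.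
  apply: lebesgue_measure_unique => _ [[u v] /= uv <-].
  rewrite /m /mscale /= /pushforward.
  have [cp|cn|c00] := ltrgtP 0 c; last by rewrite -c00 eqxx in c0.
  - have -> : (fun x : R => c * x + a) @^-1` `]u, v] = `](u - a) / c, (v - a) / c]%classic.
      apply/seteqP; split => x /=; rewrite !in_itv/= ltr_pdivrMr// ler_pdivlMr//;
        by rewrite (mulrC x) ltrBlDr lerBrDr.
    rewrite !lebesgue_measure_itv/= !lte_fin ltr_pM2r ?invr_gt0// ltrD2r.
    case: ifPn => [_|]; last by rewrite mule0.
    by rewrite -!EFinB -EFinM; congr EFin; rewrite gtr0_norm//; field.
  - have -> : (fun x : R => c * x + a) @^-1` `]u, v] = `[(v - a) / c, (u - a) / c[%classic.
      apply/seteqP; split => x /=; rewrite !in_itv/= ltr_ndivlMr// ler_ndivrMr//;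
        by rewrite (mulrC x) ltrBlDr lerBrDr andbC.
    rewrite !lebesgue_measure_itv/= !lte_fin ltr_nM2r ?invr_lt0// ltrD2r.
    case: ifPn => [_|]; last by rewrite mule0.
    by rewrite -!EFinB -EFinM; congr EFin; rewrite ltr0_norm//; field.
have -> : (\int[lebesgue_measure]_x g x = \int[m]_x g x)%E.
  by apply: eq_measure_integral => A mA _; exact: mE.
rewrite ge0_integral_mscale//= muleA -EFinM mulVf ?normr_eq0// mul1e.
by rewrite (ge0_integral_pushforward mphi)//.
Qed.

(** The graph of the power function lies above its tangent at l. *)
Lemma young_tangent (R : realType) (p l y : R) : 1 <= p -> 0 <= l -> 0 <= y ->
  p * l `^ (p - 1) * y <= y `^ p + (p - 1) * l `^ p.
Proof.
move=> p1 l0 y0; have [->|pn1] := eqVneq p 1.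
  by rewrite subrr powRr0 powRr1// !mul1r mul0r addr0.
have p1' : 1 < p by rewrite lt_neqAle eq_sym pn1.
have p0 : 0 < p by lra.
have q0 : 0 < p / (p - 1) by rewrite divr_gt0//; lra.
have pn0 : p != 0 by lra.
have pm0 : p - 1 != 0 by lra.
have := @conjugate_powR R y (l `^ (p - 1)) p (p / (p - 1)) y0 (powR_ge0 _ _) p0 q0.
rewrite -powRrM.
have -> : (p - 1) * (p / (p - 1)) = p by field.
have -> : p^-1 + (p / (p - 1))^-1 = 1 by field; rewrite pn0 pm0.
move=> /(_ erefl).
rewrite -(ler_pM2l p0) => H.
by rewrite -mulrA [_ `^ _ * y]mulrC; apply: (le_trans H); rewrite le_eqVlt; apply/orP; left;
  apply/eqP; field; rewrite pm0.
Qed.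

(** Optimizing the tangent inequalities at l = I / M. This turns a family of
    inequalities linear in I, which integrate or sum term by term, into a
    Jensen inequality. *)
Lemma power_from_tangents (R : realType) (p M I J : R) :
  1 <= p -> 0 < M -> 0 <= I ->
  (forall l, 0 <= l -> p * l `^ (p - 1) * I <= J + (p - 1) * l `^ p * M) ->
  I `^ p <= M `^ (p - 1) * J.
Proof.
move=> p1 M0 I0 H.
have l0 : 0 <= I / M by rewrite divr_ge0// ltW.
have {H} := H _ l0.
have IE : I = (I / M) * M by rewrite divfK// gt_eqF.
set l := I / M in l0 IE *.
have lp : l * l `^ (p - 1) = l `^ p by rewrite mulr_powRB1//; lra.
rewrite {1}IE mulrA -(mulrA p) (mulrC _ l) lp => H'.
have {}H' : M * l `^ p <= J by lra.
have Mp : M * M `^ (p - 1) = M `^ p by rewrite mulr_powRB1//; lra.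
rewrite IE powRM//; last exact: ltW.
by rewrite -Mp mulrA [leRHS]mulrC ler_wpM2r ?powR_ge0// mulrC.
Qed.

(** Jensen's inequality for the finite measure with weights v. *)
Lemma sum_powR_le (R : realType) (I : Type) (r : seq I) (p V : R) (v z : I -> R) :
  1 <= p -> 0 < V -> (forall i, 0 < v i) -> \sum_(i <- r) v i <= V ->
  `|\sum_(i <- r) z i| `^ p <=
  V `^ (p - 1) * \sum_(i <- r) v i * (`|z i| / v i) `^ p.
Proof.
move=> p1 V0 v0 vV.
apply: (@le_trans _ _ ((\sum_(i <- r) `|z i|) `^ p)).
  by rewrite ge0_ler_powR ?nnegrE ?sumr_ge0 ?ler_norm_sum//; lra.
apply: power_from_tangents => //; first by rewrite sumr_ge0.
move=> l l0; apply: (@le_trans _ _ (\sum_(i <- r) v i * (`|z i| / v i) `^ p +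
   (p - 1) * l `^ p * \sum_(i <- r) v i)); last first.
  by rewrite lerD2l ler_wpM2l// mulr_ge0 ?powR_ge0//; lra.
rewrite !mulr_sumr -big_split/= ler_sum// => i _.
have := @young_tangent _ p l (`|z i| / v i) p1 l0 (divr_ge0 (normr_ge0 _) (ltW (v0 i))).
have zE : `|z i| = v i * (`|z i| / v i) by rewrite mulrC divfK ?gt_eqF.
set a := `|z i| / v i in zE *; rewrite zE.
move/(ler_wpM2l (ltW (v0 i))) => H.
apply: (le_trans _ (le_trans H _)); rewrite le_eqVlt; apply/orP; left; apply/eqP; ring.
Qed.

Lemma sum_powR_le_card (R : realType) (n : nat) (p : R) (z : 'I_n -> R) :
  1 <= p -> `|\sum_(i < n) z i| `^ p <= n%:R `^ (p - 1) * \sum_(i < n) `|z i| `^ p.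
Proof.
move=> p1; case: n z => [|n] z.
  by rewrite !big_ord0 normr0 powR0 ?mulr0//; lra.
have := @sum_powR_le R _ (index_enum 'I_n.+1) p n.+1%:R (fun=> 1) z p1.
rewrite ltr0n => /(_ isT (fun=> ltr01)); rewrite sumr_const card_ord => /(_ (lexx _)).
by under [X in _ <= _ * X]eq_bigr do rewrite divr1 mul1r.
Qed.

(** Jensen's inequality for the density k of mass at most M, applied to phi.
    When the right-hand side is infinite there is nothing to prove; otherwise
    the tangent inequality at l = 1 shows that phi * k is integrable. *)
Lemma integral_powR_le d (T : measurableType d) (R : realType)
    (mu : {measure set T -> \bar R}) (p M : R) (k phi : T -> R) :
  1 <= p -> 0 < M -> measurable_fun [set: T] k -> (forall x, 0 <= k x) ->
  measurable_fun [set: T] phi -> (\int[mu]_x (k x)%:E <= M%:E)%E ->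
  ((`|\int[mu]_x (phi x * k x)| `^ p)%:E <=
   (M `^ (p - 1))%:E * \int[mu]_x (`|phi x| `^ p * k x)%:E)%E.
Proof.
move=> p1 M0 mk k0 mphi kM.
have mpk : measurable_fun [set: T] (EFin \o (fun x => `|phi x| `^ p * k x)).
  apply/measurable_EFinP; apply: measurable_funM => //.
  by apply: (measurableT_comp (measurable_powR _)); exact: measurableT_comp.
have maf : measurable_fun [set: T] (fun x => (`|phi x| * k x)%:E).
  by apply/measurable_EFinP; apply: measurable_funM => //; exact: measurableT_comp.
have pk0 x : 0 <= `|phi x| `^ p * k x by rewrite mulr_ge0 ?powR_ge0.
have [/eqP J|/negP J] := boolP (\int[mu]_x (`|phi x| `^ p * k x)%:E == +oo)%E.
  by rewrite J gt0_muley ?leey// lte_fin powR_gt0.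
have Jfin : (\int[mu]_x (`|phi x| `^ p * k x)%:E)%E \is a fin_num.
  rewrite ge0_fin_numE ?ltey; first exact/negP.
  by apply: integral_ge0 => x _; rewrite lee_fin.
have bound l : 0 <= l ->
    ((p * l `^ (p - 1))%:E * \int[mu]_x (`|phi x| * k x)%:E <=
     \int[mu]_x (`|phi x| `^ p * k x)%:E + ((p - 1) * l `^ p * M)%:E)%E.
  move=> l0; have lp0 : 0 <= (p - 1) * l `^ p by rewrite mulr_ge0 ?powR_ge0//; lra.
  apply: (@le_trans _ _ (\int[mu]_x ((`|phi x| `^ p * k x)%:E + ((p - 1) * l `^ p)%:E * (k x)%:E))%E).
    rewrite -ge0_integralZl//; last 2 first.
    - by move=> x _; rewrite lee_fin mulr_ge0.
    - by rewrite lee_fin mulr_ge0 ?powR_ge0//; lra.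
    apply: le_integral_nomeas => x.
      by rewrite -EFinM lee_fin !mulr_ge0 ?powR_ge0//; lra.
    rewrite -!EFinM -EFinD lee_fin !mulrA -mulrDl ler_wpM2r//.
    exact: young_tangent.
  rewrite ge0_integralD//; last 3 first.
  - by move=> x _; rewrite lee_fin.
  - by move=> x _; rewrite -EFinM lee_fin mulr_ge0.
  - by apply: measurable_funeM; exact/measurable_EFinP.
  rewrite leeD2l// ge0_integralZl//; last 2 first.
  - exact/measurable_EFinP.
  - by move=> x _; rewrite lee_fin.
  by rewrite [leRHS]EFinM lee_wpmul2l.
have Ifin : (\int[mu]_x (`|phi x| * k x)%:E)%E \is a fin_num.
  rewrite ge0_fin_numE; last by apply: integral_ge0 => x _; rewrite lee_fin mulr_ge0.
  have := bound 1 ler01; rewrite powR1 mulr1 => b1.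
  have : ((p%:E * \int[mu]_x (`|phi x| * k x)%:E) < +oo)%E.
    by apply: (le_lt_trans b1); rewrite -(fineK Jfin) -EFinD ltry.
  rewrite !ltey; apply: contra => /eqP ->; rewrite gt0_muley// lte_fin; lra.
have intpk : mu.-integrable [set: T] (EFin \o (fun x => phi x * k x)).
  apply/integrableP; split; first by apply/measurable_EFinP; exact: measurable_funM.
  under eq_integral => x _ do rewrite /= normrM (ger0_norm (k0 x)).
  by rewrite ltey_eq Ifin.
rewrite -(fineK Jfin) -EFinM lee_fin.
apply: (@le_trans _ _ (fine (\int[mu]_x (`|phi x| * k x)%:E) `^ p)).
  rewrite ge0_ler_powR ?nnegrE//; first lra.
    by apply: fine_ge0; apply: integral_ge0 => x _; rewrite lee_fin mulr_ge0.
  have := le_normr_Rintegral measurableT intpk.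
  rewrite /Rintegral; congr (_ <= fine _); apply: eq_integral => x _ /=.
  by rewrite normrM (ger0_norm (k0 x)).
apply: power_from_tangents => //.
  by apply: fine_ge0; apply: integral_ge0 => x _; rewrite lee_fin mulr_ge0.
move=> l l0; have := bound l l0.
by rewrite -{1}(fineK Ifin) -{1}(fineK Jfin) -EFinM -EFinD lee_fin.
Qed.

Lemma cvg_powRN_pinfty (R : realType) (a : R) : 0 < a ->
  (1 + x) `^ (- a) @[x --> +oo] --> (0 : R).
Proof.
move=> a0; apply/cvgr0Pnorm_lt => e e0.
near=> x; have x0 : 0 < x by near: x; exact: nbhs_pinfty_gt.
have xe : e^-1 `^ a^-1 < x by near: x; apply: nbhs_pinfty_gt; exact: num_real.
rewrite ger0_norm ?powR_ge0// powRN invf_plt ?posrE ?powR_gt0//; last lra.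
have -> : e^-1 = (e^-1 `^ a^-1) `^ a.
  by rewrite -powRrM mulVf ?gt_eqF// powRr1// invr_ge0 ltW.
rewrite gt0_ltr_powR// ?nnegrE ?powR_ge0//; lra.
Unshelve. all: by end_near. Qed.

Lemma integral_powR_lty (R : realType) (g : R) : 1 < g ->
  (\int[lebesgue_measure]_x ((1 + `|x|) `^ (- g))%:E < +oo :> \bar R)%E.
Proof.
move=> g1.
have dpow (b x : R) : 0 <= x -> is_derive x 1 (fun y => (1 + y) `^ b) (b * (1 + x) `^ (b - 1)).
  move=> x0; have x1 : 0 < 1 + x by lra.
  have H1 : is_derive x 1 (fun y : R => 1 + y) 1.
    have := @is_deriveD _ _ _ (cst (1 : R)) id x 1 0 1 (is_derive_cst _ _ _) (is_derive_id _ _).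
    by rewrite add0r.
  have := is_derive1_comp (is_derive1_powR b x1) H1.
  by rewrite mulr1.
have cw : continuous (fun x : R => (1 + `|x|) `^ (- g)).
  move=> x; apply: (@continuous_comp _ _ _ (fun x : R => `|x|) (fun y => (1 + y) `^ (- g))).
    exact: norm_continuous.
  apply: differentiable_continuous; apply/derivable1_diffP.
  by have [] := dpow (- g) `|x| (normr_ge0 x).
rewrite ge0_symfun_integralT//; last by move=> x /=; rewrite normrN.
rewrite -set_itvcy (@ge0_continuous_FTC2y _ _ (fun x => (1 - g)^-1 * (1 + x) `^ (1 - g)) 0 0)//.
- by rewrite -EFinB -EFinM ltry.
- exact: continuous_subspaceT.
- rewrite -(mulr0 (1 - g)^-1); apply: cvgMr; rewrite -opprB; apply: cvg_powRN_pinfty; lra.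
- by move=> x x0; apply: derivableM => //; have [] := dpow (1 - g) x (ltW x0).
- apply: cvgMr; apply: cvg_at_right_filter.
  have : {for 0, continuous (fun x : R => (1 + x) `^ (1 - g))}.
    apply: differentiable_continuous; apply/derivable1_diffP.
    by have [] := dpow (1 - g) 0 (lexx _).
  exact.
- move=> x; rewrite in_itv/= andbT => x0.
  have D := is_deriveZ (1 - g)^-1 (dpow (1 - g) x (ltW x0)).
  rewrite derive1E (@derive_val _ _ _ _ _ _ _ D).
  rewrite scalerA mulVf ?scale1r; last lra.
  by rewrite (ger0_norm (ltW x0)) addrAC subrr sub0r.
Qed.

(** * Layer cake *)

Lemma measurable_indic_lt d (T : measurableType d) (R : realType) (f g : T -> R) :
  measurable_fun [set: T] f -> measurable_fun [set: T] g ->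
  measurable_fun [set: T] (fun x => (f x < g x)%R%:R : R).
Proof.
move=> mf mg; have mlt := measurable_fun_ltr mf mg.
have -> : (fun x => (f x < g x)%R%:R : R) = \1_[set x | f x < g x].
  by apply/funext => x; rewrite indicE; congr (nat_of_bool _)%:R; apply/idP/idP; rewrite inE.
apply: measurable_indic; rewrite -[X in measurable X]setTI.
exact: (mlt measurableT [set true]).
Qed.

Lemma measurable_indic_le_lt d (T : measurableType d) (R : realType) (f g : T -> R) :
  measurable_fun [set: T] f -> measurable_fun [set: T] g ->
  measurable_fun [set: T] (fun x => (0 <= f x < g x)%R%:R : R).
Proof.
move=> mf mg.
have -> : (fun x => (0 <= f x < g x)%R%:R : R) =
    (fun x => (1 - (f x < 0)%R%:R) * (f x < g x)%R%:R).
  by apply/funext => x; rewrite leNgt; case: ltP => //= _; rewrite ?subr0 ?mul1r ?subrr ?mul0r.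
apply: measurable_funM; last exact: measurable_indic_lt.
by apply: measurable_funB => //; exact: measurable_indic_lt.
Qed.

(** Write eta w as the length of [0, eta w) and exchange the integrals. *)
Lemma layer_cake d (T : measurableType d) (R : realType)
    (mu : {sigma_finite_measure set T -> \bar R}) (f eta : T -> R) :
  measurable_fun [set: T] f -> (forall w, 0 <= f w) ->
  measurable_fun [set: T] eta -> (forall w, 0 <= eta w) ->
  (\int[mu]_w (f w * eta w)%:E =
   \int[lebesgue_measure]_t \int[mu]_w (f w * (0 <= t < eta w)%R%:R)%:E)%E.
Proof.
move=> mf f0 me e0.
have H := @fubini_tonelli _ _ T (measurableTypeR R) R mu (@lebesgue_measure R)
  (fun z => (f z.1 * (0 <= (z.2 : R) < eta z.1)%R%:R)%:E).
rewrite -H; last 2 first.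
- apply/measurable_EFinP; apply: measurable_funM; first exact: measurableT_comp.
  by apply: measurable_indic_le_lt; [exact: measurable_snd|exact: measurableT_comp].
- by move=> z; rewrite lee_fin mulr_ge0.
apply: eq_integral => w _ /=.
under eq_integral => t _ do rewrite EFinM.
rewrite ge0_integralZl//; last 2 first.
- apply/measurable_EFinP; by apply: measurable_indic_le_lt.
- by rewrite lee_fin.
rewrite EFinM; congr (_ * _)%E.
have lenE : (\int[lebesgue_measure]_t (\1_(`[0, eta w[%classic) t)%:E = (eta w)%:E :> \bar R)%E.
  have := @integral_indic _ _ R (@lebesgue_measure R) setT measurableT _ (measurable_itv `[0, eta w[).
  move=> iE; rewrite [LHS]iE; apply: (etrans (congr1 (@lebesgue_measure R) (setIT `[0, eta w[%classic))).
  rewrite lebesgue_measure_itv/= lte_fin.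
  by case: ltgtP (e0 w) => // [_|<-] _; rewrite ?sube0.
rewrite -[LHS]lenE; apply: eq_integral => t _.
by rewrite indicE mem_setE in_itv.
Qed.

(** An inequality tested on the level sets of psi extends to psi itself. *)
Lemma layer_cake_le d (T : measurableType d) (R : realType)
    (mu : {sigma_finite_measure set T -> \bar R}) (f1 f2 psi : T -> R) :
  measurable_fun [set: T] f1 -> (forall w, 0 <= f1 w) ->
  measurable_fun [set: T] f2 -> (forall w, 0 <= f2 w) ->
  measurable_fun [set: T] psi -> (forall w, 0 <= psi w) ->
  (forall v, 0 <= v ->
    (\int[mu]_(w in [set w | (v < psi w)%R]) (f1 w)%:E <=
     \int[mu]_(w in [set w | (v < psi w)%R]) (f2 w)%:E)%E) ->
  (\int[mu]_w (f1 w * psi w)%:E <= \int[mu]_w (f2 w * psi w)%:E)%E.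
Proof.
move=> mf1 f10 mf2 f20 mpsi psi0 H; rewrite !layer_cake//.
apply: le_integral_nomeas => t.
  by apply: integral_ge0 => w _; rewrite lee_fin mulr_ge0.
have [t0|t0] := leP 0 t; last first.
  by rewrite !integral0_eq// => w _; rewrite mulr0.
have E (f : T -> R) : (\int[mu]_w (f w * (true && (t < psi w)%R)%:R)%:E =
    \int[mu]_(w in [set w | (t < psi w)%R]) (f w)%:E)%E.
  rewrite [RHS]integral_mkcond; apply: eq_integral => w _.
  rewrite patchE; case: ifPn; rewrite ?inE ?notin_setE /=.
    by move=> ->; rewrite mulr1.
  by move/negP/negbTE => ->; rewrite mulr0.
by rewrite !E; exact: H.
Qed.

(** * Conditional distributions and half lines *)

Lemma measure_shrink d (T : measurableType d) (R : realType)
    (m : {measure set T -> \bar R}) (S : nat -> set T) (e : R) :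
  (m [set: T] < +oo)%E -> (forall n, measurable (S n)) ->
  (forall n k, (n <= k)%N -> S k `<=` S n) -> \bigcap_n S n = set0 -> 0 < e ->
  \forall n \near \oo, (m (S n) < e%:E)%E.
Proof.
move=> mT mS Sd S0 e0.
have := @nonincreasing_cvg_mu _ _ _ m S.
rewrite S0 measure0 => H; have {}H : m \o S @ \oo --> (0 : \bar R)%E.
  apply: H => //.
  - by apply: le_lt_trans mT; apply: le_measure; rewrite ?inE.
  - by move=> n k nk; rewrite subsetEset; exact: Sd.
apply: (H [set x | (x < e%:E)%E]).
apply: open_nbhs_nbhs; split; last by rewrite /= lte_fin.
exact: open_ereal_lt_ereal.
Qed.

(** The control of two probability measures on rational half lines passes to
    every set closed downwards, whether or not it contains its end point. *)
Lemma half_line_gap (R : realType) (m Q : {measure set R -> \bar R}) (g : \bar R)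
    (A : set R) :
  m [set: R] = 1%E -> Q [set: R] = 1%E ->
  (forall x : rat, (`|m `]-oo, (ratr x : R)]%classic - Q `]-oo, (ratr x : R)]%classic| <= g)%E) ->
  (forall x y, x <= y -> A y -> A x) ->
  measurable A /\ (`|m A - Q A| <= g)%E.
Proof.
move=> m1 Q1 H dA.
have g0 : (0 <= g)%E by apply: le_trans (H 0); exact: abse_ge0.
have mfin (B : set R) : measurable B -> m B \is a fin_num.
  move=> mB; rewrite ge0_fin_numE//; apply: (@le_lt_trans _ _ 1%E); last exact: ltry.
  by rewrite -m1; apply: le_measure; rewrite ?inE.
have Qfin (B : set R) : measurable B -> Q B \is a fin_num.
  move=> mB; rewrite ge0_fin_numE//; apply: (@le_lt_trans _ _ 1%E); last exact: ltry.
  by rewrite -Q1; apply: le_measure; rewrite ?inE.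
(* Unless empty or full, A ends at its supremum: it is a rational half line up
   to a set of small mass for both measures. *)
suff approx : A = set0 \/ A = [set: R] \/ measurable A /\ (forall e : R, 0 < e -> exists x : rat,
    exists2 D, measurable D /\ (m D < e%:E)%E /\ (Q D < e%:E)%E &
    A `<=` `]-oo, (ratr x : R)] `|` D /\ `]-oo, (ratr x : R)] `<=` A `|` D).
  case: approx => [->|[->|[mA approx]]].
  - by rewrite !measure0 subee// abse0.
  - by rewrite m1 Q1 subee// abse0.
  split => //; apply/lee_addgt0Pr => e e0.
  have [x [D [mD [mDe QDe]] [AD DA]]] := approx (e / 2) ltac:(by rewrite divr_gt0).
  have mI : measurable `]-oo, (ratr x : R)]%classic by exact: measurable_itv.
  have up (n : {measure set R -> \bar R}) : (n D < (e / 2)%:E -> n A <= n `]-oo, (ratr x : R)]%classic + (e / 2)%:E)%E.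
    move=> nD; apply: (@le_trans _ _ (n (`]-oo, (ratr x : R)]%classic `|` D))).
      by apply: le_measure; rewrite ?inE//; exact: measurableU.
    by apply: (le_trans (measureU2 _ mI mD)) => //; rewrite leeD2l// ltW.
  have lo (n : {measure set R -> \bar R}) : (n D < (e / 2)%:E -> n `]-oo, (ratr x : R)]%classic <= n A + (e / 2)%:E)%E.
    move=> nD; apply: (@le_trans _ _ (n (A `|` D))).
      by apply: le_measure; rewrite ?inE//; exact: measurableU.
    by apply: (le_trans (measureU2 _ mA mD)) => //; rewrite leeD2l// ltW.
  have := H x; have := up m mDe; have := up Q QDe; have := lo m mDe; have := lo Q QDe.
  move=> {H}; case: g g0 => [g _|_|]; last 2 first.
  - by move=> *; rewrite addye// leey.
  - by [].
  rewrite -(fineK (mfin _ mI)) -(fineK (Qfin _ mI)) -(fineK (mfin _ mA)) -(fineK (Qfin _ mA)).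
  rewrite -!EFinD /= !lee_fin; rewrite !ler_norml => *; apply/andP; split; lra.
have [->|/set0P[a0 Aa0]] := eqVneq A set0; [by left|right].
have [ubA|nubA] := pselect (has_ubound A); last first.
  left; apply/seteqP; split => // x _; apply: contrapT => Ax; apply: nubA.
  exists x => y Ay; rewrite leNgt; apply/negP => /ltW xy; exact: Ax (dA _ _ xy Ay).
right; have sA : has_sup A by split => //; exists a0.
pose c := sup A.
have Alt x : x < c -> A x.
  by move=> /(sup_gt (ex_intro _ _ Aa0))[y Ay xy]; exact: dA (ltW xy) Ay.
have Ac x : A x -> x <= c by move=> Ax; exact: ub_le_sup.
have mlt : (m [set: R] < +oo)%E by rewrite m1 ltry.
have Qlt : (Q [set: R] < +oo)%E by rewrite Q1 ltry.
have [cA|cA] := pselect (A c).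
- have AE : A = `]-oo, c]%classic.
    by apply/seteqP; split => x /=; rewrite in_itv/=; [exact: Ac|move=> /dA; exact].
  split; first by rewrite AE; exact: measurable_itv.
  move=> e e0; pose S (n : nat) := `]c, c + n.+1%:R^-1]%classic.
  have Sd n k : (n <= k)%N -> S k `<=` S n.
    move=> nk x; rewrite /S /= !in_itv/= => /andP[-> /le_trans]; apply.
    by rewrite lerD2l lef_pV2 ?posrE// ler_nat.
  have S0 : \bigcap_n S n = set0.
    apply/seteqP; split => // x Sx.
    have := Sx 0%N Logic.I; rewrite /S /= in_itv/= => /andP[cx _].
    have := Sx (Num.truncn (x - c)^-1) Logic.I; rewrite /S/= in_itv/= => /andP[_].
    rewrite -lerBlDl leNgt => /negP; apply.
    by rewrite invf_plt ?posrE ?subr_gt0// truncnS_gt.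
  have mS n : measurable (S n) by exact: measurable_itv.
  have [N _ HN] := measure_shrink mlt mS Sd S0 e0.
  have [N' _ HN'] := measure_shrink Qlt mS Sd S0 e0.
  pose k := maxn N N'.
  have [x xc] : exists x : rat, (ratr x : R) \in `]c, c + k.+1%:R^-1[.
    by have [x] := @rat_in_itvoo R c (c + k.+1%:R^-1) ltac:(by rewrite ltrDl invr_gt0 ltr0n); exists x.
  exists x, (S k).
    by split => //; split; [apply: HN|apply: HN']; rewrite /= /k ?leq_maxl ?leq_maxr.
  move: xc; rewrite in_itv/= => /andP[cx xk]; rewrite AE; split => y /=; rewrite /S /= !in_itv/=.
    by move=> yc; left; rewrite (le_trans yc)// ltW.
  by move=> yx; have [yc|yc] := leP y c; [by left|right]; rewrite /= ltW// (le_lt_trans yx).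
- have AE : A = `]-oo, c[%classic.
    apply/seteqP; split => x /=; rewrite in_itv/=; last exact: Alt.
    by move=> Ax; rewrite lt_neqAle Ac// andbT; apply/negP => /eqP xc; rewrite xc in Ax.
  split; first by rewrite AE; exact: measurable_itv.
  move=> e e0; pose S (n : nat) := `[c - n.+1%:R^-1, c[%classic.
  have Sd n k : (n <= k)%N -> S k `<=` S n.
    move=> nk x; rewrite /S /= !in_itv/= => /andP[+ ->]; rewrite andbT; apply: le_trans.
    by rewrite lerD2l lerN2 lef_pV2 ?posrE// ler_nat.
  have S0 : \bigcap_n S n = set0.
    apply/seteqP; split => // x Sx.
    have := Sx 0%N Logic.I; rewrite /S /= in_itv/= => /andP[_ cx].
    have := Sx (Num.truncn (c - x)^-1) Logic.I; rewrite /S/= in_itv/= => /andP[+ _].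
    rewrite lerBlDr -lerBlDl leNgt => /negP; apply.
    by rewrite invf_plt ?posrE ?subr_gt0// truncnS_gt.
  have mS n : measurable (S n) by exact: measurable_itv.
  have [N _ HN] := measure_shrink mlt mS Sd S0 e0.
  have [N' _ HN'] := measure_shrink Qlt mS Sd S0 e0.
  pose k := maxn N N'.
  have [x xc] : exists x : rat, (ratr x : R) \in `]c - k.+1%:R^-1, c[.
    by have [x] := @rat_in_itvoo R (c - k.+1%:R^-1) c ltac:(by rewrite ltrBlDr ltrDl invr_gt0 ltr0n); exists x.
  exists x, (S k).
    by split => //; split; [apply: HN|apply: HN']; rewrite /= /k ?leq_maxl ?leq_maxr.
  move: xc; rewrite in_itv/= => /andP[cx xk]; rewrite AE; split => y /=; rewrite /S /= !in_itv/=.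
    by move=> yc; have [yx|yx] := leP y (ratr x); [by left|right]; rewrite yc andbT ltW// (lt_trans cx).
  by move=> yx; left; rewrite (le_lt_trans yx).
Qed.

Lemma measurable_fun_sub_sigma d (T : measurableType d) (R : realType)
    (G : set (set T)) (f : T -> \bar R) :
  G `<=` measurable -> measurable_fun [set: g_sigma_algebraType G] f ->
  measurable_fun [set: T] f.
Proof.
move=> mG mf _ B mB; have := mf measurableT B mB.
exact: (smallest_sub (sigma_algebra_measurable T) mG).
Qed.

Section conditional_gap.
Context {R : realType} {d : measure_display} {T : measurableType d}.
Context (G : set (set T)) (mG : G `<=` measurable).
Context (kap : R.-pker (g_sigma_algebraType G) ~> R) (Q : {measure set R -> \bar R}).
Hypothesis Q1 : Q [set: R] = 1%E.

Let qpt (n : nat) : R := ratr (odflt 0 (unpickle n : option rat)).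
Let gap_seq (w : T) (n : nat) : \bar R :=
  (`|kap w `]-oo, qpt n]%classic - Q `]-oo, qpt n]%classic|)%E.

(** Restricting the thresholds to rationals makes the supremum measurable; by
    right continuity of distribution functions its value is unchanged. *)
Definition rational_gap (w : T) : R := fine (esups (gap_seq w) 0%N).

Let kap1 w : kap w [set: R] = 1%E.
Proof. exact: prob_kernel. Qed.

Let prob_le1 (m : {measure set R -> \bar R}) (B : set R) :
  m [set: R] = 1%E -> measurable B -> (m B <= 1)%E.
Proof. by move=> m1 mB; rewrite -m1; apply: le_measure; rewrite ?inE. Qed.

Let prob_fin (m : {measure set R -> \bar R}) (B : set R) :
  m [set: R] = 1%E -> measurable B -> m B \is a fin_num.
Proof.
move=> m1 mB; rewrite ge0_fin_numE//; apply: (le_lt_trans (prob_le1 m1 mB)).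
exact: ltry.
Qed.

Lemma prob_gap_le1 w (x : R) : (`|kap w `]-oo, x]%classic - Q `]-oo, x]%classic| <= 1)%E.
Proof.
have mI : measurable `]-oo, x]%classic by exact: measurable_itv.
have := prob_le1 (kap1 w) mI; have := prob_le1 Q1 mI.
have : (0 <= kap w `]-oo, x]%classic)%E by [].
have : (0 <= Q `]-oo, x]%classic)%E by [].
rewrite -(fineK (prob_fin (kap1 w) mI)) -(fineK (prob_fin Q1 mI)).
rewrite -EFinD /= !lee_fin ler_norml => *; apply/andP; split; lra.
Qed.

Let esups_le1 w : (esups (gap_seq w) 0%N <= 1)%E.
Proof. by apply: ge_ereal_sup => _ [n _ <-]; exact: prob_gap_le1. Qed.

Let esups_ge0 w : (0 <= esups (gap_seq w) 0%N)%E.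
Proof.
apply: (@le_trans _ _ (gap_seq w 0%N)); first exact: abse_ge0.
by apply: ereal_sup_ubound; exists 0%N.
Qed.

Let rational_gapE w : ((rational_gap w)%:E = esups (gap_seq w) 0%N)%E.
Proof.
rewrite /rational_gap fineK// ge0_fin_numE//.
by apply: (le_lt_trans (esups_le1 w)); exact: ltry.
Qed.

Lemma rational_gap_ge0 w : 0 <= rational_gap w.
Proof. by rewrite -lee_fin rational_gapE. Qed.

Lemma rational_gap_le1 w : rational_gap w <= 1.
Proof. by rewrite -lee_fin rational_gapE. Qed.

Lemma measurable_kernel_at_set (B : set R) : measurable B -> measurable_fun [set: T] (kap ^~ B).
Proof. by move=> mB; apply: (measurable_fun_sub_sigma mG); exact: measurable_kernel. Qed.

Lemma measurable_rational_gap : measurable_fun [set: T] rational_gap.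
Proof.
apply: (@measurableT_comp _ _ _ _ _ _ fine) => //.
apply: measurable_fun_esups => n; apply: measurableT_comp => //.
apply: emeasurable_funB => //; apply: measurable_kernel_at_set; exact: measurable_itv.
Qed.

Lemma rational_gap_le_sup w :
  ((rational_gap w)%:E <= ereal_sup (range (fun t : R =>
    `|kap w `]-oo, t]%classic - Q `]-oo, t]%classic|)))%E.
Proof.
rewrite rational_gapE; apply: ge_ereal_sup => _ [n _ <-].
by apply: ereal_sup_ubound; exists (qpt n).
Qed.

Definition half_line (A : set R) :=
  (forall x y, x <= y -> A y -> A x) \/ (forall x y, x <= y -> A x -> A y).

(** Sets closed upwards are handled through their complement. *)
Lemma rational_gap_half_line w A : half_line A ->
  measurable A /\ (`|kap w A - Q A| <= (rational_gap w)%:E)%E.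
Proof.
have key (x : rat) : (`|kap w `]-oo, (ratr x : R)]%classic - Q `]-oo, (ratr x : R)]%classic|
    <= (rational_gap w)%:E)%E.
  rewrite rational_gapE; apply: ereal_sup_ubound; exists (pickle x) => //.
  by rewrite /gap_seq /qpt pickleK.
case=> dA; first exact: (half_line_gap (kap1 w) Q1 key dA).
have [mA gA] := half_line_gap (A := ~` A) (kap1 w) Q1 key
  (fun x y xy Ay Ax => Ay (dA x y xy Ax)).
have mA' : measurable A by rewrite -(setCK A); exact: measurableC.
split => //; move: gA.
have kC : (kap w (~` A) = 1 - kap w A)%E.
  rewrite -setTD measureD//.
    by rewrite setTI; congr (_ - _)%E; exact: kap1.
  by apply: (@le_lt_trans _ _ 1%E); [rewrite -(kap1 w)|exact: ltry].
have QC : (Q (~` A) = 1 - Q A)%E.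
  rewrite -setTD measureD//.
    by rewrite setTI; congr (_ - _)%E; exact: Q1.
  by apply: (@le_lt_trans _ _ 1%E); [rewrite -Q1|exact: ltry].
rewrite kC QC -(fineK (prob_fin (kap1 w) mA')) -(fineK (prob_fin Q1 mA')).
rewrite -!EFinD /= !lee_fin.
by rewrite (_ : 1 - _ - _ = - (fine (kap w A) - fine (Q A))) ?normrN//; ring.
Qed.

Context (Pr : probability T R) (X : {RV Pr >-> R}) (condX : cond_distribution X kap).

(** Integrating against psi, which depends on the past only, replaces the
    indicator of X in H by its conditional probability, and that differs from
    the marginal one by at most the gap. *)
Lemma cond_half_line (H : set R) (psi : T -> R) :
  half_line H -> measurable_fun [set: T] psi -> (forall w, 0 <= psi w) ->
  (forall v, G.-sigma.-measurable [set w | v < psi w]) ->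
  (\int[Pr]_w (\1_H (X w) * psi w)%:E <=
     \int[Pr]_w ((fine (Q H) + rational_gap w) * psi w)%:E)%E /\
  (\int[Pr]_w (fine (Q H) * psi w)%:E <=
     \int[Pr]_w ((\1_H (X w) + rational_gap w) * psi w)%:E)%E.
Proof.
move=> hH mpsi psi0 Gpsi.
have [mH _] := rational_gap_half_line point hH.
have mrg := measurable_rational_gap.
have m1 : measurable_fun [set: T] (fun w => \1_H (X w) : R).
  exact: (measurableT_comp (measurable_indic mH)).
have Q0 : 0 <= fine (Q H) by rewrite fine_ge0.
have subm v : measurable [set w | v < psi w].
  by have := Gpsi v; exact: (smallest_sub (sigma_algebra_measurable T) mG).
have condE v : (\int[Pr]_(w in [set w | (v < psi w)%R]) (\1_H (X w))%:E =
    \int[Pr]_(w in [set w | (v < psi w)%R]) kap w H)%E.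
  rewrite condX//; have -> : (fun w => (\1_H (X w))%:E : \bar R) =
    (fun w => (\1_(X @^-1` H) w)%:E) by apply/funext => w; rewrite !indicE.
  rewrite integral_indic//; first by rewrite setIC.
  by rewrite -[X in measurable X]setTI; exact: measurable_funP.
have gap w := (rational_gap_half_line w hH).2.
have kf w := prob_fin (kap1 w) mH.
have Qf := prob_fin Q1 mH.
split; apply: layer_cake_le => //.
- by apply: measurable_funD.
- by move=> w; rewrite addr_ge0// rational_gap_ge0.
- move=> v v0; rewrite condE; apply: ge0_le_integral => //.
  + by apply: measurable_funTS; exact: measurable_kernel_at_set.
  + by apply: measurable_funTS; apply/measurable_EFinP; apply: measurable_funD.
  + move=> w _; have := gap w; rewrite -(fineK (kf w)) -{1}(fineK Qf).
    by rewrite -!EFinD /= !lee_fin ler_norml => /andP[_]; rewrite lerBlDl.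
- by apply: measurable_funD.
- by move=> w; rewrite addr_ge0// rational_gap_ge0.
- move=> v v0.
  under [leRHS]eq_integral do rewrite EFinD.
  rewrite ge0_integralD//; last 3 first.
  + by apply: measurable_funTS; exact/measurable_EFinP.
  + by move=> w _; rewrite lee_fin rational_gap_ge0.
  + by apply: measurable_funTS; exact/measurable_EFinP.
  rewrite condE -ge0_integralD//; last 3 first.
  + by apply: measurable_funTS; exact: measurable_kernel_at_set.
  + by move=> w _; rewrite lee_fin rational_gap_ge0.
  + by apply: measurable_funTS; exact/measurable_EFinP.
  apply: ge0_le_integral => //.
  + by apply: measurable_funTS; apply: emeasurable_funD; [exact: measurable_kernel_at_set|exact/measurable_EFinP].
  + move=> w _; have := gap w; rewrite -(fineK (kf w)) -{1}(fineK Qf).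
    by rewrite -!EFinD /= !lee_fin ler_norml => /andP[+ _]; lra.
Qed.

End conditional_gap.

Section covariance.
Context {R : realType} {d : measure_display} {T : measurableType d}.
Context (Pr : probability T R) (G : set (set T)) (mG : G `<=` measurable).
Context (kap : R.-pker (g_sigma_algebraType G) ~> R) (Q : {measure set R -> \bar R}).
Hypothesis Q1 : Q [set: R] = 1%E.
Context (X : {RV Pr >-> R}) (condX : cond_distribution X kap).
Hypothesis XQ : forall B, measurable B -> Pr (X @^-1` B) = Q B.
Let rg := rational_gap kap Q.

Lemma measurable_layer_int d' (S : measurableType d') (mu : {sigma_finite_measure set S -> \bar R})
    (psi eta : S -> R) :
  measurable_fun [set: S] psi -> (forall w, 0 <= psi w) -> measurable_fun [set: S] eta ->
  measurable_fun [set: R] (fun t : R => \int[mu]_w (psi w * (0 <= t < eta w)%R%:R)%:E)%E.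
Proof.
move=> mpsi psi0 meta.
apply: (@measurable_fun_fubini_tonelli_G _ _ S (measurableTypeR R) R mu
  (fun z => (psi z.1 * (0 <= (z.2 : R) < eta z.1)%R%:R)%:E)) => //=.
- apply/measurable_EFinP; apply: measurable_funM; first exact: measurableT_comp.
  by apply: measurable_indic_le_lt; [exact: measurable_snd|exact: measurableT_comp].
- by move=> z; rewrite lee_fin mulr_ge0.
Qed.

(** The layer cake decomposition of u reduces the covariance to level sets of
    u, which are half lines; each level t in [0, V) contributes at most the
    integral of the gap times psi. *)
Lemma cond_covariance_le (V : R) (psi : T -> R) (u : R -> R) :
  0 <= V -> measurable_fun [set: R] u -> (forall x, 0 <= u x <= V) ->
  (forall t, half_line [set x | t < u x]) ->
  measurable_fun [set: T] psi -> (forall w, 0 <= psi w) ->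
  (forall v, G.-sigma.-measurable [set w | v < psi w]) ->
  (\int[Pr]_w (psi w * u (X w))%:E <=
     \int[Pr]_w (psi w)%:E * \int[Pr]_w (u (X w))%:E +
     V%:E * \int[Pr]_w (rg w * psi w)%:E)%E /\
  (\int[Pr]_w (psi w)%:E * \int[Pr]_w (u (X w))%:E <=
     \int[Pr]_w (psi w * u (X w))%:E +
     V%:E * \int[Pr]_w (rg w * psi w)%:E)%E.
Proof.
move=> V0 mu_ uV hu mpsi psi0 Gpsi.
have mX : measurable_fun [set: T] X by exact: measurable_funP.
have muX : measurable_fun [set: T] (u \o X) by exact: measurableT_comp.
have uX0 w : 0 <= (u \o X) w by have /andP[] := uV (X w).
have mrg : measurable_fun [set: T] rg by exact: measurable_rational_gap.
have rg0 w : 0 <= rg w by exact: rational_gap_ge0.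
set S := (\int[Pr]_w (rg w * psi w)%:E)%E.
set P := (\int[Pr]_w (psi w)%:E)%E.
have S0 : (0 <= S)%E by apply: integral_ge0 => w _; rewrite lee_fin mulr_ge0.
have P0 : (0 <= P)%E by apply: integral_ge0 => w _; rewrite lee_fin.
pose g t := (\int[Pr]_w (psi w * (0 <= t < u (X w))%R%:R)%:E)%E.
pose k t := (\int[Pr]_w (1 * (0 <= t < u (X w))%R%:R)%:E)%E.
have mg : measurable_fun [set: R] g by exact: measurable_layer_int.
have mk : measurable_fun [set: R] k by exact: measurable_layer_int.
have g0 t : (0 <= g t)%E by apply: integral_ge0 => w _; rewrite lee_fin mulr_ge0.
have k0 t : (0 <= k t)%E by apply: integral_ge0 => w _; rewrite lee_fin mulr_ge0.
have gE : (\int[Pr]_w (psi w * u (X w))%:E = \int[lebesgue_measure]_t g t)%E.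
  exact: (layer_cake Pr mpsi psi0 muX uX0).
have kE : (\int[Pr]_w (u (X w))%:E = \int[lebesgue_measure]_t k t)%E.
  rewrite -(@layer_cake _ _ _ Pr (cst 1) _ (measurable_cst _) (fun=> ler01) muX uX0).
  by apply: eq_integral => w _; rewrite mul1r.
pose c (t : R) : \bar R := ((\1_(`[0, V[%classic) t)%:E * S)%E.
have c0 t : (0 <= c t)%E by rewrite mule_ge0// lee_fin.
have mc : measurable_fun [set: R] c.
  apply: emeasurable_funM => //; apply/measurable_EFinP.
  by apply: measurable_indic; exact: measurable_itv.
have cE : (\int[lebesgue_measure]_t c t = V%:E * S)%E.
  rewrite ge0_integralZr//; last first.
    by apply/measurable_EFinP; apply: measurable_indic; exact: measurable_itv.
  congr (_ * _)%E; have iE := @integral_indic _ _ R (@lebesgue_measure R) setT measurableT _ (measurable_itv `[0, V[).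
  rewrite [LHS]iE; apply: (etrans (congr1 (@lebesgue_measure R) (setIT `[0, V[%classic))).
  rewrite lebesgue_measure_itv/= lte_fin.
  by case: ltgtP (V0) => // [_|<-] _; rewrite ?sube0.
have mPk : measurable_fun [set: R] (fun t => P * k t)%E by exact: measurable_funeM.
have layer t : (g t <= P * k t + c t)%E /\ (P * k t <= g t + c t)%E.
  have [tV|tV] := boolP (t \in `[0, V[); last first.
    have z w : (0 <= t < u (X w)) = false.
      apply/negbTE; apply: contra tV => /andP[t0 tu]; rewrite in_itv/= t0/=.
      by apply: (lt_le_trans tu); have /andP[] := uV (X w).
    have -> : g t = 0%E by rewrite /g integral0_eq// => w _; rewrite z mulr0.
    have -> : k t = 0%E by rewrite /k integral0_eq// => w _; rewrite z mulr0.
    by rewrite mule0 !add0e.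
  have t0 : 0 <= t by move: tV; rewrite in_itv/= => /andP[].
  have -> : c t = S by rewrite /c indicE mem_setE tV mul1e.
  pose H := [set x | t < u x].
  have [mH _] := rational_gap_half_line kap Q1 point (hu t).
  have iE w : (0 <= t < u (X w))%R%:R = \1_H (X w) :> R.
    rewrite t0/= indicE; congr (nat_of_bool _)%:R.
    by apply/idP/idP; rewrite inE.
  have Q0 : 0 <= fine (Q H) by rewrite fine_ge0.
  have m1 : measurable_fun [set: T] (fun w => \1_H (X w) : R).
    exact: (measurableT_comp (measurable_indic mH)).
  have -> : (P * k t = \int[Pr]_w (fine (Q H) * psi w)%:E)%E.
    under [RHS]eq_integral do rewrite EFinM.
    rewrite ge0_integralZl//; last 2 first.
    - exact/measurable_EFinP.
    - by move=> w _; rewrite lee_fin.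
    rewrite muleC; congr (_ * _)%E; rewrite /k.
    under eq_integral do rewrite mul1r iE.
    have -> : (fun w => (\1_H (X w))%:E : \bar R) =
      (fun w => (\1_(X @^-1` H) w)%:E) by apply/funext => w; rewrite !indicE.
    rewrite integral_indic//; last first.
      by rewrite -[X in measurable X]setTI; exact: mX.
    rewrite setIT; apply: (etrans (XQ mH)); rewrite fineK// ge0_fin_numE//; apply: (@le_lt_trans _ _ 1%E); last exact: ltry.
    by rewrite -Q1; apply: le_measure; rewrite ?inE.
  have -> : g t = (\int[Pr]_w (\1_H (X w) * psi w)%:E)%E.
    by apply: eq_integral => w _; rewrite iE mulrC.
  have [h1 h2] := cond_half_line mG Q1 condX (hu t) mpsi psi0 Gpsi.
  have split_ (a : T -> R) : measurable_fun [set: T] a -> (forall w, 0 <= a w) ->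
    (\int[Pr]_w ((a w + rg w) * psi w)%:E = \int[Pr]_w (a w * psi w)%:E + S)%E.
    move=> ma a0; under eq_integral do rewrite mulrDl EFinD.
    rewrite ge0_integralD//.
    - by move=> w _; rewrite lee_fin mulr_ge0.
    - by apply/measurable_EFinP; exact: measurable_funM.
    - by move=> w _; rewrite lee_fin mulr_ge0.
    - by apply/measurable_EFinP; exact: measurable_funM.
  by split; [move: h1|move: h2]; rewrite split_.
rewrite gE kE -cE -ge0_integralZl//; split.
- rewrite -ge0_integralD//; last by move=> t _; rewrite mule_ge0.
  by apply: ge0_le_integral => // [|t _]; [exact: emeasurable_funD|exact: (layer t).1].
- rewrite -ge0_integralD//.
  apply: ge0_le_integral => //; first by move=> t _; rewrite mule_ge0.
    exact: emeasurable_funD.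
  by move=> t _; exact: (layer t).2.
Qed.

End covariance.

(** * Variance of stationary sums *)

Section bounded_expectation.
Context {R : realType} {d : measure_display} {T : measurableType d}.
Context (Pr : probability T R).
Local Notation E g := (\int[Pr]_w (g w))%R.

Definition bmeas (g : T -> R) :=
  measurable_fun [set: T] g /\ exists M : R, forall w, `|g w| <= M.

Lemma bmeas_integrable g : bmeas g -> Pr.-integrable [set: T] (EFin \o g).
Proof.
move=> [mg [M gM]]; apply: measurable_bounded_integrable => //.
  by apply: (@le_lt_trans _ _ 1%E); [exact: probability_le1|exact: ltry].
exists M; split; first exact: num_real.
by move=> x Mx w _; apply: (le_trans (gM w)); exact: ltW.
Qed.

Lemma bmeas_EFin g : bmeas g -> (\int[Pr]_w (g w)%:E = (E g)%:E)%E.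
Proof.
by move=> /bmeas_integrable ig; rewrite fineK//; exact: integrable_fin_num.
Qed.

Lemma bmeas_cst c : bmeas (fun=> c).
Proof. by split => //; exists `|c|. Qed.

Lemma bmeasD g h : bmeas g -> bmeas h -> bmeas (fun w => g w + h w).
Proof.
move=> [mg [M gM]] [mh [N hN]]; split; first exact: measurable_funD.
by exists (M + N) => w; rewrite (le_trans (ler_normD _ _))// lerD.
Qed.

Lemma bmeasM g h : bmeas g -> bmeas h -> bmeas (fun w => g w * h w).
Proof.
move=> [mg [M gM]] [mh [N hN]]; split; first exact: measurable_funM.
by exists (M * N) => w; rewrite normrM ler_pM.
Qed.

Lemma bmeasB g h : bmeas g -> bmeas h -> bmeas (fun w => g w - h w).
Proof.
move=> [mg [M gM]] [mh [N hN]]; split; first exact: measurable_funB.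
by exists (M + N) => w; rewrite (le_trans (ler_normB _ _))// lerD.
Qed.

Lemma bmeas_sum (I : Type) (r : seq I) (g : I -> T -> R) :
  (forall i, bmeas (g i)) -> bmeas (fun w => \sum_(i <- r) g i w).
Proof.
move=> bg; elim: r => [|i r IH].
  by under [X in bmeas X]funext do rewrite big_nil; exact: bmeas_cst.
by under [X in bmeas X]funext do rewrite big_cons; exact: bmeasD.
Qed.

Lemma expD g h : bmeas g -> bmeas h -> E (fun w => g w + h w) = E g + E h.
Proof. by move=> bg bh; rewrite RintegralD//; exact: bmeas_integrable. Qed.

Lemma expB g h : bmeas g -> bmeas h -> E (fun w => g w - h w) = E g - E h.
Proof. by move=> bg bh; rewrite RintegralB//; exact: bmeas_integrable. Qed.

Lemma exp_cst c : E (fun=> c) = c.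
Proof. by rewrite /Rintegral integral_cst//= probability_setT mule1. Qed.

Lemma expZl c g : bmeas g -> E (fun w => c * g w) = c * E g.
Proof. by move=> bg; rewrite RintegralZl//; exact: bmeas_integrable. Qed.

Lemma exp_sum (I : Type) (r : seq I) (g : I -> T -> R) :
  (forall i, bmeas (g i)) ->
  E (fun w => \sum_(i <- r) g i w) = \sum_(i <- r) E (g i).
Proof.
move=> bg; elim: r => [|i r IH].
  by rewrite big_nil; under eq_Rintegral do rewrite big_nil; exact: exp_cst.
rewrite big_cons -IH -expD//; last exact: bmeas_sum.
by apply: eq_Rintegral => w _; rewrite big_cons.
Qed.

Definition cov (g h : T -> R) : R := E (fun w => g w * h w) - E g * E h.

Lemma covBl g1 g2 h : bmeas g1 -> bmeas g2 -> bmeas h ->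
  cov (fun w => g1 w - g2 w) h = cov g1 h - cov g2 h.
Proof.
move=> b1 b2 bh; rewrite /cov.
have -> : E (fun w => (g1 w - g2 w) * h w) = E (fun w => g1 w * h w) - E (fun w => g2 w * h w).
  rewrite -expB; [|exact: bmeasM|exact: bmeasM].
  by apply: eq_Rintegral => w _; rewrite mulrBl.
by rewrite expB//; ring.
Qed.

Lemma covC g h : cov g h = cov h g.
Proof.
rewrite /cov [E g * _]mulrC; congr (_ - _).
by apply: eq_Rintegral => w _; rewrite mulrC.
Qed.

Lemma covBr g h1 h2 : bmeas g -> bmeas h1 -> bmeas h2 ->
  cov g (fun w => h1 w - h2 w) = cov g h1 - cov g h2.
Proof. by move=> *; rewrite covC covBl// covC (covC h2). Qed.

Lemma sum_square_exp (I : Type) (r : seq I) (g : I -> T -> R) (m : R) :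
  (forall i, bmeas (g i)) -> (forall i, E (g i) = m) ->
  E (fun w => (\sum_(i <- r) (g i w - m)) ^+ 2) =
  \sum_(i <- r) \sum_(j <- r) cov (g i) (g j).
Proof.
move=> bg gm; have bz i : bmeas (fun w => g i w - m) by apply: bmeasB => //; exact: bmeas_cst.
transitivity (E (fun w => \sum_(i <- r) \sum_(j <- r) (g i w - m) * (g j w - m))).
  by apply: eq_Rintegral => w _; rewrite expr2 big_distrlr.
rewrite exp_sum; last by move=> i; apply: bmeas_sum => j; exact: bmeasM.
apply: eq_bigr => i _; rewrite exp_sum; last by move=> j; exact: bmeasM.
apply: eq_bigr => j _; rewrite /cov !gm.
have bm := bmeas_cst m; have bij := bmeasM (bg i) (bg j).
transitivity (E (fun w => (g i w * g j w - m * (g i w + g j w)) + m * m)).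
  by apply: eq_Rintegral => w _; ring.
have bs := bmeasD (bg i) (bg j); have bms := bmeasM bm bs.
rewrite expD; [|exact: bmeasB|exact: bmeas_cst].
by rewrite expB// expZl// expD// !gm exp_cst; ring.
Qed.

End bounded_expectation.

(** Each distance |j - k| occurs at most twice. *)
Lemma sum_distance_le (R : realType) (a : nat -> R) (n j : nat) :
  (forall k, 0 <= a k) -> (j <= n)%N ->
  \sum_(1 <= k < n.+1) a (if (k <= j)%N then j - k else k - j)%N <=
  2 * \sum_(0 <= k < n.+1) a k.
Proof.
move=> a0 jn.
have mono m k : (m <= k)%N -> \sum_(0 <= i < m) a i <= \sum_(0 <= i < k) a i.
  by move=> mk; rewrite (big_cat_nat (leq0n m) mk)//= lerDl sumr_ge0.
apply: (@le_trans _ _ (\sum_(0 <= k < n.+1) a (if (k <= j)%N then j - k else k - j)%N)).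
  by rewrite [leRHS]big_ltn// lerDr.
have jn' : (j.+1 <= n.+1)%N by [].
rewrite (big_cat_nat (leq0n j.+1) jn')//= mulr2n mulrDl mul1r lerD//.
  rewrite (_ : \sum_(0 <= i < j.+1) _ = \sum_(0 <= i < j.+1) a i); first exact: mono.
  rewrite big_nat_rev/=; apply: eq_big_nat => i /andP[_ ij].
  by rewrite add0n subSS leq_subr subKn.
rewrite -{1}(add0n j.+1) big_addn.
rewrite (_ : \sum_(0 <= i < _) _ = \sum_(0 <= i < n.+1 - j.+1) a i.+1).
  apply: (@le_trans _ _ (\sum_(0 <= i < (n.+1 - j.+1).+1) a i)).
    by rewrite [leRHS]big_nat_recl// lerDr.
  by apply: mono; rewrite subSS ltnS leq_subr.
apply: eq_big_nat => i _; rewrite leqNgt ltn_addl//= ?leqnn//.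
by rewrite addnS subSn ?leq_addl// addnK.
Qed.

Section stationary_variance.
Context {R : realType} {d : measure_display} {T : measurableType d}.
Context {Pr : probability T R} (Y : int -> {RV Pr >-> R}).
Hypothesis hY : strictly_stationary Y.
Context (kappa : nat -> R.-pker (g_sigma_algebraType (past Y 0)) ~> R).
Hypothesis hkappa : forall k : nat, cond_distribution (Y k%:Z) (kappa k).
Local Notation E g := (\int[Pr]_w (g w))%R.
Local Notation Q := (distribution Pr (Y 0)).

Definition gap (k : nat) : T -> R := rational_gap (kappa k) Q.

Lemma past_measurable : past Y 0 `<=` measurable.
Proof.
by move=> _ [i _ [B mB <-]]; exact: measurable_funP.
Qed.

Lemma Q1 : Q [set: R] = 1%E.
Proof. exact: probability_setT. Qed.

Lemma gap_bmeas k : bmeas (gap k).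
Proof.
split; first exact: (measurable_rational_gap past_measurable).
exists 1 => w; rewrite ger0_norm ?(rational_gap_ge0 (kappa k) Q1)//.
exact: (rational_gap_le1 (kappa k) Q1).
Qed.

Lemma gap_ge0 k w : 0 <= gap k w.
Proof. exact: rational_gap_ge0 Q1 w. Qed.

Lemma gap_le1 k w : gap k w <= 1.
Proof. exact: rational_gap_le1 Q1 w. Qed.

Lemma marginal_law (k : nat) (B : set R) : measurable B -> Pr (Y k%:Z @^-1` B) = Q B.
Proof.
move=> mB; have mB' : measurable [set t : 1.-tuple R | B (tnth t ord0)].
  rewrite -[X in measurable X]setTI.
  exact: (@measurable_tnth _ _ 1 ord0 measurableT B mB).
have := hY [tuple (0 : int)] k%:Z mB'.
have tE (h : int) : [set w | [set t : 1.-tuple R | B (tnth t ord0)]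
    [tuple Y (tnth [tuple (0 : int)] j + h) w | j < 1]] = Y h @^-1` B.
  by apply/seteqP; split => w /=; rewrite tnth_mktuple (tnth_nth 0) /= add0r.
have tE0 : [set w | [set t : 1.-tuple R | B (tnth t ord0)]
    [tuple Y (tnth [tuple (0 : int)] j) w | j < 1]] = Y 0 @^-1` B.
  by apply/seteqP; split => w /=; rewrite tnth_mktuple (tnth_nth 0).
by rewrite tE tE0 => <-.
Qed.

Lemma bmeas_comp (phi : R -> R) (i : int) : bmeas phi -> bmeas (fun w => phi (Y i w)).
Proof.
move=> [mphi [M phiM]]; split; last by exists M => w.
by apply: measurableT_comp => //; exact: measurable_funP.
Qed.

Lemma exp_stationary (phi : R -> R) (k : nat) : bmeas phi ->
  E (fun w => phi (Y k%:Z w)) = E (fun w => phi (Y 0 w)).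
Proof.
move=> bphi; have push (i : int) : E (fun w => phi (Y i w)) =
    \int[pushforward Pr (Y i)]_x phi x.
  have := @integral_pushforward _ _ _ _ _ (Y i) (measurable_funP (Y i)) Pr setT (EFin \o phi).
  rewrite preimage_setT => H; rewrite /Rintegral H//.
  - by apply/measurable_EFinP; exact: bphi.1.
  - rewrite (_ : (EFin \o phi) \o Y i = EFin \o (fun w => phi (Y i w)))//.
    by apply: bmeas_integrable; exact: bmeas_comp.
rewrite !(push (fun i => measurable_funP (Y i))) /Rintegral; congr fine; apply: eq_measure_integral => A mA _.
exact: marginal_law.
Qed.

(** Only pairs are needed: the laws of (Y_0, Y_m) and (Y_j, Y_(j+m)) agree by
    stationarity. *)
Lemma exp2_stationary (phi : R -> R) (j m : nat) : bmeas phi ->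
  E (fun w => phi (Y j%:Z w) * phi (Y (j + m)%N%:Z w)) =
  E (fun w => phi (Y 0 w) * phi (Y m%:Z w)).
Proof.
move=> bphi.
pose F (t : 2.-tuple R) := phi (tnth t ord0) * phi (tnth t ord_max).
pose W (h : int) (w : T) := [tuple Y (tnth [tuple (0 : int); m%:Z] i + h) w | i < 2].
have mW h : measurable_fun [set: T] (W h).
  apply/measurable_fun_tnthP => i; rewrite /W.
  have -> : (@tnth 2 R)^~ i \o (fun w => [tuple Y (tnth [tuple (0 : int); m%:Z] i + h) w | i < 2]) =
      Y (tnth [tuple (0 : int); m%:Z] i + h).
    by apply/funext => w /=; rewrite tnth_mktuple.
  exact: measurable_funP.
have mF : measurable_fun [set: 2.-tuple R] F.
  apply: measurable_funM; (apply: measurableT_comp; [exact: bphi.1|exact: measurable_tnth]).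
have WE (h : int) : E (fun w => phi (Y h w) * phi (Y (m%:Z + h) w)) =
    \int[pushforward Pr (W h)]_x F x.
  have := @integral_pushforward _ _ _ _ _ (W h) (mW h) Pr setT (EFin \o F).
  have FW : F \o W h = (fun w => phi (Y h w) * phi (Y (m%:Z + h) w)).
    by apply/funext => w; rewrite /F /W /= !tnth_mktuple !(tnth_nth 0) /= add0r.
  rewrite preimage_setT => H; rewrite /Rintegral H//.
  - by congr fine; apply: eq_integral => w _; rewrite /= -[F _]/((F \o W h) w) FW.
  - exact/measurable_EFinP.
  - rewrite (_ : (EFin \o F) \o W h = EFin \o (F \o W h))// FW.
    by apply: bmeas_integrable; apply: bmeasM; exact: bmeas_comp.
have -> : (j + m)%N%:Z = m%:Z + j%:Z by rewrite PoszD addrC.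
have := WE mW 0; rewrite addr0 => ->; rewrite (WE mW) /Rintegral.
congr fine; apply: eq_measure_integral => A mA _.
have := hY [tuple (0 : int); m%:Z] j%:Z mA.
rewrite /pushforward => H; apply: (etrans (esym H)); congr (Pr _).
apply/seteqP; split => w /=; rewrite /W; congr (A _); apply: eq_from_tnth => i;
  by rewrite !tnth_mktuple addr0.
Qed.

Lemma cov_stationary (phi : R -> R) (j k : nat) : bmeas phi ->
  cov Pr (fun w => phi (Y j%:Z w)) (fun w => phi (Y k%:Z w)) =
  cov Pr (fun w => phi (Y 0 w))
    (fun w => phi (Y (if (k <= j)%N then j - k else k - j)%N%:Z w)).
Proof.
move=> bphi; wlog jk : j k / (j <= k)%N.
  move=> H; have [|kj] := leqP j k; first exact: H.
  by rewrite covC (H _ _ (ltnW kj)) (ltnW kj) leqNgt kj.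
have -> : (if (k <= j)%N then j - k else k - j)%N = (k - j)%N.
  by case: ifPn => // kj; have -> : j = k by apply/eqP; rewrite eqn_leq jk.
rewrite /cov -(exp2_stationary j (k - j) bphi) subnKC//.
by rewrite (exp_stationary j bphi) (exp_stationary k bphi) (exp_stationary (k - j) bphi).
Qed.

(** The covariance inequality in the form used for the variance: the past
    factor is a function of Y_0, which is measurable with respect to the
    past. *)
Lemma covariance_gap (V : R) (psi u : R -> R) (k : nat) :
  0 <= V -> measurable_fun [set: R] u -> (forall x, 0 <= u x <= V) ->
  (forall t, half_line [set x | t < u x]) ->
  bmeas psi -> (forall x, 0 <= psi x) ->
  `|cov Pr (fun w => psi (Y 0 w)) (fun w => u (Y k%:Z w))| <=
  V * E (fun w => gap k w * psi (Y 0 w)).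
Proof.
move=> V0 mu_ uV hu bpsi psi0.
have bp := bmeas_comp 0 bpsi.
have bu : bmeas u by split => //; exists V => x; have /andP[u0 ?] := uV x; rewrite ger0_norm.
have bY := bmeas_comp k%:Z bu.
have Gpsi v : (past Y 0).-sigma.-measurable [set w | v < psi (Y 0 w)].
  apply: sub_gen_smallest; exists (0 : int) => //; exists [set y | v < psi y].
    have := bpsi.1 measurableT `]v, +oo[%classic (measurable_itv _).
    by rewrite setTI (_ : psi @^-1` _ = [set y | v < psi y])//; apply/seteqP; split => y /=;
      rewrite in_itv/= andbT.
  by rewrite setTI.
have [] := cond_covariance_le past_measurable Q1 (hkappa k) (@marginal_law k) V0 mu_ uV hu
  bp.1 (fun w => psi0 _) Gpsi.
rewrite -/(gap k).
rewrite (bmeas_EFin Pr (bmeasM bp bY)) (bmeas_EFin Pr bp) (bmeas_EFin Pr bY).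
rewrite (bmeas_EFin Pr (bmeasM (gap_bmeas k) bp)).
rewrite -!EFinM -!EFinD !lee_fin /cov => h1 h2; rewrite ler_norml; apply/andP; split; lra.
Qed.

Definition gap_sum (n : nat) (w : T) : R := \sum_(0 <= k < n.+1) gap k w.

(** Expand the square into covariances, shift each of them to time 0, and
    bound it by the gap at the corresponding distance. Every distance is
    counted at most twice, and u1, u2 contribute one factor each. *)
Lemma variance_le (V : R) (phi u1 u2 : R -> R) (n : nat) :
  0 <= V -> bmeas phi -> (forall x, phi x = u1 x - u2 x) ->
  (forall u, u = u1 \/ u = u2 -> [/\ measurable_fun [set: R] u, (forall x, 0 <= u x <= V) &
    (forall t, half_line [set x | t < u x])]) ->
  E (fun w => (\sum_(1 <= k < n.+1)
      (phi (Y k%:Z w) - E (fun w' => phi (Y 0 w')))) ^+ 2) <=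
  4 * V * n%:R * E (fun w => `|phi (Y 0 w)| * gap_sum n w).
Proof.
move=> V0 bphi phiE hu.
rewrite (@sum_square_exp _ _ _ Pr _ _ (fun k w => phi (Y k%:Z w))); last 2 first.
- by move=> k; exact: bmeas_comp.
- by move=> k; exact: exp_stationary.
have babs : bmeas (fun x => `|phi x|).
  have [mphi [M phiM]] := bphi; split; first exact: measurableT_comp.
  by exists M => x; rewrite normr_id.
pose a k := 2 * V * E (fun w => `|phi (Y 0 w)| * gap k w).
have a0 k : 0 <= a k.
  rewrite mulr_ge0//; first by rewrite mulr_ge0.
  by apply: Rintegral_ge0 => w _; rewrite mulr_ge0 ?gap_ge0.
(* Splitting phi into its positive and negative parts at time 0, and into u1
   - u2 at time k, gives four covariances. *)
have covle k : cov Pr (fun w => phi (Y 0 w)) (fun w => phi (Y k%:Z w)) <= a k.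
  pose pp x := Num.max (phi x) 0; pose pn x := Num.max (- phi x) 0.
  have bpp : bmeas pp.
    have [mphi [M phiM]] := bphi; split; first exact: measurable_funrpos.
    exists M => x; apply: le_trans (phiM x); rewrite /pp maxEle.
    by case: ifP => _; rewrite ?normr0.
  have bpn : bmeas pn.
    have [mphi [M phiM]] := bphi; split; first exact: measurable_funrneg.
    exists M => x; apply: le_trans (phiM x); rewrite /pn maxEle.
    by case: ifP => _; rewrite ?normr0 ?normrN.
  have pp0 x : 0 <= pp x by rewrite /pp le_max lexx orbT.
  have pn0 x : 0 <= pn x by rewrite /pn le_max lexx orbT.
  have ppn x : phi x = pp x - pn x.
    by rewrite /pp /pn !maxEle oppr_le0; case: (leP (phi x) 0); case: (leP 0 (phi x)) => h1 h2; lra.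
  have ppa x : `|phi x| = pp x + pn x.
    by rewrite /pp /pn !maxEle oppr_le0; case: (ger0P (phi x)) => h0; case: (leP (phi x) 0) => h2; lra.
  have [m1 V1 h1] := hu u1 (or_introl erefl).
  have [m2 V2 h2] := hu u2 (or_intror erefl).
  have bu (u : R -> R) : measurable_fun [set: R] u -> (forall x, 0 <= u x <= V) -> bmeas u.
    by move=> mu_ uV; split => //; exists V => x; have /andP[u0 ?] := uV x; rewrite ger0_norm.
  have b1 := bu _ m1 V1; have b2 := bu _ m2 V2.
  have -> : (fun w => phi (Y 0 w)) = (fun w => pp (Y 0 w) - pn (Y 0 w)) by apply/funext => w.
  have -> : (fun w => phi (Y k%:Z w)) = (fun w => u1 (Y k%:Z w) - u2 (Y k%:Z w)) by apply/funext => w.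
  have [bp0 bn0 bY1 bY2] := And4 (bmeas_comp 0 bpp) (bmeas_comp 0 bpn)
    (bmeas_comp k%:Z b1) (bmeas_comp k%:Z b2).
  rewrite covBl//; last exact: bmeasB.
  rewrite !covBr//.
  have c1 := covariance_gap k V0 m1 V1 h1 bpp pp0.
  have c2 := covariance_gap k V0 m2 V2 h2 bpp pp0.
  have c3 := covariance_gap k V0 m1 V1 h1 bpn pn0.
  have c4 := covariance_gap k V0 m2 V2 h2 bpn pn0.
  have -> : a k = 2 * (V * E (fun w => gap k w * pp (Y 0 w))) + 2 * (V * E (fun w => gap k w * pn (Y 0 w))).
    rewrite /a (_ : E (fun w => `|phi (Y 0 w)| * gap k w) =
      E (fun w => gap k w * pp (Y 0 w)) + E (fun w => gap k w * pn (Y 0 w))); first by ring.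
    rewrite -expD; [|by apply: bmeasM => //; exact: gap_bmeas..].
    by apply: eq_Rintegral => w _; rewrite ppa; ring.
  by move: c1 c2 c3 c4; rewrite !ler_norml => /andP[_ c1] /andP[c2 _] /andP[c3 _] /andP[_ c4]; lra.
apply: (@le_trans _ _ (\sum_(1 <= j < n.+1) 2 * \sum_(0 <= k < n.+1) a k)).
  rewrite big_nat [leRHS]big_nat; apply: ler_sum => j /andP[_].
  rewrite ltnS => jn; apply: (le_trans _ (sum_distance_le a0 jn)); apply: ler_sum => k _.
  by rewrite cov_stationary//; exact: covle.
have -> : \sum_(0 <= k < n.+1) a k = 2 * V * E (fun w => `|phi (Y 0 w)| * gap_sum n w).
  rewrite /a -mulr_sumr -exp_sum; last first.
    by move=> k; apply: bmeasM; [exact: (bmeas_comp 0 babs)|exact: gap_bmeas].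
  by congr (_ * _); apply: eq_Rintegral => w _; rewrite /gap_sum mulr_sumr.
rewrite sumr_const_nat subn1/= -[_ *+ n]mulr_natr le_eqVlt; apply/orP; left; apply/eqP.
by ring.
Qed.

End stationary_variance.

(** * Kernels of bounded variation, cell by cell *)

Section cells.
Context {R : realType} (K : R -> R).
Local Notation mu := (@lebesgue_measure R).
Hypothesis intK : mu.-integrable [set: R] (EFin \o K).
Context (M : R) (KM : forall a b : R, a <= b -> (total_variation a b K <= M%:E)%E).

Let tv a b := fine (total_variation a b K).

Let tvE a b : a <= b -> total_variation a b K = (tv a b)%:E.
Proof.
move=> ab; rewrite /tv fineK// ge0_fin_numE ?total_variation_ge0//.
by apply: (le_lt_trans (KM ab)); exact: ltry.
Qed.

Let tvD a b c : a <= c -> c <= b -> tv a b = tv a c + tv c b.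
Proof.
move=> ac cb; apply: EFin_inj; rewrite EFinD -!tvE//; last exact: le_trans cb.
exact: total_variationD.
Qed.

Let tv_ge a b : a <= b -> `|K b - K a| <= tv a b.
Proof. by move=> ab; rewrite -lee_fin -tvE//; exact: total_variation_ge. Qed.

Let tv_ge0 a b : a <= b -> 0 <= tv a b.
Proof. by move=> ab; rewrite -lee_fin -tvE//; exact: total_variation_ge0. Qed.

Let tv_le a b : a <= b -> tv a b <= M.
Proof. by move=> ab; rewrite -lee_fin -tvE//; exact: KM. Qed.

Definition cell (c z : R) : R := if c <= z < c + 1 then K z else 0.

(** A common bound for K on [c, c + 1) and for both monotone parts of the
    cell. *)
Definition cell_bound (c : R) : R := 2 * (`|K c| + tv c (c + 1)).

Let cle (c : R) : c <= c + 1.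
Proof. by rewrite lerDl. Qed.

Lemma cell_bound_ge0 c : 0 <= cell_bound c.
Proof. by rewrite mulr_ge0// addr_ge0// tv_ge0. Qed.

Let near_c (c z : R) : c <= z -> z <= c + 1 -> `|K z| <= `|K c| + tv c z.
Proof.
move=> cz zc; have := tv_ge cz; have := ler_normD (K z - K c) (K c).
rewrite subrK; lra.
Qed.

Let tv_cell (c z : R) : c <= z -> z <= c + 1 -> tv c z <= tv c (c + 1).
Proof. by move=> cz zc; rewrite (tvD cz zc) lerDl tv_ge0. Qed.

Lemma cell_le c z : `|cell c z| <= cell_bound c.
Proof.
rewrite /cell; case: ifPn => [/andP[cz /ltW zc]|_]; last by rewrite normr0 cell_bound_ge0.
have := near_c cz zc; have := tv_cell cz zc; have := tv_ge0 (cle c).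
have := normr_ge0 (K c); rewrite /cell_bound; lra.
Qed.

(** Jordan decomposition of K on the cell by its variation from c. *)
Lemma cell_monotone_split c : exists u : bool -> R -> R,
  (forall z, cell c z = u true z - u false z) /\
  forall b, {homo u b : x y / x <= y} /\ (forall z, 0 <= u b z <= cell_bound c).
Proof.
(* Outside the cell both functions are continued by constants, which cancel
   and keep them monotone. *)
pose u b z := if z < c then 0 else if z < c + 1 then
   `|K c| + tv c z - (if b then 0 else K z) else cell_bound c.
have mid b z : c <= z -> z <= c + 1 ->
    0 <= `|K c| + tv c z - (if b then 0 else K z) <= cell_bound c.
  move=> cz zc; have := near_c cz zc; have := tv_cell cz zc; have := tv_ge0 cz.
  rewrite ler_norml => ? ? /andP[? ?]; have := normr_ge0 (K c).
  by rewrite /cell_bound; case: b => ?; apply/andP; split; lra.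
have ub b z : 0 <= u b z <= cell_bound c.
  rewrite /u; case: ltP => zc; first by rewrite lexx cell_bound_ge0.
  case: ltP => zc'; last by rewrite cell_bound_ge0 lexx.
  by apply: mid => //; exact: ltW.
exists u; split.
  move=> z; rewrite /cell /u; case: (leP c z) => cz /=; last by rewrite subr0.
  by case: ltP => zc; [rewrite subr0; ring|rewrite subrr].
move=> b; split; last exact: ub.
move=> y z yz; rewrite {1}/u; case: (ltP y c) => yc; first by have /andP[] := ub b z.
case: (ltP y (c + 1)) => yc1.
  rewrite /u ltNge (le_trans yc yz)/=; case: (ltP z (c + 1)) => zc1.
    rewrite (tvD yc yz); have := tv_ge yz; rewrite ler_norml => /andP[? ?].
    by case: b; lra.
  by have /andP[] := mid b y yc (ltW yc1).
by rewrite /u !ltNge (le_trans yc yz) (le_trans yc1 yz).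
Qed.

Let mK : measurable_fun [set: R] K.
Proof. by apply/measurable_EFinP; exact: (measurable_int _ intK). Qed.

Let absK : measurable_fun [set: R] (fun z => `|K z|%:E).
Proof. by apply/measurable_EFinP; exact: measurableT_comp. Qed.

Lemma measurable_window (a b : R) :
  measurable_fun [set: R] (fun z => if a <= z < b then K z else 0).
Proof.
have -> : (fun z => if a <= z < b then K z else 0) = (fun z => K z * \1_(`[a, b[%classic) z).
  apply/funext => z; rewrite indicE mem_setE in_itv/=.
  by case: ifP => _; rewrite ?mulr1 ?mulr0.
by apply: measurable_funM => //; apply: measurable_indic; exact: measurable_itv.
Qed.

Lemma sum_cells (a : R) (n : nat) z :
  \sum_(i < n) cell (a + i%:R) z = if a <= z < a + n%:R then K z else 0.
Proof.
elim: n => [|n IH].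
  by rewrite big_ord0 addr0; case: ifPn => // /andP[az /(le_lt_trans az)]; rewrite ltxx.
rewrite big_ord_recr/= IH /cell -addrA -natr1.
have n0 : 0 <= n%:R :> R by [].
have [h1|h1] := leP a z; have [h2|h2] := ltP z (a + n%:R); have [h3|h3] := leP (a + n%:R) z;
  have [h4|h4] := ltP z (a + (n%:R + 1)) => /=; rewrite ?addr0 ?add0r//; exfalso; lra.
Qed.

(** On the cell, K(c) exceeds K(z) by at most the variation; average over z. *)
Lemma cell_bound_integral c :
  ((cell_bound c)%:E <= 2%:E * \int[mu]_(z in `[c, (c + 1)%R[) `|K z|%:E + (4 * tv c (c + 1))%:E)%E.
Proof.
have len : mu `[c, (c + 1)[%classic = 1%E.
  by rewrite lebesgue_measure_itv/= lte_fin ltrDl ltr01 -EFinB addrAC subrr add0r.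
have mI : measurable `[c, (c + 1)[%classic by exact: measurable_itv.
have tv0 := tv_ge0 (cle c).
have cst1 k : k%:E = (\int[mu]_(z in `[c, (c + 1)%R[) (cst k%:E z))%E.
  have iE := @integral_cst _ _ R mu _ mI k%:E.
  by apply/esym/(etrans iE); rewrite -[RHS]mule1; congr (_ * _)%E; exact: len.
have key : (`|K c|%:E <= \int[mu]_(z in `[c, (c + 1)%R[) `|K z|%:E + (tv c (c + 1))%:E)%E.
  have -> : `|K c|%:E = (\int[mu]_(z in `[c, (c + 1)%R[) (cst `|K c|%:E z))%E.
    exact: cst1.
  have -> : (tv c (c + 1))%:E = (\int[mu]_(z in `[c, (c + 1)%R[) (cst (tv c (c + 1))%:E z))%E.
    exact: cst1.
  rewrite -ge0_integralD//; last exact: measurable_funTS.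
  apply: ge0_le_integral => //.
  - by move=> z _; rewrite lee_fin.
  - by apply: emeasurable_funD => //; exact: measurable_funTS.
  move=> z /=; rewrite in_itv/= => /andP[cz /ltW zc]; rewrite -EFinD lee_fin.
  have := tv_ge cz; have := tv_cell cz zc; have := ler_normD (K c - K z) (K z).
  rewrite subrK distrC; lra.
rewrite /cell_bound (_ : 2 * _ = 2 * `|K c| + 2 * tv c (c + 1)); last by ring.
have I0 : (0 <= \int[mu]_(z in `[c, (c + 1)%R[) `|K z|%:E)%E by exact: integral_ge0.
move: key I0; case: (\int[mu]_(z in _) _)%E => [I||]//.
  by rewrite -EFinM -!EFinD !lee_fin; lra.
by move=> _ _; rewrite gt0_muley ?lte_fin// addye// leey.
Qed.

(** The averages of |K| over the cells add up to at most its integral, and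
    the variations to at most the total variation. *)
Lemma sum_cell_bound : exists W : R, forall (a : R) (n : nat),
  \sum_(i < n) cell_bound (a + i%:R) <= W.
Proof.
have Ifin : (\int[mu]_z `|K z|%:E)%E \is a fin_num.
  by have /integrableP[_] := intK; rewrite ge0_fin_numE//; exact: integral_ge0.
exists (2 * fine (\int[mu]_z `|K z|%:E)%E + 4 * M) => a n.
have sumI : (\sum_(i < n) \int[mu]_(z in `[(a + i%:R)%R, (a + i%:R + 1)%R[) `|K z|%:E =
    \int[mu]_(z in `[a, (a + n%:R)%R[) `|K z|%:E)%E.
  elim: n => [|n IH].
    by rewrite big_ord0 addr0 set_itvco0 integral_set0.
  rewrite big_ord_recr/= IH -ge0_integral_setU//=; last 2 first.
  - exact: measurable_funTS.
  - apply/disj_setPS => z [] /=; rewrite !in_itv/= => /andP[_ h1] /andP[h2 _].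
    by move: (le_lt_trans h2 h1); rewrite ltxx.
  rewrite -itv_bndbnd_setU ?bnd_simp ?lerDl//.
  by rewrite -addrA natr1.
have sumT : \sum_(i < n) tv (a + i%:R) (a + i%:R + 1) = tv a (a + n%:R).
  elim: n {sumI} => [|n IH].
    by rewrite big_ord0 addr0 /tv total_variationxx.
  rewrite big_ord_recr/= IH -tvD ?lerDl//.
  by rewrite -addrA natr1.
rewrite -lee_fin -sumEFin.
apply: (@le_trans _ _ (\sum_(i < n) (2%:E * \int[mu]_(z in `[(a + i%:R)%R, (a + i%:R + 1)%R[) `|K z|%:E
   + (4 * tv (a + i%:R) (a + i%:R + 1))%:E))%E).
  by apply: lee_sum => i _; exact: cell_bound_integral.
rewrite big_split/= -ge0_sume_distrr; last by move=> i _; exact: integral_ge0.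
rewrite sumI sumEFin -mulr_sumr sumT [leRHS]EFinD; apply: leeD.
  rewrite EFinM fineK// lee_pmul2l//.
  by apply: ge0_subset_integral => //; exact: measurable_itv.
by rewrite lee_fin ler_pM2l// tv_le// lerDl.
Qed.

Lemma bounded_variation_bounded : exists W, forall z, `|K z| <= W.
Proof.
exists (`|K 0| + M) => z; have := ler_normD (K z - K 0) (K 0); rewrite subrK.
have [z0|/ltW z0] := leP 0 z.
  by have := tv_ge z0; have := tv_le z0; lra.
by have := tv_ge z0; have := tv_le z0; rewrite distrC; lra.
Qed.

End cells.

(** * Weighted second moment of the deviation on a cell *)

Lemma measurable_exp d (T : measurableType d) d' (S : measurableType d') (R : realType)
    (Pr : probability T R) (F : T * S -> R) (M : R) :
  measurable_fun [set: T * S] F -> (forall z, `|F z| <= M) ->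
  measurable_fun [set: S] (fun x => \int[Pr]_w F (w, x))%R.
Proof.
move=> mF FM.
have -> : (fun x => \int[Pr]_w F (w, x))%R =
    (fun x => fine (\int[Pr]_w (F (w, x) + M)%:E)%E - M).
  apply/funext => x; have bF : bmeas (fun w => F (w, x)).
    split; last by exists M => w.
    exact: (measurableT_comp mF (measurable_pair2 _)).
  rewrite -[X in X - M]/(\int[Pr]_w (F (w, x) + M))%R.
  by rewrite expD//; [rewrite exp_cst addrK|exact: bmeas_cst].
apply: measurable_funB => //; apply: (@measurableT_comp _ _ _ _ _ _ fine) => //.
apply: (@measurable_fun_fubini_tonelli_G _ _ T S R Pr (fun z => (F z + M)%:E)).
- by apply/measurable_EFinP; exact: measurable_funD.
- by move=> z; rewrite lee_fin; have := FM z; rewrite ler_norml => /andP[+ _]; lra.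
Qed.

(** Young's inequality with the conjugate exponents 2/p and 2/(2-p), applied
    to (D^2 W)^(p/2) and W^(-p/2) at the scale L. *)
Lemma young_weight (R : realType) (p v L W D : R) : 1 <= p < 2 ->
  0 < v -> 0 < L -> 0 < W ->
  (`|D| / v) `^ p <=
  L `^ p * (p / 2 * (D ^+ 2 * W / (v ^+ 2 * L ^+ 2)) +
            (1 - p / 2) * W `^ (- (p / (2 - p)))).
Proof.
move=> /andP[p1 p2] v0 L0 W0.
have p0 : 0 < p by lra.
have q0 : 0 < 2 - p by lra.
set t := `|D| / v; have t0 : 0 <= t by rewrite divr_ge0// ltW.
have s0 : 0 <= t / L by rewrite divr_ge0// ltW.
have tE : t = L * (t / L) by rewrite mulrC divfK// gt_eqF.
have H := @conjugate_powR R ((t / L) `^ p * W `^ (p / 2)) (W `^ (- (p / 2))) (2 / p) (2 / (2 - p))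
  (mulr_ge0 (powR_ge0 _ _) (powR_ge0 _ _)) (powR_ge0 _ _).
have e1 : ((t / L) `^ p * W `^ (p / 2)) * W `^ (- (p / 2)) = (t / L) `^ p.
  by rewrite -mulrA -powRD; [rewrite subrr powRr0 mulr1|rewrite (gt_eqF W0) implybT].
have e2 : ((t / L) `^ p * W `^ (p / 2)) `^ (2 / p) = D ^+ 2 * W / (v ^+ 2 * L ^+ 2).
  rewrite powRM ?powR_ge0// -!powRrM.
  rewrite (_ : p * (2 / p) = 2%:R); last by field; lra.
  rewrite (_ : p / 2 * (2 / p) = 1); last by field; lra.
  rewrite powR_mulrn// powRr1 ?ltW// /t !expr_div_n real_normK ?num_real//.
  by field; rewrite !gt_eqF.
have e3 : (W `^ (- (p / 2))) `^ (2 / (2 - p)) = W `^ (- (p / (2 - p))).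
  by rewrite -powRrM; congr (_ `^ _); field; lra.
have -> : t `^ p = L `^ p * (t / L) `^ p by rewrite -powRM ?(ltW L0)// -tE.
rewrite ler_wpM2l ?powR_ge0//.
rewrite -e1; apply: (le_trans (H _ _ _)).
- by rewrite divr_gt0.
- by rewrite divr_gt0.
- by field; rewrite !gt_eqF.
by rewrite e2 e3 le_eqVlt; apply/orP; left; apply/eqP; field; rewrite !gt_eqF//; lra.
Qed.

Lemma fatou_bound d (T : measurableType d) (R : realType) (mu : {measure set T -> \bar R})
    (u : nat -> T -> \bar R) (f : T -> \bar R) (C : \bar R) :
  (forall n, measurable_fun [set: T] (u n)) -> (forall n x, 0 <= u n x)%E ->
  (forall x, u ^~ x @ \oo --> f x) ->
  (forall n, \int[mu]_x u n x <= C)%E -> (\int[mu]_x f x <= C)%E.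
Proof.
move=> mu_ u0 uf uC.
have -> : (\int[mu]_x f x = \int[mu]_x limn_einf (u ^~ x))%E.
  by apply: eq_integral => x _; rewrite (cvg_limn_einf_sup (uf x)).1.
apply: (le_trans (fatou mu measurableT mu_ (fun n x _ => u0 n x))).
rewrite limn_einf_lim; apply: lime_le; first exact: is_cvg_einfs.
by apply: nearW => n; apply: (le_trans _ (uC n)); apply: ereal_inf_lbound; exists n => /=.
Qed.

Section kernel_deviation.
Context {R : realType} {d : measure_display} {T : measurableType d}.
Context {Pr : probability T R} (Y : int -> {RV Pr >-> R}).
Hypothesis hY : strictly_stationary Y.
Context (kappa : nat -> R.-pker (g_sigma_algebraType (past Y 0)) ~> R).
Hypothesis hkappa : forall k : nat, cond_distribution (Y k%:Z) (kappa k).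
Local Notation E g := (\int[Pr]_w (g w))%R.
Local Notation mu := (@lebesgue_measure R).

Definition kernel_at (phi : R -> R) (h x : R) : R -> R := fun y => phi (h^-1 * (x - y)).

Definition deviation (phi : R -> R) (h : R) (n : nat) (w : T) (x : R) : R :=
  \sum_(1 <= k < n.+1)
    (kernel_at phi h x (Y k%:Z w) - E (fun w' => kernel_at phi h x (Y 0 w'))).

Lemma measurable_kernel_at (phi : R -> R) (h x : R) :
  measurable_fun [set: R] phi -> measurable_fun [set: R] (kernel_at phi h x).
Proof.
move=> mphi; apply: (measurableT_comp mphi).
by apply: measurable_funM => //; exact: measurable_funB.
Qed.

Lemma bmeas_kernel_at (phi : R -> R) (h x : R) : bmeas phi -> bmeas (kernel_at phi h x).
Proof.
by move=> [mphi [M phiM]]; split; [exact: measurable_kernel_at|exists M => y; exact: phiM].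
Qed.

Lemma measurable_deviation (phi : R -> R) (h : R) (n : nat) : bmeas phi ->
  measurable_fun [set: T * measurableTypeR R] (fun z => deviation phi h n z.1 z.2).
Proof.
move=> [mphi [M phiM]].
have mker (i : int) : measurable_fun [set: T * measurableTypeR R]
    (fun z => kernel_at phi h z.2 (Y i z.1)).
  apply: (measurableT_comp mphi); apply: measurable_funM => //.
  apply: measurable_funB; first exact: measurable_snd.
  apply: (measurableT_comp (measurable_funP (Y i))); exact: measurable_fst.
apply: measurable_sum => k; apply: measurable_funB => //.
have := measurable_exp Pr (mker 0) (fun z => phiM _).
by move=> me; apply: (measurableT_comp me); exact: measurable_snd.
Qed.

Lemma deviationD (phi1 phi2 : R -> R) (h : R) (n : nat) (w : T) (x : R) :
  bmeas phi1 -> bmeas phi2 ->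
  deviation (fun z => phi1 z + phi2 z) h n w x =
  deviation phi1 h n w x + deviation phi2 h n w x.
Proof.
move=> b1 b2; rewrite /deviation -big_split/=; apply: eq_bigr => k _.
rewrite /kernel_at expD; first by ring.
- exact: (bmeas_comp Y 0 (bmeas_kernel_at h x b1)).
- exact: (bmeas_comp Y 0 (bmeas_kernel_at h x b2)).
Qed.

Lemma deviation_sum (m : nat) (phi : 'I_m -> R -> R) (h : R) (n : nat) (w : T) (x : R) :
  (forall i, bmeas (phi i)) ->
  deviation (fun z => \sum_(i < m) phi i z) h n w x =
  \sum_(i < m) deviation (phi i) h n w x.
Proof.
move=> bphi; elim: m phi bphi => [|m IH] phi bphi.
  rewrite big_ord0 /deviation big1// => k _; rewrite /kernel_at big_ord0.
  by under eq_Rintegral do rewrite big_ord0; rewrite exp_cst subrr.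
have -> : (fun z => \sum_(i < m.+1) phi i z) =
    (fun z => (\sum_(i < m) phi (widen_ord (leqnSn m) i) z) + phi ord_max z).
  by apply/funext => z; rewrite big_ord_recr.
rewrite deviationD//; last by apply: bmeas_sum => i.
by rewrite IH// [in RHS]big_ord_recr.
Qed.

Context (K : R -> R).
Hypothesis intK : mu.-integrable [set: R] (EFin \o K).
Context (M : R) (KM : forall a b : R, a <= b -> (total_variation a b K <= M%:E)%E).

Lemma bmeas_cell c : bmeas (cell K c).
Proof.
by split; [exact: (measurable_window intK)|exists (cell_bound K c) => z; exact: (cell_le KM)].
Qed.

(** Variance bound for the two monotone parts of the cell, reflected and
    rescaled by y |-> (x - y) / h. *)
Lemma cell_variance_le (c h x : R) (n : nat) : 0 < h ->
  E (fun w => deviation (cell K c) h n w x ^+ 2) <=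
  4 * cell_bound K c * n%:R *
    E (fun w => `|kernel_at (cell K c) h x (Y 0 w)| * gap_sum kappa n w).
Proof.
move=> h0; have [u [ucell uP]] := cell_monotone_split KM c.
apply: (@variance_le _ _ _ _ _ hY kappa hkappa _ _
  (kernel_at (u true) h x) (kernel_at (u false) h x)).
- exact: (cell_bound_ge0 KM).
- by apply: bmeas_kernel_at; exact: bmeas_cell.
- by move=> y; rewrite /kernel_at ucell.
have hi : 0 <= h^-1 by rewrite invr_ge0 ltW.
have key b : [/\ measurable_fun [set: R] (kernel_at (u b) h x),
    (forall y, 0 <= kernel_at (u b) h x y <= cell_bound K c) &
    (forall t, half_line [set y | t < kernel_at (u b) h x y])].
  have [um ub] := uP b; split.
  - by apply: measurable_kernel_at; apply: nondecreasing_measurable => // y z _ _; exact: um.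
  - by move=> y; exact: ub.
  - move=> t; left => y z yz /lt_le_trans; apply.
    by apply: um; rewrite ler_wpM2l// lerD2l lerN2.
by move=> v [] ->; exact: key.
Qed.

(** After exchanging the integrals, an observation y only matters for x in an
    interval of length h near y + hc, where the weight is at most (1 + |y| +
    h)^al. *)
Lemma cell_second_moment (c h al : R) (n : nat) : 0 < h -> 0 <= al ->
  (\int[Pr]_w \int[mu]_x
     (deviation (cell K c) h n w x ^+ 2 * (1 + `|x - h * c|) `^ al)%:E <=
   (4 * cell_bound K c ^+ 2 * n%:R * h)%:E *
     \int[Pr]_w (gap_sum kappa n w * (1 + `|Y 0 w| + h) `^ al)%:E)%E.
Proof.
move=> h0 al0; set V := cell_bound K c; have V0 : 0 <= V by exact: (cell_bound_ge0 KM).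
have B0 w : 0 <= gap_sum kappa n w by apply: sumr_ge0 => k _; exact: gap_ge0.
have bB : bmeas (gap_sum kappa n) by apply: bmeas_sum => k; exact: gap_bmeas.
have mB : measurable_fun [set: T] (gap_sum kappa n) := bB.1.
have mdev := measurable_deviation h n (bmeas_cell c).
pose wt (x : R) := (1 + `|x - h * c|) `^ al.
have mwt : measurable_fun [set: R] wt.
  apply: (measurableT_comp (measurable_powR _)); apply: measurable_funD => //.
  by apply: measurableT_comp => //; exact: measurable_funB.
have wt0 x : 0 <= wt x by exact: powR_ge0.
have FT (F : T * measurableTypeR R -> R) : measurable_fun setT F -> (forall z, 0 <= F z) ->
    (\int[Pr]_w \int[mu]_x (F (w, x))%:E = \int[mu]_x \int[Pr]_w (F (w, x))%:E)%E.
  move=> mF F0; apply: (@fubini_tonelli _ _ T (measurableTypeR R) R Pr mu (fun z => (F z)%:E)).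
    exact/measurable_EFinP.
  by move=> z; rewrite lee_fin.
rewrite (FT (fun z => deviation (cell K c) h n z.1 z.2 ^+ 2 * wt z.2)); last 2 first.
- apply: measurable_funM; first exact: measurable_funX.
  by apply: (measurableT_comp mwt); exact: measurable_snd.
- by move=> z; rewrite mulr_ge0// sqr_ge0.
pose G (z : T * measurableTypeR R) := 4 * V * n%:R *
  (`|kernel_at (cell K c) h z.2 (Y 0 z.1)| * gap_sum kappa n z.1) * wt z.2.
have mG : measurable_fun setT G.
  apply: measurable_funM; last by apply: (measurableT_comp mwt); exact: measurable_snd.
  apply: measurable_funM => //; apply: measurable_funM; last first.
    by apply: (measurableT_comp mB); exact: measurable_fst.
  apply: measurableT_comp => //; apply: (measurableT_comp (bmeas_cell c).1).
  apply: measurable_funM => //; apply: measurable_funB; first exact: measurable_snd.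
  by apply: (measurableT_comp (measurable_funP (Y 0))); exact: measurable_fst.
have G0 z : 0 <= G z.
  by apply: mulr_ge0 => //; apply: mulr_ge0; [apply: mulr_ge0 => //; apply: mulr_ge0|exact: mulr_ge0].
apply: (@le_trans _ _ (\int[mu]_x \int[Pr]_w (G (w, x))%:E)%E).
  apply: le_integral_nomeas => x.
    by apply: integral_ge0 => w _; rewrite lee_fin mulr_ge0// sqr_ge0.
  have bD : bmeas (fun w => deviation (cell K c) h n w x).
    apply: bmeas_sum => k; apply: bmeasB; last exact: bmeas_cst.
    by apply: (bmeas_comp Y k%:Z (bmeas_kernel_at h x (bmeas_cell c))).
  have bD2 : bmeas (fun w => deviation (cell K c) h n w x ^+ 2).
    by under [X in bmeas X]funext do rewrite expr2; exact: bmeasM.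
  have bk : bmeas (fun w => `|kernel_at (cell K c) h x (Y 0 w)| * gap_sum kappa n w).
    apply: bmeasM => //; have [mk [W kW]] := bmeas_comp Y 0 (bmeas_kernel_at h x (bmeas_cell c)).
    by split; [exact: measurableT_comp|exists W => w; rewrite normr_id].
  rewrite (bmeas_EFin Pr (bmeasM bD2 (bmeas_cst (wt x)))).
  rewrite (bmeas_EFin Pr (bmeasM (bmeasM (bmeas_cst (4 * V * n%:R)) bk) (bmeas_cst (wt x)))).
  rewrite lee_fin.
  under eq_Rintegral do rewrite mulrC.
  under [leRHS]eq_Rintegral do rewrite mulrC.
  rewrite expZl// expZl//; last exact: bmeasM (bmeas_cst _) bk.
  by rewrite expZl// ler_wpM2l//; exact: cell_variance_le.
rewrite -(FT G)// -ge0_integralZl//; last 3 first.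
- apply/measurable_EFinP; apply: measurable_funM => //.
  apply: (measurableT_comp (measurable_powR _)); apply: measurable_funD => //.
  by apply: measurable_funD => //; apply: measurableT_comp => //; exact: measurable_funP.
- by move=> w _; rewrite lee_fin mulr_ge0// powR_ge0.
- by rewrite lee_fin mulr_ge0 ?(ltW h0)// mulr_ge0// mulr_ge0// sqr_ge0.
apply: le_integral_nomeas => w; first by apply: integral_ge0 => x _; rewrite lee_fin.
pose y := Y 0 w; pose k0 := 4 * V ^+ 2 * n%:R * gap_sum kappa n w * (1 + `|y| + h) `^ al.
have k00 : 0 <= k0.
  by rewrite mulr_ge0 ?powR_ge0// mulr_ge0// mulr_ge0// mulr_ge0// sqr_ge0.
(* The points x from which the observation y is seen in the cell [c, c + 1). *)
pose J := `[y + h * c, y + h * c + h[%classic : set R.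
have mJ : measurable J by exact: measurable_itv.
apply: (@le_trans _ _ (\int[mu]_x (k0 * \1_J x)%:E)%E).
  apply: le_integral_nomeas => x; first by rewrite lee_fin.
  rewrite lee_fin /G /= -/y /kernel_at {1}/cell.
  case: ifPn => [/andP[cx xc]|_]; last by rewrite normr0 mul0r mulr0 mul0r mulr_ge0.
  move: cx xc; rewrite mulrC ler_pdivlMr// ltr_pdivrMr// mulrDl mul1r => cx xc.
  have xJ : x \in J by rewrite mem_setE in_itv/=; apply/andP; split; lra.
  rewrite indicE xJ mulr1 /k0.
  have cV : `|K (h^-1 * (x - y))| <= V.
    have := cell_le KM c (h^-1 * (x - y)); rewrite /cell.
    rewrite mulrC ler_pdivlMr// ltr_pdivrMr// mulrDl mul1r cx xc/=.
    by rewrite mulrC.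
  have wtle : wt x <= (1 + `|y| + h) `^ al.
    rewrite /wt ge0_ler_powR// ?nnegrE ?addr_ge0// ?(ltW h0)//.
    rewrite -addrA lerD2l; have := ler_normD y (x - h * c - y).
    rewrite subrKC => /le_trans; apply; rewrite lerD2l ger0_norm; lra.
  rewrite (_ : 4 * V ^+ 2 * _ * _ * _ =
     (4 * V * n%:R * (V * gap_sum kappa n w)) * (1 + `|y| + h) `^ al); last by ring.
  apply: ler_pM => //.
    by apply: mulr_ge0; [apply: mulr_ge0 => //; apply: mulr_ge0|exact: mulr_ge0].
  apply: ler_wpM2l; first by apply: mulr_ge0 => //; apply: mulr_ge0.
  by apply: ler_wpM2r => //; rewrite mulrC in cV.
under eq_integral do rewrite EFinM.
rewrite ge0_integralZl//; last first.
  by apply/measurable_EFinP; exact: measurable_indic.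
have iE := @integral_indic _ _ R mu setT measurableT _ mJ.
have -> : (\int[mu]_x (\1_J x)%:E = h%:E)%E.
  rewrite [LHS]iE; apply: (etrans (congr1 (@lebesgue_measure R) (setIT J))).
  by rewrite lebesgue_measure_itv/= lte_fin ltrDl h0 -EFinB addrAC subrr add0r.
by rewrite -!EFinM lee_fin /k0 le_eqVlt; apply/orP; left; apply/eqP; rewrite -/y; ring.
Qed.

End kernel_deviation.

(** * The deviation in L^p *)

Lemma cvg_bigsum (R : realType) (I : Type) (r : seq I) (u : I -> nat -> R) (l : I -> R) :
  (forall i, u i @ \oo --> l i) ->
  (fun N => \sum_(i <- r) u i N) @ \oo --> \sum_(i <- r) l i.
Proof.
move=> ul; elim: r => [|i r IH].
  by rewrite big_nil; under eq_fun do rewrite big_nil; exact: cvg_cst.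
by rewrite big_cons; under eq_fun do rewrite big_cons; exact: cvgD.
Qed.

Lemma cvg_abs_powR (R : realType) (p l : R) (u : nat -> R) : 1 <= p ->
  u @ \oo --> l -> (fun n => `|u n| `^ p) @ \oo --> `|l| `^ p.
Proof.
move=> p1 ul; have al : (fun n => `|u n|) @ \oo --> `|l| by exact: cvg_norm.
have [l0|l0] := eqVneq l 0; last first.
  have pos : 0 < `|l| by rewrite normr_gt0.
  have cont : {for `|l|, continuous (fun t : R => t `^ p)}; last first.
    exact: (cvg_comp (fun n => `|u n|) (fun t => t `^ p) al cont).
  apply: differentiable_continuous; apply/derivable1_diffP.
  by have [] := is_derive1_powR p pos.
rewrite l0 normr0 in al *; rewrite powR0; last lra.
apply: (@squeeze_cvgr _ _ _ _ (fun=> 0) (fun n => `|u n|)) => //; last exact: cvg_cst.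
have : \forall n \near \oo, `|u n| < 1 by apply: cvgr_lt al _ _.
apply: filterS => n un; rewrite powR_ge0/= -mulr_powRB1//; last lra.
rewrite -[leRHS]mulr1 ler_wpM2l//; apply: (@le_trans _ _ (1 `^ (p - 1))); last by rewrite powR1.
by rewrite ge0_ler_powR// ?nnegrE ?(ltW un)//; lra.
Qed.

Section deviation_Lp.
Context {R : realType} {d : measure_display} {T : measurableType d}.
Context {Pr : probability T R} (Y : int -> {RV Pr >-> R}).
Hypothesis hY : strictly_stationary Y.
Context (kappa : nat -> R.-pker (g_sigma_algebraType (past Y 0)) ~> R).
Hypothesis hkappa : forall k : nat, cond_distribution (Y k%:Z) (kappa k).
Local Notation mu := (@lebesgue_measure R).
Context (K : R -> R).
Hypothesis intK : mu.-integrable [set: R] (EFin \o K).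
Context (M : R) (KM : forall a b : R, a <= b -> (total_variation a b K <= M%:E)%E).
Context (W : R) (KW : forall (a : R) (n : nat), \sum_(i < n) cell_bound K (a + i%:R) <= W).
Context (p al : R) (hp : 1 <= p < 2) (al0 : 0 <= al) (alp : 1 < al * (p / (2 - p))).

Let wI : \bar R := (\int[mu]_x ((1 + `|x|) `^ (- (al * (p / (2 - p)))))%:E)%E.

Let wI_fin : wI \is a fin_num.
Proof.
rewrite ge0_fin_numE; first exact: integral_powR_lty.
by apply: integral_ge0 => x _; rewrite lee_fin powR_ge0.
Qed.

(** The factor (W + 1)^p comes from summing over the cells, the last one from
    the two terms of Young's inequality. *)
Definition Lp_constant : R := (W + 1) `^ p * (2 * p + (1 - p / 2) * fine wI).

Let W0 : 0 <= W.
Proof. by have := KW 0 0; rewrite big_ord0. Qed.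

Let wI0 : 0 <= fine wI.
Proof. by apply: fine_ge0; apply: integral_ge0 => x _; rewrite lee_fin powR_ge0. Qed.

Let prodE (F : T * measurableTypeR R -> R) : measurable_fun setT F -> (forall z, 0 <= F z) ->
  (\int[Pr \x mu]_z (F z)%:E = \int[Pr]_w \int[mu]_x (F (w, x))%:E)%E.
Proof.
move=> mF F0; rewrite (@fubini_tonelli1 _ _ T (measurableTypeR R) R Pr mu (fun z => (F z)%:E))//.
exact/measurable_EFinP.
Qed.

Let mdevp (phi : R -> R) h n : bmeas phi ->
  measurable_fun [set: T * measurableTypeR R] (fun z => `|deviation Y phi h n z.1 z.2| `^ p).
Proof.
move=> bphi; apply: (measurableT_comp (measurable_powR _)); apply: measurableT_comp => //.
exact: measurable_deviation.
Qed.

(** The kernel truncated to finitely many cells: Jensen over the cells, then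
    Young's inequality on each of them. *)
Lemma Lp_window (h S a : R) (n m : nat) : 0 < h -> 0 < S -> (0 < n)%N ->
  (\int[Pr]_w (gap_sum kappa n w * (1 + `|Y 0 w| + h) `^ al)%:E <= S%:E)%E ->
  (\int[Pr \x mu]_z (`|deviation Y (fun z => if (a <= z < a + m%:R)%R then K z else 0%R) h n z.1 z.2| `^ p)%:E
   <= (Lp_constant * (n%:R * h * S) `^ (p / 2))%:E)%E.
Proof.
move=> h0 S0 n0 SS; have [p1 p2] := andP hp.
have nR : 0 < n%:R :> R by rewrite ltr0n.
have A0 : 0 < n%:R * h * S by rewrite !mulr_gt0.
(* L is the size of the deviation; at this scale both terms of Young's
   inequality have the same order. *)
pose L : R := (n%:R * h * S) `^ (2^-1).
have L0 : 0 < L by exact: powR_gt0.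
have L2 : L ^+ 2 = n%:R * h * S.
  rewrite -powR_mulrn ?ltW// -powRrM (_ : 2^-1 * 2%:R = 1); last by field.
  by rewrite powRr1// ltW.
have LpE : L `^ p = (n%:R * h * S) `^ (p / 2) by rewrite -powRrM; congr (_ `^ _); ring.
pose c (i : 'I_m) : R := a + i%:R.
pose V i := cell_bound K (c i).
have V0 i : 0 <= V i by exact: (cell_bound_ge0 KM).
(* The summand 1 / (m + 1) keeps the weights positive where the bound of the
   cell vanishes, and adds less than 1 in total. *)
pose v i := V i + m.+1%:R^-1.
have v0 i : 0 < v i by rewrite ltr_wpDl ?V0// invr_gt0.
have Vv i : V i <= v i by rewrite lerDl.
have vW : \sum_(i < m) v i <= W + 1.
  rewrite big_split/= lerD//; first exact: KW.
  by rewrite sumr_const card_ord -[_ *+ m]mulr_natl ler_pdivrMr// mul1r ler_nat.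
have W1 : 0 < W + 1 by rewrite ltr_wpDl.
pose dv (i : 'I_m) (z : T * measurableTypeR R) := deviation Y (cell K (c i)) h n z.1 z.2.
pose wt (i : 'I_m) (z : T * measurableTypeR R) : R := (1 + `|z.2 - h * c i|) `^ al.
pose wi (i : 'I_m) (z : T * measurableTypeR R) : R :=
  (1 + `|z.2 - h * c i|) `^ (- (al * (p / (2 - p)))).
pose k1 i : R := (W + 1) `^ (p - 1) * (v i * (L `^ p * (p / 2 / (v i ^+ 2 * L ^+ 2)))).
pose k2 i : R := (W + 1) `^ (p - 1) * (v i * (L `^ p * (1 - p / 2))).
have k10 i : 0 <= k1 i.
  rewrite mulr_ge0 ?powR_ge0// mulr_ge0 ?(ltW (v0 i))// mulr_ge0 ?powR_ge0// divr_ge0//.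
    by lra.
  by rewrite mulr_ge0// sqr_ge0.
have k20 i : 0 <= k2 i.
  by rewrite mulr_ge0 ?powR_ge0// mulr_ge0 ?(ltW (v0 i))// mulr_ge0 ?powR_ge0//; lra.
have bc i := bmeas_cell intK KM (c i).
have mb (i : 'I_m) (g : R) : measurable_fun [set: T * measurableTypeR R]
    (fun z : T * measurableTypeR R => (1 + `|z.2 - h * c i|) `^ g).
  apply: (measurableT_comp (measurable_powR _)); apply: measurable_funD => //.
  by apply: measurableT_comp => //; apply: measurable_funB => //; exact: measurable_snd.
have mA i : measurable_fun [set: T * measurableTypeR R] (fun z => dv i z ^+ 2 * wt i z).
  by apply: measurable_funM; [apply: measurable_funX; exact: measurable_deviation|exact: mb].
have A0' i z : 0 <= dv i z ^+ 2 * wt i z by rewrite mulr_ge0 ?sqr_ge0 ?powR_ge0.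
have pointwise z :
    `|deviation Y (fun z => if (a <= z < a + m%:R)%R then K z else 0%R) h n z.1 z.2| `^ p <=
    \sum_(i < m) (k1 i * (dv i z ^+ 2 * wt i z) + k2 i * wi i z).
  have -> : (fun z => if a <= z < a + m%:R then K z else 0) =
      (fun z => \sum_(i < m) cell K (c i) z) by apply/funext => y; rewrite sum_cells.
  rewrite deviation_sum//.
  apply: (le_trans (sum_powR_le (fun i : 'I_m => dv i z) p1 W1 v0 vW)).
  rewrite mulr_sumr; apply: ler_sum => i _.
  have wpos : 0 < wt i z by rewrite powR_gt0// ltr_pwDl.
  have := young_weight (dv i z) hp (v0 i) L0 wpos.
  rewrite {2}/wt -powRrM mulrN -/(wi i z) => /(ler_wpM2l (ltW (v0 i))).
  move=> /(ler_wpM2l (powR_ge0 (W + 1) (p - 1))) /le_trans; apply.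
  by rewrite le_eqVlt; apply/orP; left; apply/eqP; rewrite /k1 /k2; ring.
apply: (@le_trans _ _ (\sum_(i < m)
   ((k1 i)%:E * \int[Pr \x mu]_z (dv i z ^+ 2 * wt i z)%:E +
    (k2 i)%:E * \int[Pr \x mu]_z (wi i z)%:E))%E).
  apply: (@le_trans _ _ (\int[Pr \x mu]_z
     (\sum_(i < m) ((k1 i)%:E * (dv i z ^+ 2 * wt i z)%:E + (k2 i)%:E * (wi i z)%:E)))%E).
    apply: le_integral_nomeas => z; first by rewrite lee_fin powR_ge0.
    under eq_bigr do rewrite -!EFinM -EFinD.
    by rewrite sumEFin lee_fin.
  rewrite ge0_integral_sum//; last 2 first.
  - move=> i; apply: emeasurable_funD; apply: measurable_funeM; apply/measurable_EFinP => //.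
    exact: mb.
  - move=> i z _; apply: adde_ge0; rewrite mule_ge0 ?lee_fin ?powR_ge0//.
  apply: lee_sum => i _; rewrite ge0_integralD//; last 4 first.
  - by move=> z _; rewrite lee_fin mulr_ge0.
  - by apply: measurable_funeM; apply/measurable_EFinP.
  - by move=> z _; rewrite lee_fin mulr_ge0 ?powR_ge0.
  - by apply: measurable_funeM; apply/measurable_EFinP; exact: mb.
  rewrite !ge0_integralZl//; first last.
  all: try by rewrite lee_fin.
  all: try by move=> z _; rewrite lee_fin ?powR_ge0.
  exact/measurable_EFinP.
  by apply/measurable_EFinP; exact: mb.
have sh i : (\int[mu]_x ((1 + `|x - h * c i|) `^ (- (al * (p / (2 - p)))))%:E = wI)%E.
  have := @ge0_integral_affine R 1 (- (h * c i))
    (fun x => ((1 + `|x|) `^ (- (al * (p / (2 - p)))))%:E) (oner_neq0 _).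
  rewrite normr1 invr1 mul1e -/wI => <-.
  - by apply: eq_integral => x _; rewrite mul1r.
  - apply/measurable_EFinP; apply: (measurableT_comp (measurable_powR _)).
    by apply: measurable_funD => //; exact: measurableT_comp.
  - by move=> x; rewrite lee_fin powR_ge0.
have wiE i : (\int[Pr \x mu]_z (wi i z)%:E = (fine wI)%:E)%E.
  rewrite prodE//; [|exact: mb|by move=> z; exact: powR_ge0].
  rewrite fineK// /wi /=; under eq_integral do rewrite sh.
  by rewrite integral_cst//= probability_setT mule1.
have AE i : (\int[Pr \x mu]_z (dv i z ^+ 2 * wt i z)%:E <= (4 * V i ^+ 2 * n%:R * h * S)%:E)%E.
  rewrite prodE//; apply: (le_trans (cell_second_moment hY hkappa intK KM (c i) n h0 al0)).
  rewrite [leRHS]EFinM lee_wpmul2l// lee_fin mulr_ge0 ?(ltW h0)// mulr_ge0// mulr_ge0//.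
  exact: sqr_ge0.
apply: (@le_trans _ _ (\sum_(i < m) ((k1 i * (4 * V i ^+ 2 * n%:R * h * S) + k2 i * fine wI)%:E))%E).
  apply: lee_sum => i _; rewrite wiE -EFinM EFinD leeD2r// [leRHS]EFinM.
  by rewrite lee_wpmul2l ?AE// lee_fin.
rewrite sumEFin lee_fin.
apply: (@le_trans _ _ (\sum_(i < m) v i * ((W + 1) `^ (p - 1) * (L `^ p * (2 * p + (1 - p / 2) * fine wI))))).
  apply: ler_sum => i _.
  have -> : k1 i * (4 * V i ^+ 2 * n%:R * h * S) =
      ((W + 1) `^ (p - 1) * (v i * (L `^ p * (2 * p)))) * (V i ^+ 2 / v i ^+ 2).
    rewrite (_ : 4 * V i ^+ 2 * n%:R * h * S = 4 * V i ^+ 2 * L ^+ 2); last by rewrite L2; ring.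
    by rewrite /k1; field; rewrite !gt_eqF.
  have Vv1 : V i ^+ 2 / v i ^+ 2 <= 1.
    rewrite ler_pdivrMr ?exprn_gt0// mul1r ler_sqr ?nnegrE//.
    exact: ltW.
  apply: (@le_trans _ _ ((W + 1) `^ (p - 1) * (v i * (L `^ p * (2 * p))) + k2 i * fine wI)).
    rewrite lerD2r -[leRHS]mulr1 ler_wpM2l// mulr_ge0 ?powR_ge0// mulr_ge0 ?(ltW (v0 i))//.
    by rewrite mulr_ge0 ?powR_ge0//; lra.
  by rewrite le_eqVlt; apply/orP; left; apply/eqP; rewrite /k2; ring.
rewrite -mulr_suml -LpE /Lp_constant.
have W1p : (W + 1) * (W + 1) `^ (p - 1) = (W + 1) `^ p by rewrite mulr_powRB1 ?(ltW W1)//; lra.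
rewrite -W1p (_ : (W + 1) * _ * _ * _ =
  (W + 1) * ((W + 1) `^ (p - 1) * (L `^ p * (2 * p + (1 - p / 2) * fine wI)))); last by ring.
rewrite ler_wpM2r// mulr_ge0 ?powR_ge0// mulr_ge0 ?powR_ge0// addr_ge0//; first by lra.
by rewrite mulr_ge0//; lra.
Qed.

(** Fatou's lemma removes the truncation of the kernel. *)
Lemma Lp_deviation (h S : R) (n : nat) : 0 < h -> 0 < S -> (0 < n)%N ->
  (\int[Pr]_w (gap_sum kappa n w * (1 + `|Y 0 w| + h) `^ al)%:E <= S%:E)%E ->
  (\int[Pr]_w \int[mu]_x (`|deviation Y K h n w x| `^ p)%:E
   <= (Lp_constant * (n%:R * h * S) `^ (p / 2))%:E)%E.
Proof.
move=> h0 S0 n0 SS; have [p1 p2] := andP hp.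
have [B KB] := bounded_variation_bounded KM.
have mK : measurable_fun [set: R] K by apply/measurable_EFinP; exact: (measurable_int _ intK).
have bK : bmeas K by split => //; exists B.
(* K restricted to [-N, N), a union of 2N cells. *)
pose KN (N : nat) (z : R) := if (- N%:R <= z < - N%:R + N.*2%:R)%R then K z else 0.
have KNB N z : `|KN N z| <= B.
  by rewrite /KN; case: ifP => // _; rewrite normr0; exact: le_trans (KB z).
have bKN N : bmeas (KN N) by split; [exact: (measurable_window intK)|exists B].
have KNE (z : R) : \forall N \near \oo, KN N z = K z.
  near=> N; rewrite /KN; case: ifPn => //; rewrite -addnn natrD addKr.
  have zN : `|z| < N%:R.
    by near: N; exists (Num.truncn `|z|).+1 => // k /= hk;
      apply: (lt_le_trans (truncnS_gt _)); rewrite ler_nat.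
  by move: zN; rewrite ltr_norml => /andP[/ltW -> ->].
rewrite -(prodE (F := fun z => `|deviation Y K h n z.1 z.2| `^ p)); last 2 first.
- exact: mdevp.
- by move=> z; exact: powR_ge0.
apply: (@fatou_bound _ _ R (Pr \x mu)%E (fun N (z : T * measurableTypeR R) => (`|deviation Y (KN N) h n z.1 z.2| `^ p)%:E)
  (fun z => (`|deviation Y K h n z.1 z.2| `^ p)%:E)).
- by move=> N; apply/measurable_EFinP; exact: mdevp.
- by move=> N z; rewrite lee_fin powR_ge0.
- move=> [w x] /=; apply/cvg_EFin; first exact: nearW.
  have cvgE : (fun N => \int[Pr]_w' kernel_at (KN N) h x (Y 0 w'))%R @ \oo -->
      (\int[Pr]_w' kernel_at K h x (Y 0 w'))%R.
    have := @dominated_convergence _ _ _ Pr setT measurableT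
      (fun N w' => (kernel_at (KN N) h x (Y 0 w'))%:E) (fun w' => (kernel_at K h x (Y 0 w'))%:E)
      (fun=> B%:E).
    have bk N := bmeas_comp Y 0 (bmeas_kernel_at h x (bKN N)).
    have bk0 := bmeas_comp Y 0 (bmeas_kernel_at h x bK).
    case.
    + by move=> N; apply/measurable_EFinP; exact: (bk N).1.
    + by apply/measurable_EFinP; exact: bk0.1.
    + apply: aeW => w' _; apply: cvg_near_cst.
      by have := KNE (h^-1 * (x - Y 0 w')); apply: filterS => N; rewrite /kernel_at => ->.
    + exact: (bmeas_integrable Pr (bmeas_cst B)).
    + by apply: aeW => w' N _; rewrite lee_fin; exact: KNB.
    move=> _ _ H; apply: fine_cvg; rewrite fineK//.
    exact: (integrable_fin_num measurableT (bmeas_integrable Pr bk0)).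
  have cvgD_ : (fun N => deviation Y (KN N) h n w x) @ \oo --> deviation Y K h n w x.
    apply: cvg_bigsum => k; apply: cvgB => //; apply: cvg_near_cst.
    exact: KNE.
  exact: cvg_abs_powR.
- by move=> N; exact: Lp_window.
Unshelve. all: by end_near. Qed.

End deviation_Lp.

(** * Moments of the summed dependence coefficients *)

(** Induction on n: the increment of the a-th power is at most a l^(a-1) b n
    where l is the new partial sum, and l is at most n + 1 since the terms
    are at most 1. *)
Lemma power_of_sum_le (R : realType) (a : R) (b : nat -> R) (n : nat) :
  1 <= a -> (forall k, 0 <= b k <= 1) ->
  (\sum_(0 <= k < n) b k) `^ a <= a * \sum_(0 <= k < n) k.+1%:R `^ (a - 1) * b k.
Proof.
move=> a1 b01; have b0 k : 0 <= b k by have /andP[] := b01 k.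
elim: n => [|n IH].
  by rewrite !big_nil mulr0 powR0//; lra.
rewrite !big_nat_recr//= mulrDr.
set y := \sum_(0 <= k < n) b k in IH *; set l := y + b n.
have y0 : 0 <= y by apply: sumr_ge0.
have l0 : 0 <= l by rewrite addr_ge0.
have ln : l <= n.+1%:R.
  rewrite /l -natr1; apply: lerD; last by have /andP[] := b01 n.
  rewrite /y big_mkord -[X in _ <= X%:R]card_ord -sumr_const; apply: ler_sum => k _.
  by have /andP[] := b01 k.
have step : l `^ a <= y `^ a + a * l `^ (a - 1) * b n.
  have := young_tangent a1 l0 y0.
  have : l * l `^ (a - 1) = l `^ a by rewrite mulr_powRB1//; lra.
  have -> : y = l - b n by rewrite /l addrK.
  move: (l `^ (a - 1)) (l `^ a) ((l - b n) `^ a) => u v z uv; rewrite -uv; lra.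
apply: (le_trans step); apply: lerD => //.
rewrite -mulrA ler_wpM2l//; first lra.
by rewrite ler_wpM2r// ge0_ler_powR// ?nnegrE//; lra.
Qed.

Section gap_moments.
Context {R : realType} {d : measure_display} {T : measurableType d}.
Context {Pr : probability T R} (Y : int -> {RV Pr >-> R}).
Context (kappa : nat -> R.-pker (g_sigma_algebraType (past Y 0)) ~> R).
Context (p q eps : R) (hp : 1 <= p < 2) (hq : 1 < q) (heps : 0 < eps).
Hypothesis hmoment :
  ('E_Pr[(fun w => `|Y 0 w| `^ (q * (2 - p) / p + eps))%R] < +oo)%E.

(** Times q, this is the order of the moment of Y_0 that is assumed finite;
    times p / (2 - p), it exceeds 1, which makes the dual weight integrable
    on the line. *)
Definition weight_exponent : R := (2 - p) / p + eps / q.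

Lemma weight_exponent_ge0 : 0 <= weight_exponent.
Proof.
have /andP[p1 p2] := hp; have q1 := hq; have ep := heps.
by apply: addr_ge0; apply: divr_ge0; lra.
Qed.

Lemma weight_exponent_gt : 1 < weight_exponent * (p / (2 - p)).
Proof.
have /andP[p1 p2] := hp; have q1 := hq; have ep := heps.
rewrite (_ : _ * _ = 1 + eps / q * (p / (2 - p))); last first.
  by rewrite /weight_exponent; field; do ?[apply/andP; split]; lra.
by rewrite ltrDl; apply: mulr_gt0; apply: divr_gt0; lra.
Qed.

Lemma gap_le_beta k : (\int[Pr]_w (gap kappa k w)%:E <= dep_beta1 (kappa k))%E.
Proof.
apply: le_integral_nomeas => w; first by rewrite lee_fin gap_ge0.
exact: rational_gap_le_sup (@Q1 _ _ _ _ Y) w.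
Qed.

Let e := q * (2 - p) / p + eps.

Let qe : weight_exponent * q = e.
Proof.
have /andP[p1 p2] := hp; have q1 := hq.
by rewrite /weight_exponent /e; field; do ?[apply/andP; split]; lra.
Qed.

Let e0 : 0 <= e.
Proof. rewrite -qe; apply: mulr_ge0; first exact: weight_exponent_ge0.
by have q1 := hq; lra. Qed.

Lemma weight_moment_lty (H : R) : 0 <= H ->
  (\int[Pr]_w ((1 + `|Y 0 w| + H) `^ e)%:E < +oo)%E.
Proof.
move=> H0; have ee := e0; have mY : measurable_fun [set: T] (Y 0) by exact: measurable_funP.
have c0 : 0 <= (2 * (1 + H)) `^ e by exact: powR_ge0.
have d0 : 0 <= 2 `^ e :> R by exact: powR_ge0.
have mYe : measurable_fun [set: T] (fun w => (`|Y 0 w| `^ e)%:E).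
  by apply/measurable_EFinP; apply: (measurableT_comp (measurable_powR _)); exact: measurableT_comp.
apply: (@le_lt_trans _ _ (\int[Pr]_w (((2 * (1 + H)) `^ e)%:E + (2 `^ e)%:E * (`|Y 0 w| `^ e)%:E))%E).
  apply: le_integral_nomeas => w; first by rewrite lee_fin powR_ge0.
  rewrite -EFinM -EFinD lee_fin -powRM//.
  have [YH|/ltW YH] := leP `|Y 0 w| (1 + H).
    apply: (@le_trans _ _ ((2 * (1 + H)) `^ e)); last by rewrite lerDl powR_ge0.
    by apply: ge0_ler_powR => //; rewrite ?nnegrE; have := normr_ge0 (Y 0 w); lra.
  apply: (@le_trans _ _ ((2 * `|Y 0 w|) `^ e)); last by rewrite lerDr powR_ge0.
  by apply: ge0_ler_powR => //; rewrite ?nnegrE; have := normr_ge0 (Y 0 w); lra.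
rewrite ge0_integralD//; last first.
  by apply: measurable_funeM.
rewrite integral_cst//= probability_setT mule1 ge0_integralZl//.
by rewrite lte_add_pinfty ?ltry// lte_mul_pinfty// ?lee_fin// -/e; move: hmoment; rewrite unlock.
Qed.

(** Young's inequality with exponents q and q / (q - 1) separates the weight
    from the gap sum, the latter being scaled by n^delta. *)
Lemma gap_moment (n : nat) (M h H delta : R) : (0 < n)%N -> 0 < h -> h <= H ->
  (\sum_(0 <= k < n.+1) ((k.+1%:R `^ (1 / (q - 1)))%:E * dep_beta1 (kappa k)) <=
     (M * n%:R `^ (delta * q / (q - 1)))%:E)%E ->
  (\int[Pr]_w (gap_sum kappa n w * (1 + `|Y 0 w| + h) `^ weight_exponent)%:E <=
    (n%:R `^ delta * (M + fine (\int[Pr]_w ((1 + `|Y 0 w| + H) `^ e)%:E)%E / q))%:E)%E.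
Proof.
move=> n0 h0 hH hM; have q1 := hq; have H0 : 0 <= H by apply: le_trans hH; exact: ltW.
have nR : 0 < n%:R :> R by rewrite ltr0n.
have Wlt := weight_moment_lty H0; set Wq := (\int[Pr]_w _)%E in Wlt *.
have Wq0 : (0 <= Wq)%E by apply: integral_ge0 => w _; rewrite lee_fin powR_ge0.
have Wfin : Wq \is a fin_num by rewrite ge0_fin_numE.
pose a := q / (q - 1).
have a1 : 1 <= a by rewrite ler_pdivlMr ?mul1r//; lra.
have aE : a - 1 = 1 / (q - 1) by rewrite /a; field; lra.
pose D := n%:R `^ delta; have D0 : 0 < D by exact: powR_gt0.
have DaE : D `^ a = n%:R `^ (delta * q / (q - 1)) by rewrite -powRrM mulrA.
have Da0 : 0 < D `^ a by exact: powR_gt0.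
have q0 : 0 < q by lra.
have qi : q^-1 + a^-1 = 1 by rewrite /a; field; rewrite !gt_eqF//; lra.
have mg k : measurable_fun [set: T] (gap kappa k) := (gap_bmeas kappa k).1.
have mY : measurable_fun [set: T] (fun w => (1 + `|Y 0 w| + H) `^ e).
  apply: (measurableT_comp (measurable_powR _)); apply: measurable_funD => //.
  by apply: measurable_funD => //; apply: measurableT_comp => //; exact: measurable_funP.
(* Young's inequality with the conjugate exponents q and a, for B / n^delta. *)
have pt w : gap_sum kappa n w * (1 + `|Y 0 w| + h) `^ weight_exponent <=
   D / D `^ a * \sum_(0 <= k < n.+1) k.+1%:R `^ (1 / (q - 1)) * gap kappa k w +
   D / q * (1 + `|Y 0 w| + H) `^ e.
  set B := gap_sum kappa n w; have B0 : 0 <= B by apply: sumr_ge0 => k _; exact: gap_ge0.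
  set w1 := (1 + `|Y 0 w| + H) `^ weight_exponent.
  have w10 : 0 <= w1 by exact: powR_ge0.
  have BD0 : 0 <= B / D by rewrite divr_ge0// ltW.
  apply: (@le_trans _ _ (B * w1)).
    rewrite ler_wpM2l// ge0_ler_powR// ?nnegrE ?weight_exponent_ge0//.
    - by rewrite addr_ge0// ?addr_ge0// ltW.
    - by rewrite addr_ge0// addr_ge0.
    - by rewrite lerD2l.
  have aa : 0 < a by lra.
  have := @conjugate_powR R w1 (B / D) q a w10 BD0 q0 aa qi.
  rewrite -powRrM qe => yg.
  have BDE : (B / D) `^ a = B `^ a / D `^ a.
    have {2}-> : B = B / D * D by rewrite divfK ?gt_eqF.
    by rewrite (powRM _ BD0 (ltW D0)) mulfK// gt_eqF.
  have bs : B `^ a <= a * \sum_(0 <= k < n.+1) k.+1%:R `^ (1 / (q - 1)) * gap kappa k w.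
    rewrite -aE; apply: power_of_sum_le => // k.
    by rewrite gap_ge0 gap_le1.
  rewrite (_ : B * w1 = D * (w1 * (B / D))); last by field; rewrite gt_eqF.
  apply: (le_trans (ler_wpM2l (ltW D0) yg)); rewrite mulrDr addrC.
  apply: lerD; last by rewrite mulrCA mulrC.
  rewrite BDE (_ : D * (B `^ a / D `^ a / a) = D / D `^ a * (B `^ a / a)); last first.
    by field; rewrite !gt_eqF.
  rewrite ler_wpM2l ?divr_ge0 ?(ltW D0) ?(ltW Da0)//.
  by rewrite ler_pdivrMr// mulrC.
apply: (@le_trans _ _ (\int[Pr]_w
   ((D / D `^ a)%:E * (\sum_(0 <= k < n.+1) ((k.+1%:R `^ (1 / (q - 1)))%:E * (gap kappa k w)%:E)) +
    (D / q)%:E * ((1 + `|Y 0 w| + H) `^ e)%:E))%E).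
  apply: le_integral_nomeas => w.
    by rewrite lee_fin mulr_ge0 ?powR_ge0//; apply: sumr_ge0 => k _; exact: gap_ge0.
  under eq_bigr do rewrite -EFinM.
  by rewrite sumEFin -!EFinM -EFinD lee_fin.
have DD0 : (0 <= (D / D `^ a)%:E)%E by rewrite lee_fin divr_ge0// ltW.
have Dq0 : (0 <= (D / q)%:E)%E by rewrite lee_fin divr_ge0// ltW.
have s0 w : (0 <= \sum_(0 <= k < n.+1) ((k.+1%:R `^ (1 / (q - 1)))%:E * (gap kappa k w)%:E))%E.
  by apply: sume_ge0 => k _; rewrite mule_ge0 ?lee_fin ?powR_ge0 ?gap_ge0.
have ms : measurable_fun [set: T] (fun w =>
   \sum_(0 <= k < n.+1) ((k.+1%:R `^ (1 / (q - 1)))%:E * (gap kappa k w)%:E))%E.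
  by apply: emeasurable_sum => k; apply: measurable_funeM; exact/measurable_EFinP.
rewrite ge0_integralD//; last 4 first.
- by move=> w _; rewrite mule_ge0.
- exact: measurable_funeM.
- by move=> w _; rewrite mule_ge0// lee_fin powR_ge0.
- by apply: measurable_funeM; exact/measurable_EFinP.
rewrite ge0_integralZl// ge0_integralZl//; last 2 first.
- exact/measurable_EFinP.
- by move=> w _; rewrite lee_fin powR_ge0.
rewrite -/Wq ge0_integral_sum//; last 2 first.
- by move=> k; apply: measurable_funeM; exact/measurable_EFinP.
- by move=> k w _; rewrite mule_ge0 ?lee_fin ?powR_ge0 ?gap_ge0.
rewrite mulrDr EFinD; apply: leeD; last first.
  by rewrite -(fineK Wfin) -EFinM lee_fin /D mulrA mulrAC.
apply: (@le_trans _ _ ((D / D `^ a)%:E * (M * n%:R `^ (delta * q / (q - 1)))%:E)%E).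
  rewrite lee_wpmul2l//; apply: le_trans hM; apply: lee_sum => k _.
  rewrite ge0_integralZl//; last 2 first.
  - exact/measurable_EFinP.
  - by move=> w _; rewrite lee_fin gap_ge0.
  by rewrite lee_wpmul2l ?lee_fin ?powR_ge0// gap_le_beta.
rewrite -DaE -EFinM lee_fin -/D le_eqVlt; apply/orP; left; apply/eqP.
by field; rewrite gt_eqF.
Qed.

End gap_moments.

(** * Primitives and finite differences *)

Section primitive.
Context {R : realType}.
Local Notation mu := (@lebesgue_measure R).

Definition primitive (phi : R -> R) (x : R) : R :=
  (\int[mu]_(t in `]-oo, x]) phi t)%R.

Lemma primitiveB (phi : R -> R) (a b : R) : mu.-integrable [set: R] (EFin \o phi) ->
  a <= b -> primitive phi b - primitive phi a = (\int[mu]_(t in `]a, b]) phi t)%R.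
Proof.
move=> iphi ab; apply: Rintegral_itvB => //.
by apply: (integrableS measurableT) => //; exact: measurable_itv.
Qed.

Lemma le_primitiveB (phi : R -> R) (a b : R) : mu.-integrable [set: R] (EFin \o phi) ->
  a <= b -> (`|primitive phi b - primitive phi a|%:E <= \int[mu]_(t in `]a, b[) `|phi t|%:E)%E.
Proof.
move=> iphi ab; rewrite primitiveB//.
have mI : measurable (`]a, b]%classic : set (measurableTypeR R)) by exact: measurable_itv.
have iI : mu.-integrable `]a, b] (EFin \o phi) by apply: (integrableS measurableT).
have := le_normr_Rintegral mI iI; rewrite -lee_fin => /le_trans; apply.
rewrite /Rintegral fineK; last first.
  by apply: integrable_fin_num => //; exact: (integrable_norm iI).
rewrite (@integral_itv_bndo_bndc _ (BRight a) b)//.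
by apply/measurable_EFinP; apply: measurableT_comp => //; apply/measurable_EFinP;
  exact: (measurable_funS measurableT (@subsetT _ _) (measurable_int _ iphi)).
Qed.

(** Absolute continuity of the integral. *)
Lemma primitive_abs_continuous (phi : R -> R) : mu.-integrable [set: R] (EFin \o phi) ->
  abs_continuous (primitive phi).
Proof.
move=> iphi M e e0.
have [dl [dl0 small]] := integral_normr_continuous iphi e0.
exists dl => // n a b abM tr sd.
pose F (i : 'I_n) : set (measurableTypeR R) := `]a i, b i[%classic.
have mF i : measurable (F i) by exact: measurable_itv.
have ab i : a i <= b i by have [_ []] := abM i.
pose A := \big[setU/set0]_(i < n) F i.
have mA : measurable A by apply: bigsetU_measurable => i _; exact: mF.
have muA : (mu A < dl%:E)%E.
  rewrite (measure_semi_additive_ord mu mF tr mA).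
  rewrite -lte_fin in sd; apply: le_lt_trans sd; rewrite -sumEFin.
  apply: lee_sum => i _.
  rewrite [X in (X <= _)%E](_ : _ = lebesgue_measure `]a i, b i[%classic)//.
  rewrite lebesgue_measure_itv/= lte_fin.
  by case: ifP => // _; rewrite lee_fin subr_ge0.
have := small A mA muA; rewrite -lte_fin /Rintegral fineK; last first.
  apply: integrable_fin_num => //; apply: integrable_norm.
  exact: (integrableS measurableT).
move=> lt; rewrite -lte_fin; apply: le_lt_trans lt; rewrite -sumEFin.
have mabs : measurable_fun A (fun t => `|phi t|%:E).
  apply/measurable_EFinP; apply: measurableT_comp => //; apply/measurable_EFinP.
  exact: (measurable_funS measurableT (@subsetT _ _) (measurable_int _ iphi)).
rewrite (ge0_integral_bigsetU mu mF (index_enum_uniq _) _ mabs)//; last exact: sub_trivIset tr.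
by apply: lee_sum => i _; exact: le_primitiveB.
Qed.

Lemma primitive_continuous (phi : R -> R) : mu.-integrable [set: R] (EFin \o phi) ->
  continuous (primitive phi).
Proof.
move=> iphi x; have ac := primitive_abs_continuous iphi.
apply/cvgrPdist_lt => e e0.
have [dl dl0 H] := ac (`|x| + 1) e e0.
near=> y; have xy : `|x - y| < Num.min dl 1.
  near: y; apply: (@cvgr_dist_lt _ _ _ (nbhs x) _ id x) => //.
  by rewrite lt_min dl0 ltr01.
move: xy; rewrite lt_min => /andP[xyd xy1].
have key (a b : R) : a <= b -> `|x - a| < 1 -> `|x - b| < 1 -> b - a < dl ->
    `|primitive phi b - primitive phi a| < e.
  move=> ab xa xb bad.
  have := H 1%N (fun=> a) (fun=> b).
  rewrite !big_ord1; apply => //.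
    move=> _; move: xa xb; rewrite !ltr_norml => /andP[? ?] /andP[? ?].
    have := ler_norm x; have := ler_norm (- x); rewrite normrN => *.
    by split; [lra|split => //; lra].
  by move=> i j _ _ _; rewrite (ord1 i) (ord1 j).
have x1 : `|x - x| < 1 by rewrite subrr normr0.
have [xley|/ltW ylex] := leP x y.
  by rewrite distrC; apply: key => //; rewrite -(ger0_norm (_ : 0 <= y - x)) ?subr_ge0// distrC.
by apply: key => //; rewrite -(ger0_norm (_ : 0 <= x - y)) ?subr_ge0.
Unshelve. all: by end_near. Qed.

Lemma primitive_derive_ae (phi : R -> R) : mu.-integrable [set: R] (EFin \o phi) ->
  {ae mu, forall x, is_derive x (1 : R) (primitive phi) (phi x)}.
Proof.
move=> iphi; have loc := open_integrable_locally openT iphi.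
have iy y : mu.-integrable `]-oo, y] (EFin \o phi).
  by apply: (integrableS measurableT) => //; exact: measurable_itv.
have := FTC1Ny iy loc; apply: filterS; first exact: (ae_filter_ringOfSetsType mu).
move=> x [dx xE].
by rewrite derive1E in xE; apply: DeriveDef; [exact: dx|exact: xE].
Qed.

Lemma primitive_derive (phi : R -> R) x : mu.-integrable [set: R] (EFin \o phi) ->
  {for x, continuous phi} -> is_derive x (1 : R) (primitive phi) (phi x).
Proof.
move=> iphi cx; have iy : mu.-integrable `]-oo, (x + 1)] (EFin \o phi).
  by apply: (integrableS measurableT) => //; exact: measurable_itv.
have xu : x < x + 1 by rewrite ltrDl.
have [dx xE] := @continuous_FTC1 _ phi -oo%O x (x + 1) xu iy (ltNyr x) cx.
by rewrite derive1E in xE; apply: DeriveDef; [exact: dx|exact: xE].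
Qed.

Lemma abs_continuous_diff (b : R) (G : R -> R) : abs_continuous G ->
  abs_continuous (forward_diff b G).
Proof.
move=> acG M e e0; have e2 : 0 < e / 2 by rewrite divr_gt0.
have [d1 d10 H1] := acG M (e / 2) e2.
have [d2 d20 H2] := acG (M + `|b|) (e / 2) e2.
exists (Num.min d1 d2); first by rewrite lt_min d10 d20.
move=> n u v uvM tr; rewrite lt_min => /andP[s1 s2].
have := H1 n u v uvM tr s1.
have : \sum_(i < n) `|G (v i + b) - G (u i + b)| < e / 2.
  apply: (H2 n (fun i => u i + b) (fun i => v i + b)).
  - move=> i; have [? [? ?]] := uvM i; have := ler_norm b; have := ler_norm (- b).
    by rewrite normrN lerD2r => *; split; [lra|split => //; lra].
  - move=> i j _ _ [x []] /=; rewrite !in_itv/= => /andP[x1 x2] /andP[x3 x4].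
    apply: tr => //; exists (x - b); split => /=; rewrite in_itv/=;
      by rewrite ltrBrDr ltrBlDr ?x1 ?x2 ?x3 ?x4.
  - by under eq_bigr do rewrite opprD addrACA subrr addr0.
move=> h2 h1; apply: (@le_lt_trans _ _ (\sum_(i < n) `|G (v i) - G (u i)| +
    \sum_(i < n) `|G (v i + b) - G (u i + b)|)); last by lra.
rewrite -big_split/=; apply: ler_sum => i _; rewrite /forward_diff.
rewrite (_ : _ - _ = - (G (v i) - G (u i)) + (G (v i + b) - G (u i + b))); last by ring.
by rewrite (le_trans (ler_normD _ _))// normrN.
Qed.

Lemma abs_continuousZ (c : R) (G : R -> R) : abs_continuous G ->
  abs_continuous (fun x => c * G x).
Proof.
move=> acG M e e0; have c1 : 0 < `|c| + 1 by rewrite ltr_wpDl.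
have [dl dl0 H] := acG M (e / (`|c| + 1)) (divr_gt0 e0 c1).
exists dl => // n u v uvM tr s1; have := H n u v uvM tr s1.
rewrite ltr_pdivlMr// => h; apply: le_lt_trans h; rewrite mulr_suml.
apply: ler_sum => i _; rewrite -mulrBr normrM mulrC ler_wpM2l//.
by rewrite lerDl.
Qed.

Lemma is_derive_diff (b x : R) (G : R -> R) (g : R -> R) :
  is_derive (x + b) (1 : R) G (g (x + b)) -> is_derive x (1 : R) G (g x) ->
  is_derive x (1 : R) (forward_diff b G) (forward_diff b g x).
Proof.
move=> d1 d2; apply: is_deriveB => //.
have sh : is_derive x (1 : R) (fun y : R => y + b) 1.
  have := @is_deriveD _ _ _ id (cst b) x 1 1 0 (is_derive_id _ _) (is_derive_cst _ _ _).
  by rewrite addr0.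
by have := is_derive1_comp (f := G) (g := fun y => y + b) (x := x) d1 sh; rewrite mulr1.
Qed.

(** Lebesgue null sets are invariant under translation. *)
Lemma ae_shift (P : R -> Prop) (b : R) : {ae mu, forall x, P x} -> {ae mu, forall x, P (x + b)}.
Proof.
move=> [A [mA A0 PA]].
have mphi : measurable_fun [set: measurableTypeR R] (fun x : R => x + b : measurableTypeR R).
  by apply: measurable_funD.
have mB : measurable ((fun x : R => x + b) @^-1` A : set (measurableTypeR R)).
  by rewrite -[X in measurable X]setTI; exact: mphi measurableT A mA.
exists ((fun x => x + b) @^-1` A); split => //; last by move=> x /= nPx; apply: PA.
have mA' : measurable_fun [set: R] (fun x => (\1_A x)%:E : \bar R).
  by apply/measurable_EFinP; exact: measurable_indic.
have i0 (x : R) : (0 <= (\1_A x)%:E :> \bar R)%E by rewrite lee_fin.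
have := @ge0_integral_affine R 1 b (fun x => (\1_A x)%:E) (oner_neq0 _) mA' i0.
have -> : (\int[mu]_x (\1_A x)%:E = 0 :> \bar R)%E.
  by rewrite integral_indic// setIT.
rewrite mule0 => iE.
have := integral_indic mu measurableT mB; rewrite setIT => <-; rewrite -[RHS]iE.
by apply: eq_integral => x _; rewrite mul1r !indicE.
Qed.

Lemma iter_diff_derive (b : R) (k : nat) (G g : R -> R) :
  (forall x, is_derive x (1 : R) G (g x)) ->
  forall x, is_derive x (1 : R) (iter k (forward_diff b) G) (iter k (forward_diff b) g x).
Proof.
by move=> d; elim: k => [|k IH] x //=; exact: is_derive_diff.
Qed.

Lemma iter_diff_derive_ae (b : R) (k : nat) (G g : R -> R) :
  {ae mu, forall x, is_derive x (1 : R) G (g x)} ->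
  {ae mu, forall x, is_derive x (1 : R) (iter k (forward_diff b) G) (iter k (forward_diff b) g x)}.
Proof.
move=> d; elim: k => [|k IH] //=; have := ae_shift b IH; move: IH.
apply: filterS2; first exact: (ae_filter_ringOfSetsType mu).
by move=> x d1 d2; exact: is_derive_diff.
Qed.

Lemma iter_diffZ (b c : R) (k : nat) (G : R -> R) :
  iter k (forward_diff b) (fun x => c * G x) = (fun x => c * iter k (forward_diff b) G x).
Proof.
by elim: k => //= k ->; apply/funext => x; rewrite /forward_diff; ring.
Qed.

Lemma iter_abs_continuous (b : R) (k : nat) (G : R -> R) :
  abs_continuous G -> abs_continuous (iter k (forward_diff b) G).
Proof. by move=> acG; elim: k => //= k IH; exact: abs_continuous_diff. Qed.

End primitive.

(** * Steklov means *)

Section steklov.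
Context {R : realType}.
Local Notation mu := (@lebesgue_measure R).

(** The mean of phi over [x, x + b], written as a difference quotient of a
    primitive so that it can be differentiated. *)
Definition steklov (b : R) (phi : R -> R) (x : R) : R :=
  b^-1 * forward_diff b (primitive phi) x.

Lemma measurable_affine (b x : R) :
  measurable_fun [set: measurableTypeR R] (fun u : measurableTypeR R => x + b * u : measurableTypeR R).
Proof. by apply: measurable_funD => //; exact: measurable_funM. Qed.

Lemma measurable_affine2 (b : R) :
  measurable_fun [set: (measurableTypeR R * measurableTypeR R)%type]
    (fun z : measurableTypeR R * measurableTypeR R => z.1 + b * z.2 : measurableTypeR R).
Proof.
apply: measurable_funD; first exact: measurable_fst.
by apply: measurable_funM => //; exact: measurable_snd.
Qed.

Lemma uniform_average : exists U : probability (measurableTypeR R) R,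
  forall g : R -> \bar R, measurable_fun [set: R] g -> (forall x, 0 <= g x)%E ->
    (\int[U]_u g u = \int[mu]_(u in `[0%R, 1%R]) g u)%E.
Proof.
exists (uniform_prob (@ltr01 R)) => g mg g0.
by rewrite integral_uniform// subr0 invr1 mul1e.
Qed.

Lemma steklov_average (b : R) (phi : R -> R) (x : R) : 0 < b ->
  mu.-integrable [set: R] (EFin \o phi) -> (forall x, 0 <= phi x) ->
  ((steklov b phi x)%:E = \int[mu]_(u in `[0%R, 1%R]) (phi (x + b * u))%:E)%E.
Proof.
move=> b0 iphi phi0.
have mphi : measurable_fun [set: R] phi by apply/measurable_EFinP; exact: measurable_int iphi.
have mI : measurable (`[0%R, 1%R]%classic : set (measurableTypeR R)) by exact: measurable_itv.
have mJ : measurable (`[x, (x + b)%R]%classic : set (measurableTypeR R)) by exact: measurable_itv.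
have xb : x <= x + b by rewrite lerDl ltW.
have iJ : mu.-integrable `[x, (x + b)%R] (EFin \o phi) by apply: (integrableS measurableT).
have iI : mu.-integrable (`]x, (x + b)%R] : set (measurableTypeR R)) (EFin \o phi).
  by apply: (integrableS measurableT) => //; exact: measurable_itv.
have fI : ((\int[mu]_(t in `]x, (x + b)%R]) (phi t)%:E)%E \is a fin_num).
  by apply: (integrable_fin_num _ iI); exact: measurable_itv.
rewrite /steklov /forward_diff primitiveB// /Rintegral EFinM fineK//.
rewrite (@integral_itv_obnd_cbnd _ x (BRight (x + b)))//; last first.
  by apply/measurable_EFinP; exact: (measurable_funS measurableT).
rewrite [in RHS]integral_mkcond [in LHS]integral_mkcond.
have mr : measurable_fun [set: R] ((fun t : R => (phi t)%:E) \_ `[x, (x + b)%R]).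
  by apply/(measurable_restrictT _ mJ); apply/measurable_EFinP; exact: (measurable_funS measurableT).
have := @ge0_integral_affine R b x ((fun t => (phi t)%:E) \_ `[x, (x + b)%R])
  (lt0r_neq0 b0) mr.
rewrite (gtr0_norm b0) => <-; last first.
  by move=> t; rewrite patchE; case: ifPn => // _; rewrite lee_fin.
apply: eq_integral => u _; rewrite !patchE addrC; congr (if _ then _ else _).
apply/idP/idP; rewrite !inE/= !in_itv/= => /andP[h1 h2].
- rewrite -(ler_pM2l b0) mulr0 -(lerD2r x) add0r (addrC _ x) h1 /=.
  by have := h2; rewrite lerD2l -{2}(mulr1 b) ler_pM2l.
- rewrite lerDl lerD2l mulr_ge0 ?(ltW b0)//=.
  by rewrite -{2}(mulr1 b) ler_pM2l.
Qed.

Lemma ge0_integral_shift (a : R) (g : R -> \bar R) : measurable_fun [set: R] g ->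
  (forall x, 0 <= g x)%E -> (\int[mu]_x g (x + a)%R = \int[mu]_x g x)%E.
Proof.
move=> mg g0; rewrite -[RHS]mul1e -[X in (X%:E * _)%E]invr1 -(@normr1 R).
rewrite -(@ge0_integral_affine R 1 a g (oner_neq0 _) mg g0).
by apply: eq_integral => x _; rewrite mul1r.
Qed.

Definition mass_function (phi : R -> R) :=
  (forall x, 0 <= phi x) /\ mu.-integrable [set: R] (EFin \o phi).

Lemma mass_measurable phi : mass_function phi -> measurable_fun [set: R] phi.
Proof. by move=> [_ iphi]; apply/measurable_EFinP; exact: measurable_int iphi. Qed.

Lemma measurable_comp_affine2 (g : R -> R) (b : R) : measurable_fun [set: R] g ->
  measurable_fun [set: (measurableTypeR R * measurableTypeR R)%type]
    (fun z : measurableTypeR R * measurableTypeR R => g (z.1 + b * z.2)).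
Proof. by move=> mg; exact: (measurableT_comp mg (measurable_affine2 b)). Qed.

Lemma measurable_comp_affine (g : R -> R) (b x : R) : measurable_fun [set: R] g ->
  measurable_fun [set: R] (fun u => (g (x + b * u))%:E).
Proof.
move=> mg; apply/measurable_EFinP.
exact: (measurableT_comp mg (measurable_affine b x)).
Qed.

Lemma integral_average (P : probability (measurableTypeR R) R) (b : R) (g : R -> R) :
  measurable_fun [set: R] g -> (forall x, 0 <= g x) ->
  (\int[mu]_x \int[P]_v (g (x + b * v)%R)%:E = \int[mu]_x (g x)%:E)%E.
Proof.
move=> mg g0.
have mF : measurable_fun [set: (measurableTypeR R * measurableTypeR R)%type]
    (fun z : measurableTypeR R * measurableTypeR R => (g (z.1 + b * z.2))%:E).
  by apply/measurable_EFinP; exact: measurable_comp_affine2.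
have F0 (z : measurableTypeR R * measurableTypeR R) : (0 <= (g (z.1 + b * z.2))%:E)%E.
  by rewrite lee_fin.
rewrite (@fubini_tonelli _ _ (measurableTypeR R) (measurableTypeR R) R mu P _ mF F0)/=.
under eq_integral => v _.
  rewrite (@ge0_integral_shift (b * v) (fun x => (g x)%:E)); [over| |].
  - exact/measurable_EFinP.
  - by move=> x; rewrite lee_fin.
have P1 : P [set: measurableTypeR R] = 1%E by exact: probability_setT.
rewrite (integral_cst P measurableT) [X in (_ * X)%E](_ : _ = 1%E) ?mule1//.
Qed.

Lemma steklov_uniform (U : probability (measurableTypeR R) R) :
  (forall g : R -> \bar R, measurable_fun [set: R] g -> (forall x, 0 <= g x)%E ->
    (\int[U]_u g u = \int[mu]_(u in `[0%R, 1%R]) g u)%E) ->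
  forall b phi x, 0 < b -> mass_function phi ->
  ((steklov b phi x)%:E = \int[U]_u (phi (x + b * u))%:E)%E.
Proof.
move=> UE b phi x b0 mphi; have [phi0 iphi] := mphi.
rewrite steklov_average// UE//; last by move=> u; rewrite lee_fin.
by apply: measurable_comp_affine; exact: mass_measurable.
Qed.

Lemma steklov_mass (b : R) phi : 0 < b -> mass_function phi -> mass_function (steklov b phi).
Proof.
move=> b0 mphi; have [U UE] := uniform_average; have [phi0 iphi] := mphi.
have St0 x : 0 <= steklov b phi x.
  rewrite -lee_fin (steklov_uniform UE)//; apply: integral_ge0 => u _.
  by rewrite lee_fin.
have mprim : measurable_fun [set: R] (primitive phi).
  exact: (continuous_measurable_fun (primitive_continuous iphi)).
have mSt : measurable_fun [set: R] (steklov b phi).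
  apply: measurable_funM => //; apply: measurable_funB => //.
  by apply: (measurableT_comp mprim); exact: measurable_funD.
split=> //; apply/integrableP; split; first exact/measurable_EFinP.
have -> : (\int[mu]_x `|(EFin \o steklov b phi) x| =
    \int[mu]_x \int[U]_u (phi (x + b * u)%R)%:E)%E.
  by apply: eq_integral => x _; rewrite -(steklov_uniform UE)//= ger0_norm.
rewrite integral_average//; last exact: mass_measurable.
have /integrableP[_] := iphi; apply: le_lt_trans.
by apply: le_integral_nomeas => x; [rewrite lee_fin|rewrite /= lee_fin ler_norm].
Qed.

Lemma iter_steklov_mass (b : R) k phi : 0 < b -> mass_function phi ->
  mass_function (iter k (steklov b) phi).
Proof. by move=> b0 m; elim: k => //= k IH; exact: steklov_mass. Qed.

Lemma image_law d (T : measurableType d) (Q : probability T R) (X : T -> R) :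
  measurable_fun [set: T] X -> exists P : probability (measurableTypeR R) R,
    (forall A, P A = Q (X @^-1` A)) /\
    forall g : R -> \bar R, measurable_fun [set: R] g -> (forall x, 0 <= g x)%E ->
      (\int[P]_v g v = \int[Q]_w g (X w))%E.
Proof.
move=> mX.
have mX' : @measurable_fun _ _ T (measurableTypeR R) [set: T] X by [].
exists (@distribution _ _ T (measurableTypeR R) R Q
  (@mfun_Sub _ _ T (measurableTypeR R) X (mem_set mX'))); split=> // g mg g0.
by rewrite (ge0_integral_pushforward mX').
Qed.

(** Iterating k averages over independent uniform variables averages over
    their sum. *)
Lemma steklov_law (k : nat) : exists P : probability (measurableTypeR R) R,
  P `[0, k%:R]%classic = 1%E /\
  forall b phi, 0 < b -> mass_function phi -> forall x,
    ((iter k (steklov b) phi x)%:E = \int[P]_v (phi (x + b * v))%:E)%E.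
Proof.
elim: k => [|k [P [P1 PE]]].
  exists (dirac (0 : measurableTypeR R)); split.
    transitivity ((\1_(`[0, 0]%classic : set (measurableTypeR R)) (0 : R))%:E : \bar R); first by [].
    by rewrite indicE mem_set//= in_itv/= lexx.
  move=> b phi b0 m x; rewrite integral_dirac//; last first.
    by apply: measurable_comp_affine; exact: mass_measurable.
  by rewrite diracT mul1e mulr0 addr0.
have [U UE] := uniform_average.
have madd : measurable_fun [set: (measurableTypeR R * measurableTypeR R)%type]
    (fun z : measurableTypeR R * measurableTypeR R => z.1 + z.2 : measurableTypeR R).
  by apply: measurable_funD; [exact: measurable_fst|exact: measurable_snd].
have [P' [P'A P'I]] := @image_law _ _ ((U \x P)%E : probability _ R) _ madd.
have P'E (g : R -> \bar R) : measurable_fun [set: R] g -> (forall x, 0 <= g x)%E ->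
    (\int[P']_v g v = \int[U]_u \int[P]_v g (u + v)%R)%E.
  move=> mg g0; rewrite P'I//.
  have mgX : measurable_fun [set: (measurableTypeR R * measurableTypeR R)%type]
      (fun z : measurableTypeR R * measurableTypeR R => g (z.1 + z.2)).
    exact: (measurableT_comp mg madd).
  exact: (@fubini_tonelli1 _ _ (measurableTypeR R) (measurableTypeR R) R U P _ mgX).
exists P'; split.
  have mk : measurable (`[0%R, k%:R]%classic : set (measurableTypeR R)) by exact: measurable_itv.
  have m1 : measurable (`[0%R, 1%R]%classic : set (measurableTypeR R)) by exact: measurable_itv.
  have mk1 : measurable (`[0%R, k.+1%:R]%classic : set (measurableTypeR R)) by exact: measurable_itv.
  apply/eqP; rewrite eq_le; apply/andP; split; first exact: (probability_le1 P' mk1).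
  have U1 : U `[0%R, 1%R]%classic = 1%E.
    have := UE (fun x => (\1_(`[0%R, 1%R]%classic : set (measurableTypeR R)) x)%:E).
    rewrite integral_indic// setIT => ->.
    - rewrite integral_indic// setIid.
      rewrite [LHS](_ : _ = lebesgue_measure `[0%R, 1%R]%classic)//.
      by rewrite lebesgue_measure_itv/= lte_fin ltr01 oppr0 adde0.
    - by apply/measurable_EFinP; exact: measurable_indic.
    - by move=> x; rewrite lee_fin.
  have := @product_measure1E _ _ (measurableTypeR R) (measurableTypeR R) R U P _ _ m1 mk.
  rewrite [X in (X * _)%E]U1 [X in (_ * X)%E]P1 mule1 P'A => <-; apply: le_measure; rewrite ?inE//.
  - exact: measurableX.
  - by rewrite -[X in measurable X]setTI; exact: madd.
  - move=> [u v] [/= ]; rewrite !in_itv/= => /andP[u0 u1] /andP[v0 v1].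
    by rewrite addr_ge0//= -natr1 addrC lerD.
move=> b phi b0 m x; rewrite P'E; last 2 first.
- by apply: measurable_comp_affine; exact: mass_measurable.
- by move=> v; rewrite lee_fin; have [] := m.
rewrite /= (steklov_uniform UE)//; last exact: iter_steklov_mass.
apply: eq_integral => u _; rewrite PE//; apply: eq_integral => v _.
by congr (phi _)%:E; ring.
Qed.

Lemma continuous_steklov (b : R) phi : mass_function phi -> continuous (steklov b phi).
Proof.
move=> [_ iphi] x; have cp := primitive_continuous iphi.
apply: cvgM; first exact: cvg_cst.
apply: cvgB; last exact: cp.
by apply: (@cvg_comp _ _ _ (fun y => y + b) (primitive phi)); [
  apply: cvgD; [exact: cvg_id|exact: cvg_cst]|exact: cp].
Qed.

Lemma is_derive_scale (c x l : R) (G : R -> R) : is_derive x (1 : R) G l ->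
  is_derive x (1 : R) (fun y => c * G y) (c * l).
Proof. by move=> dG; exact: (is_deriveZ c dG). Qed.

Lemma iter_diff_steklov_derive (b x : R) (c : R) (k : nat) psi : mass_function psi ->
  continuous psi ->
  is_derive x (1 : R) (fun y => c * iter k (forward_diff b) (steklov b psi) y)
    (c * b^-1 * iter k.+1 (forward_diff b) psi x).
Proof.
move=> [_ ipsi] cpsi; rewrite -mulrA; apply: is_derive_scale.
rewrite /steklov iter_diffZ -iterSr; apply: is_derive_scale.
by apply: iter_diff_derive => {}x; apply: primitive_derive => //; exact: cpsi.
Qed.

(** Each derivative turns one Steklov mean into a difference quotient, as
    long as the mean that is differentiated is continuous; one mean must
    therefore remain. *)
Lemma steklov_derive1n (b : R) (k m : nat) phi : 0 < b -> mass_function phi ->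
  derive1n k (iter (k + m).+1 (steklov b) phi) =
  (fun x => b^-1 ^+ k * iter k (forward_diff b) (iter m.+1 (steklov b) phi) x).
Proof.
move=> b0 mphi; elim: k m => [|k IH] m.
  by apply/funext => x; rewrite expr0 mul1r.
rewrite derive1nS addSnnS IH; apply/funext => x; rewrite derive1E.
have mpsi := iter_steklov_mass m.+1 b0 mphi.
have cpsi : continuous (iter m.+1 (steklov b) phi).
  by rewrite iterS; apply: continuous_steklov; exact: iter_steklov_mass.
have := iter_diff_steklov_derive b x (b^-1 ^+ k) k mpsi cpsi.
by move=> /(@derive_val _ _ _ _ _ _ _) ->; rewrite exprSr.
Qed.

(** The last derivative exists only almost everywhere, by Lebesgue's
    differentiation theorem for the primitive of phi. *)
Lemma steklov_sobolev (b : R) (r : nat) phi : 0 < b -> (0 < r)%N -> mass_function phi ->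
  sobolev_derivative r (iter r (steklov b) phi)
    (fun x => b^-1 ^+ r * iter r (forward_diff b) phi x).
Proof.
move=> b0; case: r => // r _ mphi; exists (iter r.+1 (steklov b) phi); split.
- by apply: nearW.
- move=> k x kr; have -> : r = (k + (r - k.+1).+1)%N by rewrite addnS -addSn subnKC.
  rewrite (steklov_derive1n k _ b0 mphi) iterS.
  have mpsi := iter_steklov_mass (r - k.+1).+1 b0 mphi.
  have cpsi : continuous (iter (r - k.+1).+1 (steklov b) phi).
    by rewrite iterS; apply: continuous_steklov; exact: iter_steklov_mass.
  by have [] := iter_diff_steklov_derive b x (b^-1 ^+ k) k mpsi cpsi.
- have := steklov_derive1n r 0 b0 mphi; rewrite addn0 => ->.
  apply: abs_continuousZ; apply: iter_abs_continuous.
  by apply: abs_continuousZ; apply: abs_continuous_diff; apply: primitive_abs_continuous; case: mphi.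
- have := steklov_derive1n r 0 b0 mphi; rewrite addn0 => ->.
  have [_ iphi] := mphi.
  have := iter_diff_derive_ae b r.+1 (primitive_derive_ae iphi).
  apply: filterS; first exact: (ae_filter_ringOfSetsType mu).
  move=> x dx; rewrite exprSr -mulrA; apply: is_derive_scale.
  by rewrite /steklov [X in is_derive _ _ X _]iter_diffZ -iterSr; apply: is_derive_scale.
Qed.

End steklov.

(** * Convolution in L^p *)

Section bias_tools.
Context {R : realType}.
Local Notation mu := (@lebesgue_measure R).

(** Only the coefficient of g x is needed explicitly; the vanishing beyond r
    makes the induction go through. *)
Lemma difference_coefficients (r : nat) : exists c : nat -> R,
  [/\ c 0%N = (-1) ^+ r, forall j, (r < j)%N -> c j = 0 &
    forall (g : R -> R) u x, iter r (forward_diff u) g x =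
      \sum_(j < r.+1) c j * g (x + u * j%:R)].
Proof.
elim: r => [|r [c [c0 cz cE]]].
  exists (fun j => (j == 0%N)%:R); split => //; first by case.
  by move=> g u x; rewrite big_ord_recl big_ord0 /= mul1r mulr0 !addr0.
exists (fun j => (if j is i.+1 then c i else 0) - c j); split.
- by rewrite c0 sub0r exprS mulN1r.
- by case=> // j rj; rewrite !cz ?subr0// ltnW.
move=> g u x; rewrite iterS {1}/forward_diff !cE.
under [RHS]eq_bigr do rewrite mulrBl.
rewrite big_split/= sumrN; congr (_ - _).
- rewrite [RHS]big_ord_recl/= mul0r add0r; apply: eq_bigr => j _.
  by congr (_ * g _); rewrite /bump/= add1n -natr1; ring.
- by rewrite [RHS]big_ord_recr/= cz// mul0r addr0.
Qed.

Lemma measurable_Rintegral d1 d2 (T1 : measurableType d1) (T2 : measurableType d2)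
  (m : {sigma_finite_measure set T2 -> \bar R}) (F : T1 * T2 -> R) :
  measurable_fun [set: T1 * T2] F ->
  measurable_fun [set: T1] (fun x => \int[m]_y F (x, y)).
Proof.
move=> mF; apply: measurableT_comp => //.
rewrite (_ : (fun x => _) = (fun x => (\int[m]_y (fun z => (F z)%:E)^\+ (x, y))
   - (\int[m]_y (fun z => (F z)%:E)^\- (x, y)))%E); last first.
  apply/funext => x; rewrite [LHS]integralE.
  by congr (_ - _)%E; apply: eq_integral => y _; rewrite ?funeposE ?funenegE.
apply: emeasurable_funB.
- have m1 : measurable_fun [set: T1 * T2] ((fun z => (F z)%:E)^\+)%E.
    by apply: measurable_funepos; apply/measurable_EFinP.
  exact: (@measurable_fun_fubini_tonelli_F _ _ T1 T2 R m _ m1 (funepos_ge0 _)).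
- have m1 : measurable_fun [set: T1 * T2] ((fun z => (F z)%:E)^\-)%E.
    by apply: measurable_funeneg; apply/measurable_EFinP.
  exact: (@measurable_fun_fubini_tonelli_F _ _ T1 T2 R m _ m1 (funeneg_ge0 _)).
Qed.

Lemma measurable_sg d (T : measurableType d) (g : T -> R) : measurable_fun [set: T] g ->
  measurable_fun [set: T] (fun x => Num.sg (g x)).
Proof.
move=> mg; rewrite (_ : (fun x => _) = fun x => (0 < g x)%R%:R - (g x < 0)%R%:R).
  by apply: measurable_funB; apply: measurable_indic_lt.
apply/funext => x; have [gx|gx|gx] := ltgtP (g x) 0.
- by rewrite ltr0_sg// sub0r.
- by rewrite gtr0_sg// subr0.
- by rewrite gx sgr0 subrr.
Qed.

Lemma measurable_reflect2 (k : R -> R) : measurable_fun [set: R] k ->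
  measurable_fun [set: (measurableTypeR R * measurableTypeR R)%type]
    (fun z : measurableTypeR R * measurableTypeR R => k (z.1 - z.2)).
Proof.
move=> mk; apply: (measurableT_comp mk).
by apply: measurable_funB; [exact: measurable_fst|exact: measurable_snd].
Qed.

Lemma measurable_convolution (g k : R -> R) : measurable_fun [set: R] g ->
  measurable_fun [set: R] k -> measurable_fun [set: R] (convolution g k).
Proof.
move=> mg mk.
apply: (@measurable_Rintegral _ _ (measurableTypeR R) (measurableTypeR R) mu
   (fun z => g z.2 * k (z.1 - z.2))).
apply: measurable_funM; last exact: measurable_reflect2.
by apply: (measurableT_comp mg); exact: measurable_snd.
Qed.

Lemma ge0_integral_reflect (a : R) (g : R -> \bar R) : measurable_fun [set: R] g ->
  (forall x, 0 <= g x)%E -> (\int[mu]_x g (a - x)%R = \int[mu]_x g x)%E.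
Proof.
move=> mg g0; have n1 : (-1 : R) != 0 by rewrite oppr_eq0 oner_neq0.
rewrite -[RHS]mul1e -[X in (X%:E * _)%E]invr1 -(@normr1 R) -normrN.
rewrite -(@ge0_integral_affine R (-1) a g n1 mg g0).
by apply: eq_integral => x _; rewrite mulN1r addrC.
Qed.

(** Young's inequality for convolutions, as Jensen's inequality with weight
    |k(x - y)|; the sign of k is moved into the function to be averaged. *)
Lemma convolution_Lp (p kap : R) (g k : R -> R) : 1 <= p -> 0 < kap ->
  measurable_fun [set: R] g -> measurable_fun [set: R] k ->
  (\int[mu]_x `|k x|%:E <= kap%:E)%E ->
  (\int[mu]_x (`|convolution g k x| `^ p)%:E <= (kap `^ p)%:E * \int[mu]_x (`|g x| `^ p)%:E)%E.
Proof.
move=> p1 kap0 mg mk kkap.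
have mak : measurable_fun [set: R] (fun x => `|k x|) by exact: measurableT_comp.
have mgp : measurable_fun [set: R] (fun x => `|g x| `^ p).
  by apply: (measurableT_comp (measurable_powR p)); exact: measurableT_comp.
have kE x : (\int[mu]_y `|k (x - y)%R|%:E = \int[mu]_x `|k x|%:E)%E.
  by apply: (@ge0_integral_reflect x (fun y => `|k y|%:E)) => //; exact/measurable_EFinP.
have kE2 y : (\int[mu]_x `|k (x - y)%R|%:E = \int[mu]_x `|k x|%:E)%E.
  apply: (@ge0_integral_shift _ (- y) (fun y => `|k y|%:E)) => //; exact/measurable_EFinP.
have mkx x : measurable_fun [set: R] (fun y => k (x - y)).
  by apply: (measurableT_comp mk); apply: measurable_funB.
have mak' x : measurable_fun [set: R] (fun y => `|k (x - y)|) by exact: measurableT_comp.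
have mphi x : measurable_fun [set: R] (fun y => g y * Num.sg (k (x - y))).
  by apply: measurable_funM => //; exact: measurable_sg.
have mF : measurable_fun [set: (measurableTypeR R * measurableTypeR R)%type]
    (fun z : measurableTypeR R * measurableTypeR R => (`|g z.2| `^ p * `|k (z.1 - z.2)|)%:E).
  apply/measurable_EFinP; apply: measurable_funM.
    by apply: (measurableT_comp mgp); exact: measurable_snd.
  exact: (measurable_reflect2 mak).
have F0 (z : measurableTypeR R * measurableTypeR R) :
    (0 <= (`|g z.2| `^ p * `|k (z.1 - z.2)|)%:E)%E.
  by rewrite lee_fin mulr_ge0// powR_ge0.
have step x : ((`|convolution g k x| `^ p)%:E <=
    (kap `^ (p - 1))%:E * \int[mu]_y (`|g y| `^ p * `|k (x - y)|)%:E)%E.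
  (* The convolution integrates g times the sign of k against the weight |k|. *)
  have := @integral_powR_le _ _ R mu p kap (fun y => `|k (x - y)|)
    (fun y => g y * Num.sg (k (x - y))) p1 kap0.
  have -> : (\int[mu]_y (g y * Num.sg (k (x - y)) * `|k (x - y)|))%R = convolution g k x.
    by congr (fine _); apply: eq_integral => y _; rewrite -mulrA -numEsg.
  move=> /(_ (mak' x) _ (mphi x)); rewrite kE => /(_ _ kkap) H.
  have k0 y : 0 <= `|k (x - y)| by exact: normr_ge0.
  apply: (le_trans (H k0)); apply: lee_wpmul2l; first by rewrite lee_fin powR_ge0.
  apply: le_integral_nomeas => y; first by rewrite lee_fin mulr_ge0// powR_ge0.
  rewrite lee_fin; apply: ler_wpM2r => //; apply: ge0_ler_powR; rewrite ?nnegrE//.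
  - by lra.
  - rewrite normrM ler_piMr// normr_sg; by case: (_ == _).
apply: le_trans.
  by apply: le_integral_nomeas; [move=> x; rewrite lee_fin powR_ge0|exact: step].
rewrite ge0_integralZl_EFin//; last 3 first.
- by move=> x _; apply: integral_ge0 => y _; exact: (F0 (x, y)).
- exact: (@measurable_fun_fubini_tonelli_F _ _ (measurableTypeR R) (measurableTypeR R) R mu _ mF F0).
- by rewrite powR_ge0.
rewrite (@fubini_tonelli _ _ (measurableTypeR R) (measurableTypeR R) R mu mu _ mF F0)/=.
have -> : (kap `^ p = kap `^ (p - 1) * kap)%R.
  by rewrite -[X in _ = _ * X](powRr1 (ltW kap0)) -powRD ?subrK// (gt_eqF kap0) implybT.
rewrite EFinM -muleA; apply: lee_wpmul2l; first by rewrite lee_fin powR_ge0.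
rewrite -ge0_integralZl_EFin//; last 2 first.
- exact/measurable_EFinP.
- exact: ltW.
apply: le_integral_nomeas => y.
  by apply: integral_ge0 => x _; exact: (F0 (x, y)).
under eq_integral do rewrite EFinM.
rewrite ge0_integralZl_EFin ?powR_ge0//; last first.
  apply/measurable_EFinP; apply: (measurableT_comp mak); exact: measurable_funB.
by rewrite kE2 muleC; apply: lee_wpmul2r; rewrite ?lee_fin ?powR_ge0.
Qed.

Lemma scaled_kernel_norm (K : R -> R) (h : R) : 0 < h -> measurable_fun [set: R] K ->
  (\int[mu]_x `|scaled_kernel K h x|%:E = \int[mu]_x `|K x|%:E)%E.
Proof.
move=> h0 mK; have mak : measurable_fun [set: R] (fun x => `|K x|) by exact: measurableT_comp.
have h0' : h^-1 != 0 by rewrite invr_neq0 ?gt_eqF.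
have maff : measurable_fun [set: R] (fun x : R => `|K (h^-1 * x + 0)|).
  by apply: (measurableT_comp mak); apply: measurable_funD => //; exact: measurable_funM.
have := @ge0_integral_affine R h^-1 0 (fun x => `|K x|%:E) h0'.
rewrite normfV invrK (gtr0_norm h0) => H.
have -> : (\int[mu]_x `|scaled_kernel K h x|%:E =
    (h^-1)%:E * \int[mu]_x `|K (h^-1 * x + 0)%R|%:E)%E.
  rewrite -ge0_integralZl_EFin// ?invr_ge0 ?(ltW h0)//; last exact/measurable_EFinP.
  apply: eq_integral => x _; rewrite -EFinM /scaled_kernel normrM addr0 mulrC.
  by rewrite (gtr0_norm (_ : 0 < h^-1)) ?invr_gt0// mulrC (mulrC x).
rewrite H//; last exact/measurable_EFinP.
by rewrite muleA -EFinM mulVf ?mul1e ?gt_eqF.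
Qed.

Lemma Rintegral_lincomb d (T : measurableType d) (m : {measure set T -> \bar R})
  (n : nat) (a : 'I_n -> R) (G : 'I_n -> T -> R) :
  (forall i, m.-integrable [set: T] (EFin \o G i)) ->
  m.-integrable [set: T] (EFin \o (fun y => \sum_(i < n) a i * G i y)) /\
  (\int[m]_y (\sum_(i < n) a i * G i y))%R = \sum_(i < n) a i * (\int[m]_y G i y)%R.
Proof.
move=> iG; elim: (index_enum _) => [|i s [IH1 IH2]].
  rewrite big_nil; split.
    rewrite (_ : _ \o _ = cst 0%E); first exact: integrable0.
    by apply/funext => y; rewrite /= big_nil.
  rewrite (_ : (fun y => _) = cst 0) ?/Rintegral ?integral0//.
  by apply/funext => y; rewrite big_nil.
have iZ : m.-integrable [set: T] (EFin \o (fun y => a i * G i y)).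
  rewrite (_ : _ \o _ = (fun y => (a i)%:E * (EFin \o G i) y)%E).
    exact: integrableZl.
  by apply/funext => y; rewrite /= EFinM.
rewrite big_cons; split.
  rewrite (_ : _ \o _ = (EFin \o (fun y => (a i * G i y)%R)) \+
     (EFin \o (fun y => \sum_(i <- s) a i * G i y)%R))%E.
    exact: integrableD.
  by apply/funext => y; rewrite /= big_cons.
under eq_Rintegral do rewrite big_cons.
by rewrite RintegralD// IH2 RintegralZl.
Qed.

End bias_tools.

Section bias.
Context {R : realType}.
Local Notation mu := (@lebesgue_measure R).
Variables (p : R) (K : R -> R).
Hypotheses (p1 : 1 <= p) (intK : mu.-integrable [set: R] (EFin \o K)).

Definition smoothing_error (k g : R -> R) (x : R) : R := g x - convolution g k x.

Lemma measurable_smoothing_error (k g : R -> R) : measurable_fun [set: R] g ->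
  measurable_fun [set: R] k -> measurable_fun [set: R] (smoothing_error k g).
Proof. by move=> mg mk; apply: measurable_funB => //; exact: measurable_convolution. Qed.

Lemma integrable_conv_term (W x : R) (k g : R -> R) : measurable_fun [set: R] k ->
  (forall z, `|k z| <= W) -> mu.-integrable [set: R] (EFin \o g) ->
  mu.-integrable [set: R] (EFin \o (fun y => g y * k (x - y))).
Proof.
move=> mk kW ig.
have mg : measurable_fun [set: R] g by apply/measurable_EFinP; exact: measurable_int ig.
have W0 : 0 <= W by exact: le_trans (kW 0).
have mkx : measurable_fun [set: R] (fun y => k (x - y)).
  by apply: (measurableT_comp mk); apply: measurable_funB.
apply: (@le_integrable _ _ _ mu _ measurableT _ (fun y => (W * g y)%:E)).
- by apply/measurable_EFinP; exact: measurable_funM.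
- move=> y _ /=; rewrite lee_fin normrM mulrC normrM (ger0_norm W0).
  by rewrite ler_wpM2r.
- under eq_fun do rewrite EFinM.
  exact: integrableZl.
Qed.

Lemma smoothing_error_sum (W : R) (k : R -> R) (n : nat) (a : 'I_n -> R) (G : 'I_n -> R -> R) :
  measurable_fun [set: R] k -> (forall z, `|k z| <= W) ->
  (forall i, mu.-integrable [set: R] (EFin \o G i)) ->
  forall x, smoothing_error k (fun y => \sum_(i < n) a i * G i y) x =
    \sum_(i < n) a i * smoothing_error k (G i) x.
Proof.
move=> mk kW iG x; rewrite /smoothing_error.
under [RHS]eq_bigr do rewrite mulrBr.
rewrite big_split/= sumrN; congr (_ - _).
have it i := integrable_conv_term x mk kW (iG i).
have [_ E] := Rintegral_lincomb a it.
rewrite -E /convolution; congr (fine _); apply: eq_integral => y _.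
by rewrite mulr_suml; congr EFin; apply: eq_bigr => i _; rewrite mulrA.
Qed.

Lemma smoothing_error_Lp (kap : R) (k g : R -> R) : 0 < kap ->
  measurable_fun [set: R] g -> measurable_fun [set: R] k ->
  (\int[mu]_x `|k x|%:E <= kap%:E)%E ->
  (\int[mu]_x (`|smoothing_error k g x| `^ p)%:E <=
    (2 `^ (p - 1) * (1 + kap `^ p))%:E * \int[mu]_x (`|g x| `^ p)%:E)%E.
Proof.
move=> kap0 mg mk kkap.
have mcp := measurable_convolution mg mk.
have mN (u : R -> R) : measurable_fun [set: R] u -> measurable_fun [set: R] (fun x => (`|u x| `^ p)%:E).
  move=> mu'; apply/measurable_EFinP; apply: (measurableT_comp (measurable_powR p)).
  exact: measurableT_comp.
have N0 (u : R -> R) x : (0 <= (`|u x| `^ p)%:E)%E by rewrite lee_fin powR_ge0.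
have step x : ((`|smoothing_error k g x| `^ p)%:E <=
    (2 `^ (p - 1))%:E * ((`|g x| `^ p)%:E + (`|convolution g k x| `^ p)%:E))%E.
  rewrite -EFinD -EFinM lee_fin.
  have := @sum_powR_le_card R 2 p (fun i => if i == 0 :> nat then g x else - convolution g k x) p1.
  by rewrite !big_ord_recl !big_ord0/= !addr0 normrN.
apply: le_trans.
  by apply: le_integral_nomeas; [exact: N0|exact: step].
rewrite ge0_integralZl_EFin ?powR_ge0//; last 2 first.
- by move=> x _; rewrite adde_ge0.
- by apply: emeasurable_funD; exact: mN.
rewrite ge0_integralD//; [|exact: mN|exact: mN].
rewrite EFinM -muleA; apply: lee_wpmul2l; first by rewrite lee_fin powR_ge0.
rewrite EFinD ge0_muleDl ?lee_fin ?powR_ge0// mul1e leeD2l//.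
exact: convolution_Lp.
Qed.

End bias.

(** * Bias for generalized Lipschitz densities *)

Section average.
Context {R : realType}.
Local Notation mu := (@lebesgue_measure R).

(** Jensen's inequality for the average over P, integrated over the line. *)
Lemma average_Lp (P : probability (measurableTypeR R) R) (p : R)
  (phi : measurableTypeR R * measurableTypeR R -> R) : 1 <= p ->
  measurable_fun [set: (measurableTypeR R * measurableTypeR R)%type] phi ->
  (\int[mu]_x (`|\int[P]_v phi (x, v)| `^ p)%:E <=
   \int[P]_v \int[mu]_x (`|phi (x, v)| `^ p)%:E)%E.
Proof.
move=> p1 mphi.
pose F (z : measurableTypeR R * measurableTypeR R) := (`|phi z| `^ p)%:E.
have mF : measurable_fun [set: (measurableTypeR R * measurableTypeR R)%type] F.
  apply/measurable_EFinP; apply: (measurableT_comp (measurable_powR p)).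
  exact: measurableT_comp.
have F0 z : (0 <= F z)%E by rewrite lee_fin powR_ge0.
have mx x : measurable_fun [set: measurableTypeR R] (fun v => phi (x, v)).
  exact: (measurableT_comp mphi (@measurable_pair1 _ _ _ (measurableTypeR R) (x : measurableTypeR R))).
have PT : P [set: measurableTypeR R] = 1%E by exact: probability_setT.
have step x : ((`|(\int[P]_v phi (x, v))%R| `^ p)%:E <= \int[P]_v F (x, v))%E.
  have := @integral_powR_le _ (measurableTypeR R) R P p 1 (cst 1) _ p1 ltr01 (measurable_cst _)
    (fun=> ler01) (mx x).
  have -> : (\int[P]_v (cst 1 v : R)%:E = 1%:E)%E.
    apply: (etrans (integral_cst P measurableT 1%:E)).
    by rewrite [X in (_ * X)%E](_ : _ = 1%E) ?mule1.
  rewrite lexx => /(_ isT); rewrite powR1 mul1e.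
  rewrite (_ : (\int[P]_v (_ * cst 1 v))%R = (\int[P]_v phi (x, v))%R); last first.
    by apply: eq_Rintegral => v _; rewrite mulr1.
  by under eq_integral do rewrite /= mulr1.
apply: le_trans.
  by apply: le_integral_nomeas; [move=> x; rewrite lee_fin powR_ge0|exact: step].
by rewrite (@fubini_tonelli _ _ (measurableTypeR R) (measurableTypeR R) R mu P _ mF F0).
Qed.

Lemma inLpP (p : R) (g : R -> R) : 0 < p ->
  inLp p g <-> measurable_fun [set: R] g /\ (\int[mu]_x (`|g x| `^ p)%:E < +oo)%E.
Proof.
move=> p0.
have E : (\int[mu]_x (`|g x| `^ p)%:E = 'N[mu]_(p%:E)[EFin \o g] `^ p)%E.
  by rewrite powR_Lnorm ?lt0r_neq0//; apply: eq_integral => x _; rewrite /= poweR_EFin.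
rewrite /inLp /finite_norm E; split=> -[mg fg]; split=> //.
  by rewrite poweR_lty.
by apply: lty_poweRy fg; rewrite lt0r_neq0.
Qed.

End average.

Section lipschitz_bias.
Context {R : realType}.
Local Notation mu := (@lebesgue_measure R).
Variables (p s : R) (r : nat) (f : R -> R).
Hypotheses (p1 : 1 <= p) (s0 : 0 < s) (r0 : (0 < r)%N) (mass_f : mass_function f).

Definition difference_bound (M : R) := forall u : R, 0 < u ->
  (\int[mu]_x (`|iter r (forward_diff u) f x| `^ p)%:E <= (M * u `^ (p * s))%:E)%E.

(** For s in [r - 1, r) the modulus of smoothness that defines the Lipschitz
    space is the one of order exactly r. *)
Lemma lipschitz_difference : r%:R - 1 <= s < r%:R -> gen_lipschitz s p f ->
  exists2 M, 0 <= M & difference_bound M.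
Proof.
move=> rs [_]; have p0 : 0 < p by have := p1; lra.
have s0' := s0; have r0' := r0.
have trE : (Num.truncn s).+1 = r.
  rewrite -(prednK r0'); congr S; apply/eqP; rewrite truncn_eq ?(ltW s0')//.
  rewrite prednK// -subn1 natrB//.
rewrite trE.
set A := (X in ereal_sup X) => supA.
have [S S0 SE] : exists2 S : R, 0 <= S & forall t, 0 < t ->
    ((t `^ (- s))%:E * modulus_smoothness r p f t <= S%:E)%E.
  have ub t : 0 < t -> ((t `^ (- s))%:E * modulus_smoothness r p f t <= ereal_sup A)%E.
    by move=> t0; apply: ereal_sup_ubound; exists t.
  exists (Num.max 0 (fine (ereal_sup A))); first by rewrite le_max lexx.
  move=> t t0; apply: (le_trans (ub t t0)).
  move: supA; case: (ereal_sup A) => [x _|//|_]; last exact: leNye.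
  by rewrite lee_fin le_max lexx orbT.
exists (S `^ p); first exact: powR_ge0.
move=> u u0.
have Nu : ('N[mu]_(p%:E)[EFin \o iter r (forward_diff u) f] <= (S * u `^ s)%:E)%E.
  have := SE u u0; have us0 : 0 < u `^ s by exact: powR_gt0.
  rewrite powRN => h.
  have : (modulus_smoothness r p f u <= (S * u `^ s)%:E)%E.
    rewrite mulrC EFinM -lee_pdivrMl// .
  apply: le_trans; apply: ereal_sup_ubound; exists u => //=.
  by rewrite u0 lexx.
have -> : (\int[mu]_x (`|iter r (forward_diff u) f x| `^ p)%:E =
    'N[mu]_(p%:E)[EFin \o iter r (forward_diff u) f] `^ p)%E.
  by rewrite powR_Lnorm ?lt0r_neq0//; apply: eq_integral => x _; rewrite /= poweR_EFin.
have -> : ((S `^ p * u `^ (p * s))%:E = (S * u `^ s)%:E `^ p)%E.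
  by rewrite poweR_EFin powRM ?powR_ge0// -powRrM (mulrC s).
apply: gt0_ler_poweR => //; first exact: ltW.
- by rewrite in_itv/= Lnorm_ge0 leey.
- by rewrite in_itv/= lee_fin mulr_ge0 ?powR_ge0// leey.
Qed.

Lemma measurable_iter_diff2 (h : R) : measurable_fun [set: R] f ->
  measurable_fun [set: (measurableTypeR R * measurableTypeR R)%type]
    (fun z : measurableTypeR R * measurableTypeR R => iter r (forward_diff (h * z.2)) f z.1).
Proof.
move=> mf; have [c [_ _ cE]] := @difference_coefficients R r.
under eq_fun do rewrite cE.
apply: measurable_sum => j; apply: measurable_funM => //.
have := measurable_comp_affine2 (h * j%:R) mf.
by apply: eq_measurable_fun => z _; rewrite mulrAC.
Qed.

Lemma measurable_iter_diff (u : R) : measurable_fun [set: R] f ->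
  measurable_fun [set: R] (iter r (forward_diff u) f).
Proof.
move=> mf; elim: r => //= n IH; apply: measurable_funB => //.
by apply: (measurableT_comp IH); exact: measurable_funD.
Qed.

Variables (P : probability (measurableTypeR R) R).
Hypotheses (P1 : P `[0, r%:R]%classic = 1%E)
  (PE : forall b phi, 0 < b -> mass_function phi -> forall x,
    ((iter r (steklov b) phi x)%:E = \int[P]_v (phi (x + b * v))%:E)%E).

Definition averaged_difference (h x : R) : R :=
  \int[P]_v iter r (forward_diff (h * v)) f x.

(** Expand the difference under the integral: its j-th term averages f(x + j
    h v), which is an iterated Steklov mean of step jh. *)
Lemma averaged_differenceE (c : nat -> R) (h x : R) : 0 < h ->
  (forall (g : R -> R) u y, iter r (forward_diff u) g y = \sum_(j < r.+1) c j * g (y + u * j%:R)) ->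
  averaged_difference h x = c 0%N * f x + \sum_(j < r) c j.+1 * iter r (steklov (h * j.+1%:R)) f x.
Proof.
move=> h0 cE; have mf := mass_measurable mass_f.
pose G (j : nat) (v : R) := f (x + h * v * j%:R).
have mG j : measurable_fun [set: measurableTypeR R] (fun v => (G j v)%:E).
  have := measurable_comp_affine (h * j%:R) x mf.
  by apply: eq_measurable_fun => v _; rewrite /G mulrAC.
have GE j : (\int[P]_v (G j.+1 v)%:E = (iter r (steklov (h * j.+1%:R)) f x)%:E)%E.
  rewrite PE ?mulr_gt0//; apply: eq_integral => v _.
  by rewrite /G mulrAC.
have G0E : (\int[P]_v (G 0%N v)%:E = (f x)%:E)%E.
  rewrite (eq_integral (cst (f x)%:E)); last by move=> v _; rewrite /G mulr0 addr0.
  have PT : P [set: measurableTypeR R] = 1%E by exact: probability_setT.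
  by rewrite (integral_cst P measurableT) [X in (_ * X)%E](_ : _ = 1%E) ?mule1.
have iG (j : 'I_r.+1) : P.-integrable [set: measurableTypeR R] (EFin \o G j).
  apply/integrableP; split; first exact: mG.
  have -> : (\int[P]_v `|(EFin \o G j) v| = \int[P]_v (G j v)%:E)%E.
    by apply: eq_integral => v _; rewrite /= ger0_norm//; exact: (proj1 mass_f).
  by case: (nat_of_ord j) => [|i]; rewrite ?G0E ?GE ltry.
have [_ E] := Rintegral_lincomb (fun j : 'I_r.+1 => c j) iG.
rewrite /averaged_difference.
under eq_Rintegral do rewrite cE.
rewrite E big_ord_recl /=; congr (_ * _ + _).
- by rewrite /Rintegral G0E.
- by apply: eq_bigr => j _; rewrite /Rintegral GE.
Qed.

(** P is carried by [0, r], where the r-th difference with step hv is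
    controlled; at v = 0 it vanishes. *)
Lemma averaged_difference_Lp (M h : R) : 0 <= M -> difference_bound M -> 0 < h ->
  (\int[mu]_x (`|averaged_difference h x| `^ p)%:E <= (M * (h * r%:R) `^ (p * s))%:E)%E.
Proof.
move=> M0 HM h0; have mf := mass_measurable mass_f.
have p1' := p1; have s0' := s0; have r0' := r0.
have mF := measurable_iter_diff2 h mf.
apply: (le_trans (average_Lp P p1' mF)).
have mFp : measurable_fun [set: (measurableTypeR R * measurableTypeR R)%type]
    (fun z : measurableTypeR R * measurableTypeR R =>
      (`|iter r (forward_diff (h * z.2)) f z.1| `^ p)%:E).
  apply/measurable_EFinP; apply: (measurableT_comp (measurable_powR p)).
  exact: measurableT_comp.
have F0 (z : measurableTypeR R * measurableTypeR R) :
    (0 <= (`|iter r (forward_diff (h * z.2)) f z.1| `^ p)%:E)%E.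
  by rewrite lee_fin powR_ge0.
have PT : P [set: measurableTypeR R] = 1%E by exact: probability_setT.
set B := (_ * _ `^ _)%R.
have -> : B%:E = (\int[P]_v (cst B%:E v))%E.
  by rewrite (integral_cst P measurableT) [X in (_ * X)%E](_ : _ = 1%E) ?mule1.
have mr : measurable (`[0, r%:R]%classic : set (measurableTypeR R)) by exact: measurable_itv.
apply: ae_ge0_le_integral => //.
- by move=> v _; apply: integral_ge0 => x _; rewrite lee_fin powR_ge0.
- exact: (@measurable_fun_fubini_tonelli_G _ _ (measurableTypeR R) (measurableTypeR R) R mu _ mFp F0).
- by move=> v _; rewrite lee_fin /B mulr_ge0// powR_ge0.
exists (~` `[0, r%:R]%classic); split; first exact: measurableC.
  by apply: (etrans (probability_setC P mr)); rewrite [X in (1 - X)%E]P1 subee.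
apply: subsetC => v /=; rewrite in_itv/= => /andP[v0 vr] _.
move: v0; rewrite le_eqVlt => /orP[/eqP <-|v0].
  rewrite (eq_integral (cst 0%E)) ?integral0 ?lee_fin ?/B ?mulr_ge0 ?powR_ge0// => x _.
  rewrite /= mulr0 -(prednK r0') iterS {1}/forward_diff addr0 subrr normr0 powR0//.
  by rewrite gt_eqF//; lra.
apply: (le_trans (HM _ (mulr_gt0 h0 v0))).
rewrite lee_fin ler_wpM2l// ge0_ler_powR ?nnegrE//.
- by rewrite mulr_ge0; lra.
- by rewrite mulr_ge0// ltW.
- by rewrite mulr_ge0// ltW.
- by rewrite ler_pM2l.
Qed.

Lemma iter_steklov_Lp (b : R) : 0 < b ->
  (\int[mu]_x (`|iter r (steklov b) f x| `^ p)%:E <= \int[mu]_x (`|f x| `^ p)%:E)%E.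
Proof.
move=> b0; have mf := mass_measurable mass_f.
have p1' := p1.
have E x : iter r (steklov b) f x = (\int[P]_v f (x + b * v))%R.
  by rewrite /Rintegral -PE.
under eq_integral do rewrite E.
apply: (le_trans (average_Lp P p1' (measurable_comp_affine2 b mf))) => /=.
have mfp : measurable_fun [set: R] (fun x => (`|f x| `^ p)%:E).
  apply/measurable_EFinP; apply: (measurableT_comp (measurable_powR p)).
  exact: measurableT_comp.
under eq_integral => v _.
  rewrite (@ge0_integral_shift R (b * v) (fun x => (`|f x| `^ p)%:E) mfp); last first.
    by move=> x; rewrite lee_fin powR_ge0.
  over.
have PT : P [set: measurableTypeR R] = 1%E by exact: probability_setT.
rewrite le_eqVlt; apply/orP; left; apply/eqP; apply: (etrans (integral_cst P measurableT _)).
by rewrite [X in (_ * X)%E](_ : _ = 1%E) ?mule1.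
Qed.

(** The r-th derivative of the mean has L^p norm at most M^(1/p) (jh)^(s-r);
    the factor h^r of the approximation property brings this down to order
    h^s because j is at least 1. *)
Lemma iter_steklov_error (C1 : R) (K : R -> R) (M h : R) (j : nat) : inLp p f -> 0 <= M ->
  difference_bound M ->
  (forall (h : R) (g gr : R -> R), 0 < h ->
    inLp p g -> inLp p gr -> sobolev_derivative r g gr ->
    (\int[mu]_x (`|g x - convolution g (scaled_kernel K h) x| `^ p)%:E
     <= (C1 * h `^ (p * r%:R))%:E * 'N[mu]_(p%:E)[EFin \o gr] `^ p)%E) ->
  0 < h -> (0 < j <= r)%N ->
  (\int[mu]_x (`|smoothing_error (scaled_kernel K h) (iter r (steklov (h * j%:R)) f) x| `^ p)%:E
    <= (`|C1| * M * (h * r%:R) `^ (p * s))%:E)%E.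
Proof.
move=> Lf M0 HM hK h0 /andP[j0 jr].
have p1' := p1; have s0' := s0; have p0 : 0 < p by lra.
have mf := mass_measurable mass_f.
set b := h * j%:R; have b0 : 0 < b by rewrite mulr_gt0// ltr0n.
have mSt := iter_steklov_mass r b0 mass_f.
have Lg : inLp p (iter r (steklov b) f).
  apply/(inLpP _ p0); split; first exact: mass_measurable.
  by apply: le_lt_trans (iter_steklov_Lp b0) _; have /(inLpP _ p0)[] := Lf.
pose gr x := b^-1 ^+ r * iter r (forward_diff b) f x.
have mgr : measurable_fun [set: R] gr.
  by apply: measurable_funM => //; exact: measurable_iter_diff.
have grE : (\int[mu]_x (`|gr x| `^ p)%:E <= ((b^-1 ^+ r) `^ p * (M * b `^ (p * s)))%:E)%E.
  have br0 : 0 <= b^-1 ^+ r by rewrite exprn_ge0// invr_ge0 ltW.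
  have -> : (\int[mu]_x (`|gr x| `^ p)%:E =
      \int[mu]_x (((b^-1 ^+ r) `^ p)%:E * (`|iter r (forward_diff b) f x| `^ p)%:E))%E.
    by apply: eq_integral => x _; rewrite -EFinM /gr normrM powRM// (ger0_norm br0).
  rewrite ge0_integralZl_EFin ?powR_ge0//; last first.
    apply/measurable_EFinP; apply: (measurableT_comp (measurable_powR p)).
    by apply: measurableT_comp => //; exact: measurable_iter_diff.
  by rewrite EFinM; apply: lee_wpmul2l; rewrite ?lee_fin ?powR_ge0//; exact: HM.
have Lgr : inLp p gr.
  by apply/(inLpP _ p0); split => //; apply: (le_lt_trans grE); rewrite ltry.
apply: (le_trans (hK h _ _ h0 Lg Lgr (steklov_sobolev b0 r0 mass_f))).
have -> : ('N[mu]_(p%:E)[EFin \o (fun x => (b^-1 ^+ r * iter r (forward_diff b) f x)%R)] `^ p =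
    \int[mu]_x (`|gr x| `^ p)%:E)%E.
  by rewrite powR_Lnorm ?lt0r_neq0//; apply: eq_integral => x _; rewrite /= poweR_EFin.
have I0 : (0 <= \int[mu]_x (`|gr x| `^ p)%:E)%E.
  by apply: integral_ge0 => x _; rewrite lee_fin powR_ge0.
apply: (@le_trans _ _ ((`|C1| * h `^ (p * r%:R))%:E * \int[mu]_x (`|gr x| `^ p)%:E)%E).
  by apply: lee_wpmul2r => //; rewrite lee_fin ler_wpM2r ?powR_ge0// ler_norm.
apply: le_trans.
  by apply: lee_wpmul2l grE; rewrite lee_fin mulr_ge0// powR_ge0.
rewrite -EFinM lee_fin.
have -> : `|C1| * h `^ (p * r%:R) * ((b^-1 ^+ r) `^ p * (M * b `^ (p * s))) =
   `|C1| * M * (b `^ (p * s) * (h `^ (p * r%:R) * (b^-1 ^+ r) `^ p)) by ring.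
apply: ler_wpM2l; first by rewrite mulr_ge0.
rewrite -[leRHS]mulr1; apply: ler_pM; rewrite ?powR_ge0// ?mulr_ge0 ?powR_ge0//.
  apply: ge0_ler_powR; rewrite ?nnegrE.
  - by rewrite mulr_ge0 ?ltW.
  - exact: ltW.
  - by rewrite mulr_ge0// ltW.
  - by rewrite ler_pM2l// ler_nat.
rewrite -powR_mulrn ?invr_ge0 ?(ltW b0)// -powRrM (mulrC r%:R) -powRM ?invr_ge0 ?(ltW h0) ?(ltW b0)//.
apply: (@le_trans _ _ (1 `^ (p * r%:R))); last by rewrite powR1.
apply: ge0_ler_powR; rewrite ?nnegrE//.
- by rewrite mulr_ge0// ltW.
- by rewrite mulr_ge0 ?invr_ge0 ?ltW.
- by rewrite ler_pdivrMr// mul1r /b ler_peMr ?(ltW h0)// ler1n.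
Qed.

End lipschitz_bias.

Section bias_bound.
Context {R : realType}.
Local Notation mu := (@lebesgue_measure R).

(** The density is a combination of its averaged r-th difference, which is
    small, and of iterated Steklov means, which are smooth. The smoothing
    error is linear. *)
Lemma lipschitz_bias (p s W : R) (r : nat) (f K : R -> R) : 1 <= p -> 0 < s -> (0 < r)%N ->
  mass_function f -> mu.-integrable [set: R] (EFin \o K) -> (forall z, `|K z| <= W) ->
  r%:R - 1 <= s < r%:R -> gen_lipschitz s p f -> approximation_order K p r ->
  exists2 B, 0 <= B & forall h, 0 < h ->
    (\int[mu]_x (`|smoothing_error (scaled_kernel K h) f x| `^ p)%:E <= (B * h `^ (p * s))%:E)%E.
Proof.
move=> p1 s0 r0 mass_f intK KW rs Lf [C1 hK].
have mf := mass_measurable mass_f.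
have mK : measurable_fun [set: R] K by apply/measurable_EFinP; exact: measurable_int intK.
have [M M0 HM] := lipschitz_difference p1 s0 r0 rs Lf.
have [P [P1 PE]] := @steklov_law R r.
have [c [c0 cz cE]] := @difference_coefficients R r.
pose kap := fine (\int[mu]_x `|K x|%:E) + 1.
have iK0 : (0 <= \int[mu]_x `|K x|%:E)%E by apply: integral_ge0 => x _; rewrite lee_fin.
have iKf : ((\int[mu]_x `|K x|%:E)%E \is a fin_num).
  by rewrite ge0_fin_numE//; have /integrableP[] := intK.
have kap0 : 0 < kap by rewrite ltr_wpDl// fine_ge0.
have Kkap : (\int[mu]_x `|K x|%:E <= kap%:E)%E.
  by rewrite -(fineK iKf) lee_fin lerDl.
pose sg : R := (-1) ^+ r.
have sg2 : sg * sg = 1 by rewrite -expr2 sqrr_sign.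
(* f is sg times the averaged difference minus the means with coefficients sg
   c_j; index 0 stands for the averaged difference. *)
pose a (i : nat) := if i is j.+1 then - (sg * c j.+1) else sg.
pose G h (i : nat) := if i is j.+1 then iter r (steklov (h * j.+1%:R)) f
  else averaged_difference r f P h.
have DE h x : 0 < h -> averaged_difference r f P h x =
    \sum_(j < r.+1) c j * (if nat_of_ord j is j'.+1 then iter r (steklov (h * j'.+1%:R)) f x else f x).
  move=> h0; rewrite (averaged_differenceE mass_f PE x h0 cE) big_ord_recl/=.
  by congr (_ + _); apply: eq_bigr.
have iF h j : 0 < h -> mu.-integrable [set: R] (EFin \o iter r (steklov (h * j.+1%:R)) f).
  by move=> h0; have [] := iter_steklov_mass r (mulr_gt0 h0 (ltr0Sn R j)) mass_f.
have iG h (i : 'I_r.+1) : 0 < h -> mu.-integrable [set: R] (EFin \o G h i).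
  move=> h0; rewrite /G; case: (nat_of_ord i) => [|j]; last exact: iF.
  have -> : averaged_difference r f P h = (fun x => \sum_(j < r.+1) c j *
      (if nat_of_ord j is j'.+1 then iter r (steklov (h * j'.+1%:R)) f else f) x).
    apply/funext => x; rewrite DE//; apply: eq_bigr => j _.
    by case: (nat_of_ord j).
  apply: (proj1 (Rintegral_lincomb _ _)) => j.
  by case: (nat_of_ord j) => [|j']; [have [] := mass_f|exact: iF].
have fE h : 0 < h -> f = (fun x => \sum_(i < r.+1) a i * G h i x).
  move=> h0; apply/funext => x; rewrite big_ord_recl/= (averaged_differenceE mass_f PE x h0 cE).
  rewrite c0 -/sg mulrDr mulrA sg2 mul1r mulr_sumr -addrA -big_split/=.
  by rewrite big1 ?addr0// => j _; rewrite mulNr mulrA subrr.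
pose A := 2 `^ (p - 1) * (1 + kap `^ p) + `|C1|.
have A0 : 0 <= A by rewrite addr_ge0// mulr_ge0 ?powR_ge0// addr_ge0// powR_ge0.
exists (r.+1%:R `^ (p - 1) * ((\sum_(i < r.+1) `|a i| `^ p) * (A * M * r%:R `^ (p * s)))).
  by rewrite !mulr_ge0 ?powR_ge0// sumr_ge0// => i _; exact: powR_ge0.
move=> h h0.
set k := scaled_kernel K h.
have mk : measurable_fun [set: R] k.
  by apply: measurable_funM => //; apply: (measurableT_comp mK); exact: measurable_funM.
have kW z : `|k z| <= h^-1 * W.
  by rewrite normrM gtr0_norm ?invr_gt0// ler_wpM2l// invr_ge0 ltW.
have kkap : (\int[mu]_x `|k x|%:E <= kap%:E)%E by rewrite scaled_kernel_norm.
have mG (i : 'I_r.+1) : measurable_fun [set: R] (G h i).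
  by apply/measurable_EFinP; exact: measurable_int (iG h i h0).
have GE (i : 'I_r.+1) : (\int[mu]_x (`|smoothing_error k (G h i) x| `^ p)%:E <=
    (A * M * (h * r%:R) `^ (p * s))%:E)%E.
  have := mG i; have := ltn_ord i; rewrite /G; case: (nat_of_ord i) => [_|j jr] mGi.
    apply: (le_trans (smoothing_error_Lp p1 kap0 mGi mk kkap)).
    apply: le_trans.
      apply: lee_wpmul2l (averaged_difference_Lp p1 s0 r0 mass_f P1 M0 HM h0).
      by rewrite lee_fin mulr_ge0 ?powR_ge0// addr_ge0// powR_ge0.
    rewrite -EFinM lee_fin mulrA ler_wpM2r ?powR_ge0// ler_wpM2r//.
    by rewrite lerDl.
  have jr' : (0 < j.+1 <= r)%N by [].
  have H := iter_steklov_error p1 s0 r0 mass_f PE (proj1 Lf) M0 HM hK h0 jr'.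
  apply: (le_trans H).
  rewrite lee_fin ler_wpM2r ?powR_ge0// ler_wpM2r// lerDr.
  by rewrite mulr_ge0 ?powR_ge0// addr_ge0// powR_ge0.
have mGE (i : 'I_r.+1) : measurable_fun [set: R] (fun x => (`|smoothing_error k (G h i) x| `^ p)%:E).
  apply/measurable_EFinP; apply: (measurableT_comp (measurable_powR p)).
  by apply: measurableT_comp => //; exact: measurable_smoothing_error.
have step x : ((`|smoothing_error k f x| `^ p)%:E <= (r.+1%:R `^ (p - 1))%:E *
    \sum_(i < r.+1) ((`|a i| `^ p)%:E * (`|smoothing_error k (G h i) x| `^ p)%:E))%E.
  rewrite {1}(fE h h0) (smoothing_error_sum (fun i : 'I_r.+1 => a i) mk kW (fun i => iG h i h0)).
  have -> : (\sum_(i < r.+1) ((`|a i| `^ p)%:E * (`|smoothing_error k (G h i) x| `^ p)%:E) =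
      (\sum_(i < r.+1) `|a i * smoothing_error k (G h i) x| `^ p)%:E)%E.
    by rewrite -sumEFin; apply: eq_bigr => i _; rewrite -EFinM normrM powRM.
  by rewrite -EFinM lee_fin; exact: sum_powR_le_card.
apply: le_trans.
  by apply: le_integral_nomeas; [move=> x; rewrite lee_fin powR_ge0|exact: step].
have t0 x (i : 'I_r.+1) : (0 <= (`|a i| `^ p)%:E * (`|smoothing_error k (G h i) x| `^ p)%:E)%E.
  by rewrite -EFinM lee_fin mulr_ge0 ?powR_ge0.
have mt (i : 'I_r.+1) : measurable_fun [set: R] (fun x => (`|a i| `^ p)%:E *
    (`|smoothing_error k (G h i) x| `^ p)%:E)%E.
  by apply: emeasurable_funM.
rewrite ge0_integralZl_EFin ?powR_ge0//; last 2 first.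
- by move=> x _; apply: sume_ge0 => i _; exact: t0.
- exact: emeasurable_sum.
rewrite -[X in (_ <= X%:E)%E]mulrA [leRHS]EFinM; apply: lee_wpmul2l; first by rewrite lee_fin powR_ge0.
rewrite ge0_integral_sum//.
have -> : ((\sum_(i < r.+1) `|a i| `^ p) * (A * M * r%:R `^ (p * s)) * h `^ (p * s))%:E =
    (\sum_(i < r.+1) ((`|a i| `^ p)%:E * (A * M * (h * r%:R) `^ (p * s))%:E))%E.
  rewrite [RHS](eq_bigr (fun i : 'I_r.+1 => (`|a i| `^ p * (A * M * (h * r%:R) `^ (p * s)))%:E)); last first.
    by move=> i _; rewrite EFinM.
  by rewrite sumEFin -mulr_suml powRM ?(ltW h0)//; congr EFin; ring.
apply: lee_sum => i _.
rewrite ge0_integralZl_EFin ?powR_ge0//; last exact: mGE.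
by apply: lee_wpmul2l => //; rewrite lee_fin powR_ge0.
Qed.

Lemma sobolev_bias (p : R) (r : nat) (f K : R -> R) : 1 <= p ->
  sobolev r p f -> approximation_order K p r ->
  exists2 B, 0 <= B & forall h, 0 < h ->
    (\int[mu]_x (`|smoothing_error (scaled_kernel K h) f x| `^ p)%:E <=
      (B * h `^ (p * r%:R))%:E)%E.
Proof.
move=> p1 [Lf [gs Lg Dg]] [C1 hK]; have p0 : 0 < p by lra.
have fN : ('N[mu]_(p%:E)[EFin \o gs] \is a fin_num)%E.
  by rewrite ge0_fin_numE ?Lnorm_ge0//; case: Lg.
exists (`|C1| * fine ('N[mu]_(p%:E)[EFin \o gs]) `^ p).
  by rewrite mulr_ge0// powR_ge0.
move=> h h0; apply: (le_trans (hK h f gs h0 Lf Lg Dg)).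
rewrite -(fineK fN) poweR_EFin -EFinM lee_fin fineK//.
rewrite mulrAC ler_wpM2r ?powR_ge0// ler_wpM2r ?powR_ge0//.
exact: ler_norm.
Qed.

End bias_bound.

(** * From bias and deviation to the risk *)

Section density.
Context {R : realType} {d : measure_display} {T : measurableType d}.
Context {Pr : probability T R}.
Local Notation mu := (@lebesgue_measure R).
Variables (X : {RV Pr >-> R}) (f : R -> R).
Hypotheses (mf : measurable_fun [set: R] f) (f_ge0 : forall x, 0 <= f x)
  (hf : has_density (distribution Pr X) f).

Lemma density_mass_one : (\int[mu]_x (f x)%:E = 1)%E.
Proof.
rewrite -(hf measurableT); exact: (@probability_setT _ _ _ (distribution Pr X)).
Qed.

Lemma density_mass : mass_function f.
Proof.
have f0 := f_ge0; split => //; apply/integrableP; split; first exact/measurable_EFinP.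
have -> : (\int[mu]_x `|(EFin \o f) x| = \int[mu]_x (f x)%:E)%E.
  by apply: eq_integral => x _; rewrite /= ger0_norm.
by rewrite density_mass_one ltry.
Qed.

(** Both sides have the same layer cake decomposition. *)
Lemma ge0_density_expectation (g : R -> R) : measurable_fun [set: R] g ->
  (forall x, 0 <= g x) -> (\int[Pr]_w (g (X w))%:E = \int[mu]_x (g x * f x)%:E)%E.
Proof.
move=> mg g0; have f0 := f_ge0; have mX : measurable_fun [set: T] X by [].
have mgX : measurable_fun [set: T] (g \o X) by exact: measurableT_comp.
have := layer_cake Pr (measurable_cst (1 : R)) (fun=> ler01) mgX (fun w => g0 (X w)).
under eq_integral do rewrite mul1r.
move=> ->; under [RHS]eq_integral do rewrite mulrC.
rewrite (layer_cake mu mf f0 mg g0); apply: eq_integral => t _.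
pose A : set R := [set x | 0 <= t < g x].
have mA : measurable A.
  have := measurable_indic_le_lt (measurable_cst t) mg.
  move=> /(_ measurableT [set 1]); rewrite setTI => mm.
  have -> : A = (fun x : R => (0 <= t < g x)%R%:R : R) @^-1` [set 1].
    apply/seteqP; split => x /=; rewrite /A/=; first by move=> ->.
    by case: (_ && _) => //= /eqP; rewrite eq_sym oner_eq0.
  exact: mm.
have := hf mA; rewrite /distribution /pushforward => PA.
transitivity (Pr (X @^-1` A)).
  rewrite -[X @^-1` A]setIT -integral_indic//; last by rewrite -[_ @^-1` _]setTI; exact: mX.
  apply: eq_integral => w _; rewrite mul1r indicE; congr ((nat_of_bool _)%:R)%:E.
  by apply/idP/idP => h; [rewrite inE|move: h; rewrite inE].
rewrite PA integral_mkcond; apply: eq_integral => x _.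
rewrite patchE; case: ifPn => [|].
  by rewrite inE /A/= => ->; rewrite mulr1.
by rewrite notin_setE /A/= => /negP/negbTE ->; rewrite mulr0.
Qed.

(** Since f is nonnegative, the positive and negative parts of g * f are
    those of g, times f. *)
Lemma density_expectation (g : R -> R) : measurable_fun [set: R] g ->
  (\int[Pr]_w g (X w) = \int[mu]_x (g x * f x))%R.
Proof.
move=> mg; have f0 := f_ge0; rewrite /Rintegral; congr fine.
rewrite [LHS]integralE [RHS]integralE.
have mp : measurable_fun [set: R] (g^\+)%R by exact: measurable_funrpos.
have mn : measurable_fun [set: R] (g^\-)%R by exact: measurable_funrneg.
have := ge0_density_expectation mp (funrpos_ge0 g).
have := ge0_density_expectation mn (funrneg_ge0 g) => nE pE.
congr (_ - _)%E.
  rewrite (_ : (\int[Pr]_x _ = \int[Pr]_w ((g^\+)%R (X w))%:E)%E); last first.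
    by apply: eq_integral => w _; rewrite funeposE /funrpos EFin_max.
  rewrite pE; apply: eq_integral => x _.
  by rewrite funeposE /funrpos -EFin_max maxr_pMl// mul0r.
rewrite (_ : (\int[Pr]_x _ = \int[Pr]_w ((g^\-)%R (X w))%:E)%E); last first.
  by apply: eq_integral => w _; rewrite funenegE /funrneg EFin_max.
rewrite nE; apply: eq_integral => x _.
by rewrite funenegE /funrneg -EFin_max maxr_pMl// mul0r mulNr.
Qed.

End density.

Section estimator.
Context {R : realType} {d : measure_display} {T : measurableType d}.
Context {Pr : probability T R}.
Local Notation mu := (@lebesgue_measure R).
Variables (Y : int -> {RV Pr >-> R}) (f K : R -> R) (p : R).
Hypotheses (mf : measurable_fun [set: R] f) (f_ge0 : forall x, 0 <= f x)
  (hf : has_density (distribution Pr (Y 0)) f) (bK : bmeas K) (p1 : 1 <= p).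

Definition estimate (n : nat) (h : R) (w : T) (x : R) : R :=
  (n%:R * h)^-1 * \sum_(1 <= k < n.+1) K (h^-1 * (x - Y k%:Z w)).

(** The convolution of f with the rescaled kernel is the mean of the
    estimator. *)
Lemma estimate_decomposition (n : nat) (h : R) (w : T) (x : R) : (0 < n)%N -> 0 < h ->
  estimate n h w x - f x =
  (n%:R * h)^-1 * deviation Y K h n w x - smoothing_error (scaled_kernel K h) f x.
Proof.
move=> n0 h0; have n0' : n%:R != 0 :> R by rewrite pnatr_eq0 -lt0n.
have h0' : h != 0 by rewrite gt_eqF.
have cE : convolution f (scaled_kernel K h) x = h^-1 * \int[Pr]_w kernel_at K h x (Y 0 w).
  have mk : measurable_fun [set: R] (kernel_at K h x) by have [] := bmeas_kernel_at h x bK.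
  rewrite (density_expectation mf f_ge0 hf mk) -RintegralZl//; last first.
    have [mK [W KW]] := bK.
    pose k z := K (h^-1 * z).
    have mk' : measurable_fun [set: R] k.
      by apply: (measurableT_comp mK); exact: measurable_funM.
    have := integrable_conv_term x mk' (fun z => KW _) (proj2 (density_mass mf f_ge0 hf)).
    by apply: eq_integrable => // y _; rewrite /= /kernel_at mulrC.
  apply: eq_Rintegral => y _; rewrite /scaled_kernel /kernel_at [in RHS](mulrC _ (x - y)).
  by ring.
rewrite /estimate /deviation sumrB big_const_nat subn1/= iter_addr_0 mulrBr.
rewrite /smoothing_error cE; set E := (\int[Pr]_w _)%R.
rewrite -(mulr_natr E) [X in _ * X - f x](_ : _ = \sum_(1 <= k < n.+1) kernel_at K h x (Y k%:Z w))//.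
by field; rewrite n0' h0'.
Qed.

Lemma estimate_risk (n : nat) (h V B : R) : (0 < n)%N -> 0 < h ->
  (\int[Pr]_w \int[mu]_x (`|deviation Y K h n w x| `^ p)%:E <= V%:E)%E ->
  (\int[mu]_x (`|smoothing_error (scaled_kernel K h) f x| `^ p)%:E <= B%:E)%E ->
  (\int[Pr]_w \int[mu]_x (`|estimate n h w x - f x| `^ p)%:E <=
    (2 `^ (p - 1) * (((n%:R * h)^-1) `^ p * V + B))%:E)%E.
Proof.
move=> n0 h0 hV hB; have p1' := p1.
set a := (n%:R * h)^-1; have a0 : 0 <= a by rewrite invr_ge0 mulr_ge0 ?(ltW h0).
set k := scaled_kernel K h.
have mK : measurable_fun [set: R] K by have [] := bK.
have mk : measurable_fun [set: R] k.
  by apply: measurable_funM => //; apply: (measurableT_comp mK); exact: measurable_funM.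
have mdev := measurable_deviation Y h n bK.
have mD : measurable_fun [set: (T * measurableTypeR R)%type]
    (fun z : T * measurableTypeR R => (`|deviation Y K h n z.1 z.2| `^ p)%:E).
  apply/measurable_EFinP; apply: (measurableT_comp (measurable_powR p)).
  exact: measurableT_comp.
have D0 (z : T * measurableTypeR R) : (0 <= (`|deviation Y K h n z.1 z.2| `^ p)%:E)%E.
  by rewrite lee_fin powR_ge0.
have mI := @measurable_fun_fubini_tonelli_F _ _ T (measurableTypeR R) R mu _ mD D0.
have mDw w : measurable_fun [set: R] (fun x => (`|deviation Y K h n w x| `^ p)%:E).
  exact: (measurableT_comp mD (@measurable_pair1 _ _ T (measurableTypeR R) w)).
have mE : measurable_fun [set: R] (fun x => (`|smoothing_error k f x| `^ p)%:E).
  apply/measurable_EFinP; apply: (measurableT_comp (measurable_powR p)).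
  by apply: measurableT_comp => //; exact: measurable_smoothing_error.
have stepx w x : ((`|estimate n h w x - f x| `^ p)%:E <= (2 `^ (p - 1))%:E *
    ((a `^ p)%:E * (`|deviation Y K h n w x| `^ p)%:E +
     (`|smoothing_error k f x| `^ p)%:E))%E.
  rewrite -[((a `^ p)%:E * _)%E]EFinM -EFinD -EFinM lee_fin estimate_decomposition//.
  have := @sum_powR_le_card R 2 p (fun i => if i == 0 :> nat then a * deviation Y K h n w x
    else - smoothing_error k f x) p1'.
  rewrite !big_ord_recl !big_ord0/= !addr0 normrN => /le_trans; apply.
  by rewrite normrM (ger0_norm a0) powRM.
have maD w : measurable_fun [set: R] (fun x => (a `^ p)%:E * (`|deviation Y K h n w x| `^ p)%:E)%E.
  by apply: emeasurable_funM; [exact: measurable_cst|exact: mDw].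
have stepw w : (\int[mu]_x (`|estimate n h w x - f x| `^ p)%:E <= (2 `^ (p - 1))%:E *
    ((a `^ p)%:E * \int[mu]_x (`|deviation Y K h n w x| `^ p)%:E + B%:E))%E.
  apply: le_trans.
    by apply: le_integral_nomeas; [move=> x; rewrite lee_fin powR_ge0|exact: stepx].
  rewrite ge0_integralZl_EFin ?powR_ge0//; last 2 first.
  - by move=> x _; rewrite adde_ge0// -EFinM lee_fin mulr_ge0 ?powR_ge0.
  - exact: emeasurable_funD (maD w) mE.
  apply: lee_wpmul2l; first by rewrite lee_fin powR_ge0.
  rewrite ge0_integralD//; last 2 first.
  - by move=> x _; rewrite -EFinM lee_fin mulr_ge0 ?powR_ge0.
  - exact: maD.
  by rewrite ge0_integralZl_EFin ?powR_ge0//; [rewrite leeD2l|exact: mDw].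
have B0 : (0 <= B%:E)%E.
  by apply: le_trans hB; apply: integral_ge0 => x _; rewrite lee_fin powR_ge0.
have I0 w : (0 <= \int[mu]_x (`|deviation Y K h n w x| `^ p)%:E)%E.
  by apply: integral_ge0 => x _; rewrite lee_fin powR_ge0.
apply: le_trans.
  apply: le_integral_nomeas; last exact: stepw.
  by move=> w; apply: integral_ge0 => x _; rewrite lee_fin powR_ge0.
have aI0 w : (0 <= (a `^ p)%:E * \int[mu]_x (`|deviation Y K h n w x| `^ p)%:E)%E.
  by rewrite mule_ge0// lee_fin powR_ge0.
have maI : measurable_fun [set: T] (fun w =>
    (a `^ p)%:E * \int[mu]_x (`|deviation Y K h n w x| `^ p)%:E)%E.
  by apply: emeasurable_funM => //; exact: mI.
rewrite ge0_integralZl_EFin ?powR_ge0//; last 2 first.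
- by move=> w _; rewrite adde_ge0.
- by apply: emeasurable_funD.
rewrite EFinM; apply: lee_wpmul2l; first by rewrite lee_fin powR_ge0.
rewrite ge0_integralD// ge0_integralZl_EFin ?powR_ge0//.
rewrite (integral_cst Pr measurableT) [X in (_ + _ * X)%E](_ : _ = 1%E); last exact: probability_setT.
rewrite mule1 EFinD EFinM leeD2r//; apply: lee_wpmul2l => //.
by rewrite lee_fin powR_ge0.
Qed.

End estimator.

Section rate.
Context {R : realType} {d : measure_display} {T : measurableType d}.
Context {Pr : probability T R}.
Local Notation mu := (@lebesgue_measure R).
Variables (Y : int -> {RV Pr >-> R}) (f K : R -> R) (p : R).
Hypotheses (hp : 1 <= p < 2) (hY : strictly_stationary Y)
  (mf : measurable_fun [set: R] f) (f_ge0 : forall x, 0 <= f x)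
  (hf : has_density (distribution Pr (Y 0)) f).
Variable kappa : nat -> R.-pker (g_sigma_algebraType (past Y 0)) ~> R.
Hypotheses (hkappa : forall k : nat, cond_distribution (Y k%:Z) (kappa k))
  (intK : mu.-integrable [set: R] (EFin \o K)) (bvK : bounded_variation_line K).
Variables (q eps : R).
Hypotheses (hq : 1 < q) (heps : 0 < eps)
  (hmoment : ('E_Pr[(fun w => `|Y 0 w| `^ (q * (2 - p) / p + eps))%R] < +oo)%E).
Variables (s C : R).
Hypotheses (s0 : 0 < s) (hC : 0 < C).

(** The left-hand side is (N^delta D / (N h))^(p/2), and delta - 1 + (1 -
    delta) / (2 s + 1) equals - 2 s (1 - delta) / (2 s + 1). *)
Lemma rate_arithmetic (N delta D : R) : 0 < N -> 0 < D ->
  let h := C * N `^ (- ((1 - delta) / (2 * s + 1))) in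
  ((N * h)^-1) `^ p * (N * h * (N `^ delta * D)) `^ (p / 2) =
  (D / C) `^ (p / 2) * N `^ (- (p * s * (1 - delta)) / (2 * s + 1)).
Proof.
move=> N0 D0 h; have s0' := s0; have hC' := hC.
have h0 : 0 < h by rewrite mulr_gt0// powR_gt0.
have S0 : 0 < N `^ delta * D by rewrite mulr_gt0// powR_gt0.
have x0 : 0 < N * h by rewrite mulr_gt0.
have xi0 : 0 < (N * h)^-1 by rewrite invr_gt0.
have pE : p = p / 2 + p / 2 by field.
rewrite {1}pE powRD; last by rewrite (gt_eqF xi0) implybT.
have xS0 : 0 <= N * h * (N `^ delta * D) by rewrite mulr_ge0// ltW.
rewrite -mulrA -(powRM _ (ltW xi0) xS0) mulKf ?gt_eqF// -(powRM _ (ltW xi0) (ltW S0)).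
have -> : (N * h)^-1 * (N `^ delta * D) =
    D / C * N `^ (delta - 1 + (1 - delta) / (2 * s + 1)).
  rewrite !powRD ?(gt_eqF N0) ?implybT// powR_inv1 ?(ltW N0)// /h powRN.
  have t0 : N `^ ((1 - delta) / (2 * s + 1)) != 0 by rewrite gt_eqF// powR_gt0.
  field; rewrite t0 !gt_eqF//.
rewrite powRM ?powR_ge0 ?divr_ge0 ?(ltW D0) ?(ltW hC')// -powRrM.
congr (_ * _ `^ _).
by field; lra.
Qed.

Lemma risk_rate (delta B : R) : 0 <= delta < 1 -> 0 <= B ->
  (forall h, 0 < h -> (\int[mu]_x (`|smoothing_error (scaled_kernel K h) f x| `^ p)%:E <=
     (B * h `^ (p * s))%:E)%E) ->
  is_bigO
      (fun n => (\sum_(0 <= k < n.+1)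
         ((k.+1%:R `^ (1 / (q - 1)))%:E * dep_beta1 (kappa k)))%E)
      (fun n => n%:R `^ (delta * q / (q - 1))) ->
  is_bigO (Lp_risk Pr p f (kernel_estimator K (bandwidth C delta s) Y))
      (fun n => n%:R `^ (- (p * s * (1 - delta)) / (2 * s + 1))).
Proof.
move=> hd B0 hB [M hM].
have hp' := hp; have hq' := hq; have heps' := heps; have s0' := s0; have hC' := hC.
have p1 : 1 <= p by case/andP: hp'.
have [M' KM] := bvK.
have [W KW] := sum_cell_bound intK KM.
have [Kb Kbd] := bounded_variation_bounded KM.
have mK : measurable_fun [set: R] K by apply/measurable_EFinP; exact: measurable_int intK.
have bK : bmeas K by split=> //; exists Kb.
set I := fine (\int[Pr]_w ((1 + `|Y 0 w| + C) `^ (q * (2 - p) / p + eps))%:E).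
have I0 : 0 <= I.
  by apply: fine_ge0; apply: integral_ge0 => w _; rewrite lee_fin powR_ge0.
pose D := `|M| + I / q + 1.
have q0 : 0 < q by lra.
have Iq0 : 0 <= I / q by rewrite divr_ge0// ltW.
have D0 : 0 < D by rewrite ltr_wpDl// addr_ge0.
set cst := Lp_constant W p (weight_exponent p q eps).
exists (2 `^ (p - 1) * (cst * (D / C) `^ (p / 2) + B * C `^ (p * s))).
near=> n.
have n0 : (0 < n)%N by near: n; exists 1%N.
have hMn : ((\sum_(0 <= k < n.+1) ((k.+1%:R `^ (1 / (q - 1)))%:E * dep_beta1 (kappa k)))%E
   <= (M * n%:R `^ (delta * q / (q - 1)))%:E)%E by near: n.
have N0 : 0 < (n%:R : R) by rewrite ltr0n.
have N1 : 1 <= (n%:R : R) by rewrite ler1n.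
set h := bandwidth C delta s n.
have h0 : 0 < h by rewrite mulr_gt0// powR_gt0.
have hC1 : h <= C.
  rewrite /h /bandwidth -[leRHS]mulr1 ler_pM2l//.
  apply: (@le_trans _ _ (n%:R `^ 0)); last by rewrite powRr0.
  by apply: ler_powR => //; rewrite oppr_le0 divr_ge0//; lra.
have gm := gap_moment hp hq heps hmoment n0 h0 hC1 hMn.
have gmD : (\int[Pr]_w (gap_sum kappa n w * (1 + `|Y 0 w| + h) `^ weight_exponent p q eps)%:E <=
    (n%:R `^ delta * D)%:E)%E.
  apply: (le_trans gm); rewrite lee_fin ler_pM2l ?powR_gt0// /D.
  by have := ler_norm M; rewrite -/I; lra.
have S0 : 0 < n%:R `^ delta * D by rewrite mulr_gt0// powR_gt0.
have dev := Lp_deviation hY hkappa intK KM KW hp (weight_exponent_ge0 hp hq heps)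
  (weight_exponent_gt hp hq heps) h0 S0 n0 gmD.
have := estimate_risk mf f_ge0 hf bK p1 n0 h0 dev (hB h h0).
move=> /le_trans; apply; rewrite lee_fin -[leRHS]mulrA ler_wpM2l ?powR_ge0//.
rewrite mulrDl; apply: lerD.
  by rewrite mulrCA (rate_arithmetic _ N0 D0) mulrA lexx.
rewrite -[leRHS]mulrA ler_wpM2l// /h /bandwidth powRM ?powR_ge0 ?(ltW hC')//.
rewrite ler_wpM2l ?powR_ge0// -powRrM.
rewrite (_ : _ * (p * s) = - (p * s * (1 - delta)) / (2 * s + 1))//.
by field; lra.
Unshelve. all: by end_near. Qed.

End rate.

(** * Total variation *)

Section charges.
Context {R : realType}.
Local Notation mu := (@lebesgue_measure R).

Lemma variation_norm_ge0 (nu : {charge set R -> \bar R}) : (0 <= variation_norm nu)%E.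
Proof. by rewrite /variation_norm; exact: measure_ge0. Qed.

(** Add up the integrals of g over the two sets of a Hahn decomposition. *)
Lemma variation_norm_density (nu : {charge set R -> \bar R}) (g : R -> R) :
  mu.-integrable [set: R] (EFin \o g) -> has_density nu g ->
  (variation_norm nu <= \int[mu]_x `|g x|%:E)%E.
Proof.
move=> ig nug; rewrite /variation_norm.
move: (cid _) => [P Pex] /=; move: (cid _) => [N PN] /=.
have [[mP _] [mN _] PNT PN0] := PN.
have mg : measurable_fun [set: R] g by apply/measurable_EFinP; exact: measurable_int ig.
rewrite /charge_variation/= jordan_posE jordan_negE cjordan_posE cjordan_negE.
rewrite /crestr0 !mem_set//= /crestr !setTI !nug//.
have mg' : measurable_fun [set: measurableTypeR R] (fun x : measurableTypeR R => `|g x|%:E).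
  by apply/measurable_EFinP; exact: measurableT_comp.
have PNT' : (P `|` N)%classic = [set: measurableTypeR R] by exact: PNT.
rewrite -[in leRHS]PNT'.
have mP' : measurable (P : set (measurableTypeR R)) by exact: mP.
have mN' : measurable (N : set (measurableTypeR R)) by exact: mN.
rewrite (@ge0_integral_setU _ (measurableTypeR R) R mu _ _ mP' mN'); last 3 first.
- by rewrite PNT'.
- by move=> x _; rewrite lee_fin.
- by apply/disj_set2P.
apply: leeD.
- apply: (le_trans (lee_abs _)).
  apply: (le_trans (le_abse_integral _ _ _)) => //.
  by apply/measurable_EFinP; exact: (measurable_funS measurableT).
- apply: (le_trans (lee_abs _)); rewrite abseN.
  apply: (le_trans (le_abse_integral _ _ _)) => //.
  by apply/measurable_EFinP; exact: (measurable_funS measurableT).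
Qed.

Lemma density_charge (g : R -> R) : mu.-integrable [set: R] (EFin \o g) ->
  exists nu : {charge set R -> \bar R}, has_density nu g.
Proof.
move=> ig; pose nu0 := induced_charge ig.
pose nu (A : set R) : \bar R := (\int[mu]_(x in A) (g x)%:E)%E.
have h0 : nu set0 = 0%E by rewrite /nu integral_set0.
have hf (A : set R) : measurable A -> nu A \is a fin_num.
  move=> mA; have mA' : measurable (A : set (measurableTypeR R)) by exact: mA.
  by apply: (integrable_fin_num mA'); exact: (integrableS measurableT).
have hs : @semi_sigma_additive _ R _ nu.
  exact: (@charge_semi_sigma_additive _ (measurableTypeR R) R nu0).
pose c : {charge set R -> \bar R} := HB.pack nu (isCharge.Build _ R R nu h0 hf hs).
by exists c.
Qed.

Lemma density_probability (g : R -> R) : measurable_fun [set: R] g -> (forall x, 0 <= g x) ->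
  (\int[mu]_x (g x)%:E = 1)%E ->
  exists P : probability R R, has_density P g.
Proof.
move=> mg g0 g1.
pose nu (A : set R) : \bar R := (\int[mu]_(x in A) (g x)%:E)%E.
have h0 : nu set0 = 0%E by rewrite /nu integral_set0.
have hp (A : set R) : (0 <= nu A)%E by apply: integral_ge0 => x _; rewrite lee_fin.
have hs : @semi_sigma_additive _ R _ nu.
  apply: (@semi_sigma_additive_nng_induced _ (measurableTypeR R) R mu (fun x => (g x)%:E)).
    exact/measurable_EFinP.
  by move=> x; rewrite lee_fin.
pose m : {measure set R -> \bar R} := HB.pack nu (isMeasure.Build _ R R nu h0 hp hs).
pose P : probability R R := HB.pack nu (isMeasure.Build _ R R nu h0 hp hs)
  (Measure_isProbability.Build _ R R m g1).
by exists P.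
Qed.

Lemma has_densityB (nu : {charge set R -> \bar R}) (Q : probability R R) (g f : R -> R) :
  mu.-integrable [set: R] (EFin \o g) -> mu.-integrable [set: R] (EFin \o f) ->
  has_density nu g -> has_density Q f ->
  has_density (cadd nu (copp (charge_of_finite_measure Q))) (fun x => g x - f x).
Proof.
move=> ig jf nug Qf A mA; rewrite /cadd/= /copp/= nug// /charge_of_finite_measure Qf//.
have mA' : measurable (A : set (measurableTypeR R)) by exact: mA.
rewrite -(integralB mA')//; last 2 first.
- exact: (integrableS measurableT).
- exact: (integrableS measurableT).
Qed.

End charges.

Section estimator_measures.
Context {R : realType} {d : measure_display} {T : measurableType d}.
Context {Pr : probability T R}.
Local Notation mu := (@lebesgue_measure R).

Lemma integrable_affine (K : R -> R) (c b : R) : c != 0 -> mu.-integrable [set: R] (EFin \o K) ->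
  mu.-integrable [set: R] (EFin \o (fun x => K (c * x + b))) /\
  (\int[mu]_x K (c * x + b) = `|c|^-1 * \int[mu]_x K x)%R.
Proof.
move=> c0 iK.
have mK : measurable_fun [set: R] K by apply/measurable_EFinP; exact: measurable_int iK.
have mKc : measurable_fun [set: R] (fun x => K (c * x + b)).
  apply: (measurableT_comp mK); apply: measurable_funD => //; exact: measurable_funM.
have mA : measurable_fun [set: R] (fun x => `|K x|%:E).
  by apply/measurable_EFinP; exact: measurableT_comp.
have mp : measurable_fun [set: R] (fun x => (EFin \o K)^\+ x)%E.
  by apply: measurable_funepos; exact/measurable_EFinP.
have mn : measurable_fun [set: R] (fun x => (EFin \o K)^\- x)%E.
  by apply: measurable_funeneg; exact/measurable_EFinP.
have pE := ge0_integral_affine b c0 mp (funepos_ge0 _).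
have nE := ge0_integral_affine b c0 mn (funeneg_ge0 _).
have fp : ((\int[mu]_x (EFin \o K)^\+ x)%E \is a fin_num).
  by apply: (integrable_fin_num measurableT); exact: integrable_funepos.
have fn : ((\int[mu]_x (EFin \o K)^\- x)%E \is a fin_num).
  by apply: (integrable_fin_num measurableT); exact: integrable_funeneg.
split.
  apply/integrableP; split; first exact/measurable_EFinP.
  have -> : (\int[mu]_x `|(EFin \o (fun x => K (c * x + b)%R)) x| =
      (`|c|^-1)%:E * \int[mu]_x `|K x|%:E)%E.
    by rewrite -(ge0_integral_affine b c0 mA).
  have /integrableP[_ lt] := iK; rewrite lte_mul_pinfty//.
rewrite /Rintegral [in LHS]integralE [in RHS]integralE.
have -> : (\int[mu]_x (fun x => (K (c * x + b))%:E)^\+ x =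
    (`|c|^-1)%:E * \int[mu]_x (EFin \o K)^\+ x)%E.
  by rewrite -pE; apply: eq_integral => x _; rewrite !funeposE.
have -> : (\int[mu]_x (fun x => (K (c * x + b))%:E)^\- x =
    (`|c|^-1)%:E * \int[mu]_x (EFin \o K)^\- x)%E.
  by rewrite -nE; apply: eq_integral => x _; rewrite !funenegE.
transitivity (`|c|^-1 * fine (\int[mu]_x (EFin \o K)^\+ x - \int[mu]_x (EFin \o K)^\- x)%E); last by [].
by rewrite -(fineK fp) -(fineK fn) /= mulrBr.
Qed.

Variables (Y : int -> {RV Pr >-> R}) (f K : R -> R).
Hypotheses (intK : mu.-integrable [set: R] (EFin \o K)).

Lemma measurable_estimate (n : nat) (h : R) :
  measurable_fun [set: (T * measurableTypeR R)%type]
    (fun z : T * measurableTypeR R => estimate Y K n h z.1 z.2).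
Proof.
have mK : measurable_fun [set: R] K by apply/measurable_EFinP; exact: measurable_int intK.
apply: measurable_funM => //; apply: measurable_sum => k.
apply: (measurableT_comp mK); apply: measurable_funM => //.
apply: measurable_funB; first exact: measurable_snd.
by apply: measurableT_comp => //; exact: measurable_fst.
Qed.

Lemma estimate_integrable (n : nat) (h : R) w : ((0 < n)%N -> 0 < h) ->
  mu.-integrable [set: R] (EFin \o estimate Y K n h w).
Proof.
case: n => [_|n /(_ isT) h0].
  rewrite (_ : _ \o _ = cst 0%E); first exact: integrable0.
  by apply/funext => x; rewrite /= /estimate big_geq// mulr0.
rewrite (_ : estimate Y K n.+1 h w = fun x => \sum_(k < n.+1) (n.+1%:R * h)^-1 *
    K (h^-1 * x + (- (h^-1 * Y k.+1%:Z w)))).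
  apply: (proj1 (Rintegral_lincomb _ _)) => k.
  by apply: (proj1 (integrable_affine _ _ intK)); rewrite invr_neq0// gt_eqF.
apply/funext => x; rewrite /estimate big_add1/= big_mkord mulr_sumr.
by apply: eq_bigr => k _; rewrite mulrBr.
Qed.

Lemma estimate_integral (n : nat) (h : R) w : (0 < n)%N -> 0 < h ->
  (\int[mu]_x estimate Y K n h w x = \int[mu]_x K x)%R.
Proof.
case: n => // n _ h0; have hi : h^-1 != 0 by rewrite invr_neq0// gt_eqF.
have aff (k : 'I_n.+1) := integrable_affine (- (h^-1 * Y k.+1%:Z w)) hi intK.
have [_ E] := Rintegral_lincomb (fun=> (n.+1%:R * h)^-1) (fun k => proj1 (aff k)).
transitivity (\int[mu]_x (\sum_(k < n.+1) (n.+1%:R * h)^-1 *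
    K (h^-1 * x + (- (h^-1 * Y k.+1%:Z w)))))%R.
  apply: eq_Rintegral => x _; rewrite /estimate big_add1/= big_mkord mulr_sumr.
  by apply: eq_bigr => k _; rewrite mulrBr.
rewrite E; under eq_bigr do rewrite (proj2 (aff _)).
rewrite sumr_const card_ord normfV invrK (gtr0_norm h0) -mulr_natr.
have n0 : n.+1%:R != 0 :> R by rewrite pnatr_eq0.
by field; rewrite gt_eqF//= n0.
Qed.

Lemma measurable_density_event (n : nat) (h : R) (g : R -> R) (A : set R) :
  measurable A -> measurable_fun [set: R] g ->
  measurable_fun [set: T] (fun w => (\int[mu]_(x in A) g (estimate Y K n h w x))%R).
Proof.
move=> mA mg; have mA' : measurable (A : set (measurableTypeR R)) by exact: mA.
have mF : measurable_fun [set: (T * measurableTypeR R)%type]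
    (fun z : T * measurableTypeR R => g (estimate Y K n h z.1 z.2) * \1_A z.2).
  apply: measurable_funM.
    by apply: (measurableT_comp mg); exact: measurable_estimate.
  have mi : measurable_fun [set: measurableTypeR R] (\1_A : measurableTypeR R -> R).
    exact: measurable_indic.
  exact: (measurableT_comp mi measurable_snd).
have := @measurable_Rintegral R _ _ T (measurableTypeR R) mu _ mF.
apply: eq_measurable_fun => w _ /=; rewrite /Rintegral [in RHS]integral_mkcond; congr fine.
apply: eq_integral => x _; rewrite patchE indicE.
by case: (x \in A); rewrite ?mulr1// mulr0.
Qed.

End estimator_measures.

Section normalization.
Context {R : realType}.
Local Notation mu := (@lebesgue_measure R).
Variables (g f : R -> R).
Hypotheses (ig : mu.-integrable [set: R] (EFin \o g)) (g1 : (\int[mu]_x g x = 1)%R)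
  (i_f : mu.-integrable [set: R] (EFin \o f)) (f1 : (\int[mu]_x f x = 1)%R)
  (f_ge0 : forall x, 0 <= f x).

Let mg : measurable_fun [set: R] g.
Proof. by apply/measurable_EFinP; exact: measurable_int ig. Qed.

Let pos x := Num.max (g x) 0.

Let mpos : measurable_fun [set: R] pos.
Proof. by apply: measurable_funrpos. Qed.

Let ipos : mu.-integrable [set: R] (EFin \o pos).
Proof.
apply: (@le_integrable _ _ _ mu _ measurableT _ (EFin \o g)) => //; first exact/measurable_EFinP.
move=> x _ /=; rewrite lee_fin /pos ger0_norm; last by rewrite le_max lexx orbT.
by rewrite ge_max normr_ge0 ler_norm.
Qed.

Let c := (\int[mu]_x pos x)%R.

Lemma pos_part_mass_ge1 : 1 <= c.
Proof.
have ipos' := ipos; have ig' := ig; rewrite /c -g1; apply: le_Rintegral => //.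
by move=> x _; rewrite /pos le_max lexx.
Qed.

Let c0 : 0 < c. Proof. by apply: lt_le_trans pos_part_mass_ge1. Qed.

Lemma measurable_normalized : measurable_fun [set: R] (normalized_pos_part g).
Proof. by apply: measurable_funM. Qed.

Lemma normalized_ge0 x : 0 <= normalized_pos_part g x.
Proof. by apply: divr_ge0; [rewrite le_max lexx orbT|exact: ltW]. Qed.

Let pos_mass : (\int[mu]_x (pos x)%:E = c%:E)%E.
Proof.
by rewrite /c /Rintegral fineK//; apply: (integrable_fin_num measurableT); exact: ipos.
Qed.

Let pos_ge0 x : 0 <= pos x. Proof. by rewrite le_max lexx orbT. Qed.

Lemma normalized_mass : (\int[mu]_x (normalized_pos_part g x)%:E = 1)%E.
Proof.
have c0' := c0.
have -> : (\int[mu]_x (normalized_pos_part g x)%:E = \int[mu]_x ((c^-1)%:E * (pos x)%:E))%E.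
  by apply: eq_integral => x _; rewrite -EFinM mulrC.
rewrite ge0_integralZl_EFin//; last 3 first.
- by move=> x _; rewrite lee_fin.
- exact/measurable_EFinP.
- by rewrite invr_ge0 ltW.
by rewrite pos_mass -EFinM mulVf// gt_eqF.
Qed.

(** Truncating at 0 does not increase the distance to f since f is
    nonnegative; dividing by the mass c costs c - 1, which is at most the
    same distance. *)
Lemma normalized_error : (\int[mu]_x `|normalized_pos_part g x - f x|%:E <=
  2%:E * \int[mu]_x `|g x - f x|%:E)%E.
Proof.
have c0' := c0; have c1 := pos_part_mass_ge1; have f0 := f_ge0.
have iB := integrableB measurableT ig i_f.
have ci1 : 0 <= 1 - c^-1 by rewrite subr_ge0 invf_le1.
have posf x : `|pos x - f x| <= `|g x - f x|.
  rewrite /pos; case: (leP 0 (g x)) => // /ltW gx0.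
  rewrite sub0r normrN ger0_norm// ler0_norm; last by rewrite subr_le0 (le_trans gx0).
  by rewrite opprB lerDl oppr_ge0.
have step x : (`|normalized_pos_part g x - f x|%:E <=
    (1 - c^-1)%:E * (pos x)%:E + `|g x - f x|%:E)%E.
  rewrite -EFinM -EFinD lee_fin.
  have -> : normalized_pos_part g x - f x = - ((1 - c^-1) * pos x) + (pos x - f x).
    by rewrite /normalized_pos_part -/(pos x) -/c; ring.
  apply: (le_trans (ler_normD _ _)); apply: lerD (posf x).
  by rewrite normrN normrM !ger0_norm.
have mE : measurable_fun [set: R] (fun x => `|g x - f x|%:E).
  by apply/measurable_EFinP; apply: measurableT_comp => //; apply/measurable_EFinP; exact: measurable_int iB.
have mp : measurable_fun [set: R] (fun x => ((1 - c^-1)%:E * (pos x)%:E)%E).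
  by apply: emeasurable_funM => //; exact/measurable_EFinP.
apply: le_trans.
  by apply: le_integral_nomeas; [move=> x; rewrite lee_fin|exact: step].
rewrite ge0_integralD//; last by move=> x _; rewrite -EFinM lee_fin mulr_ge0.
rewrite ge0_integralZl_EFin//; last 2 first.
- by move=> x _; rewrite lee_fin.
- exact/measurable_EFinP.
rewrite pos_mass -EFinM mulrBl mul1r mulVf ?gt_eqF//.
have -> : (2%:E = 1%:E + 1%:E :> \bar R)%E by [].
rewrite ge0_muleDl ?lee_fin// !mul1e; apply: leeD => //.
have ipB := integrableB measurableT ipos i_f.
have -> : c - 1 = (\int[mu]_x (pos x - f x))%R by rewrite /c -f1 RintegralB.
apply: (@le_trans _ _ (\int[mu]_x `|pos x - f x|%:E)%E); last first.
  by apply: le_integral_nomeas => x; rewrite lee_fin.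
apply: (@le_trans _ _ (`|\int[mu]_x (pos x - f x)|%R%:E)); first by rewrite lee_fin ler_norm.
have := le_normr_Rintegral measurableT ipB; rewrite -lee_fin => /le_trans; apply.
rewrite /Rintegral fineK//; apply: (integrable_fin_num measurableT).
exact: (integrable_norm ipB).
Qed.

End normalization.

Section total_variation_risk.
Context {R : realType} {d : measure_display} {T : measurableType d}.
Context {Pr : probability T R}.
Local Notation mu := (@lebesgue_measure R).
Variables (Y : int -> {RV Pr >-> R}) (f K : R -> R) (H v : nat -> R).
Hypotheses (mf : measurable_fun [set: R] f) (f_ge0 : forall x, 0 <= f x)
  (hf : has_density (distribution Pr (Y 0)) f)
  (intK : mu.-integrable [set: R] (EFin \o K)) (H0 : forall n, (0 < n)%N -> 0 < H n).

Let fn := kernel_estimator K H Y.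

Hypothesis risk : is_bigO (Lp_risk Pr 1 f fn) v.

Let i_f : mu.-integrable [set: R] (EFin \o f) := proj2 (density_mass mf f_ge0 hf).

Let i_fn n w : mu.-integrable [set: R] (EFin \o fn n w).
Proof. exact: (estimate_integrable Y intK w (H0 (n := n))). Qed.

Let m_fn n : measurable_fun [set: (T * measurableTypeR R)%type]
    (fun z : T * measurableTypeR R => fn n z.1 z.2).
Proof. exact: (measurable_estimate Y intK n (H n)). Qed.

Lemma L1_riskE n : Lp_risk Pr 1 f fn n = (\int[Pr]_w \int[mu]_x `|fn n w x - f x|%:E)%E.
Proof.
apply: eq_integral => w _; apply: eq_integral => x _.
by rewrite powRr1.
Qed.

(** The charge evaluated on a set is an integral depending measurably on the
    sample point, by Fubini. *)
Lemma estimator_charges : exists2 muhat : nat -> T -> {charge set R -> \bar R},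
    (forall n, random_charge (muhat n) /\ (forall w, has_density (muhat n w) (fn n w))) &
    is_bigO (variation_risk Pr (distribution Pr (Y 0)) muhat) v.
Proof.
pose muhat n w := projT1 (cid (density_charge (i_fn n w))).
have muhatE n w : has_density (muhat n w) (fn n w).
  exact: (projT2 (cid (density_charge (i_fn n w)))).
exists muhat.
  move=> n; split => // A mA.
  have := measurable_density_event Y intK n (H n) mA (@measurable_id _ _ [set: R]).
  move=> /measurable_EFinP; apply: eq_measurable_fun => w _ /=.
  rewrite muhatE// /Rintegral fineK//.
  have mA' : measurable (A : set (measurableTypeR R)) by exact: mA.
  by apply: (integrable_fin_num mA'); exact: (integrableS measurableT _ _ (i_fn n w)).
have [M hM] := risk; exists M; apply: filterS hM => n; apply: le_trans.
rewrite L1_riskE; apply: le_integral_nomeas => w; first exact: variation_norm_ge0.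
apply: (variation_norm_density (g := fun x => fn n w x - f x)).
  exact: (integrableB measurableT (i_fn n w) i_f).
exact: has_densityB.
Qed.

(** All the estimators have the integral of K and approach f, whose integral
    is 1, in mean L^1 distance. *)
Lemma kernel_mass_one : v n @[n --> \oo] --> (0 : R) -> (\int[mu]_x K x = 1)%R.
Proof.
move=> v0; have [M hM] := risk.
have f1 : (\int[mu]_x f x = 1)%R by rewrite /Rintegral (density_mass_one hf).
have le : \forall n \near \oo, `|(\int[mu]_x K x)%R - 1| <= M * v n.
  near=> n; have n0 : (0 < n)%N by near: n; exists 1%N.
  have : (Lp_risk Pr 1 f fn n <= (M * v n)%:E)%E by near: n.
  rewrite -lee_fin; apply: le_trans; rewrite L1_riskE.
  have -> : (`|(\int[mu]_x K x)%R - 1|%:E = \int[Pr]_w (cst (`|(\int[mu]_x K x)%R - 1|)%:E w))%E.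
    rewrite (integral_cst Pr measurableT) [X in (_ * X)%E](_ : _ = 1%E) ?mule1//.
    exact: probability_setT.
  apply: le_integral_nomeas => w; first by rewrite lee_fin.
  have iB := integrableB measurableT (i_fn n w) i_f.
  rewrite /cst -f1 -(estimate_integral Y intK w n0 (H0 n0)) -RintegralB//; last exact: (i_fn n w).
  have := le_normr_Rintegral measurableT iB; rewrite -lee_fin => /le_trans; apply.
  rewrite /Rintegral fineK//; apply: (integrable_fin_num measurableT).
  exact: (integrable_norm iB).
apply/eqP; rewrite -subr_eq0 -normr_eq0 eq_le normr_ge0 andbT.
have Mv : (M * v n) @[n --> \oo] --> (M * 0 : R) by apply: cvgM => //; exact: cvg_cst.
rewrite mulr0 in Mv.
exact: (cvgr_to_ge Mv le).
Unshelve. all: by end_near. Qed.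

Lemma estimator_probabilities : v n @[n --> \oo] --> (0 : R) ->
  exists2 mustar : nat -> {RV Pr >-> pprobability R R},
    (forall n w, (0 < n)%N -> has_density (mustar n w) (normalized_pos_part (fn n w))) &
    is_bigO (variation_risk Pr (distribution Pr (Y 0))
      (fun n w => charge_of_finite_measure (mustar n w))) v.
Proof.
move=> v0; have K1 := kernel_mass_one v0.
have f1 : (\int[mu]_x f x = 1)%R by rewrite /Rintegral (density_mass_one hf).
have fn1 n w : (0 < n)%N -> (\int[mu]_x fn n w x = 1)%R.
  by move=> n0; rewrite -K1; exact: (estimate_integral Y intK w n0 (H0 n0)).
(* The estimator built from no observation vanishes and cannot be normalized,
   so a constant is taken at n = 0. *)
have dens n : exists X : {RV Pr >-> pprobability R R},
    (0 < n)%N -> forall w, has_density (X w) (normalized_pos_part (fn n w)).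
  case: (posnP n) => [n0|n0].
    have mc : measurable_fun [set: T] (cst (distribution Pr (Y 0) : pprobability R R)).
      exact: measurable_cst.
    by exists (mfun_Sub (mem_set mc)).
  have ex w := density_probability (measurable_normalized (i_fn n w))
    (normalized_ge0 (i_fn n w) (fn1 n w n0)) (normalized_mass (i_fn n w) (fn1 n w n0)).
  pose F w : pprobability R R := projT1 (cid (ex w)).
  have FE w : has_density (F w : probability R R) (normalized_pos_part (fn n w)).
    exact: (projT2 (cid (ex w))).
  have mmax : measurable_fun [set: R] (fun y : R => Num.max y 0).
    by apply: measurable_funrpos; exact: measurable_id.
  have mF : measurable_fun [set: T] F.
    apply: (measurability (@pset _ R R : set (set (pprobability R R)))) => //.
    move=> _ -[_ [r r01] [U mU <-]] <-; apply: emeasurable_fun_infty_o => //=.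
    have mA := measurable_density_event Y intK n (H n) mU mmax.
    have mT := measurable_density_event Y intK n (H n) measurableT mmax.
    have : measurable_fun [set: T] (fun w =>
        ((\int[mu]_(x in U) Num.max (fn n w x) 0)%R *
         (\int[mu]_x Num.max (fn n w x) 0)%R `^ (-1))).
      apply: measurable_funM; first exact: mA.
      by apply: (measurableT_comp (measurable_powR (-1))); exact: mT.
    move=> /measurable_EFinP; apply: eq_measurable_fun => w _ /=.
    have mU' : measurable (U : set (measurableTypeR R)) by exact: mU.
    have ip : mu.-integrable U (EFin \o (fun x => Num.max (fn n w x) 0)).
      apply: (@le_integrable _ _ _ mu _ mU' _ (EFin \o fn n w)).
      - apply/measurable_EFinP; apply: (measurable_funS measurableT (@subsetT _ _)).
        apply: (measurableT_comp mmax); apply/measurable_EFinP.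
        exact: measurable_int (i_fn n w).
      - move=> x _ /=; rewrite lee_fin ger0_norm; last by rewrite le_max lexx orbT.
        by rewrite ge_max normr_ge0 ler_norm.
      - exact: (integrableS measurableT mU' (@subsetT _ _) (i_fn n w)).
    rewrite FE// powR_inv1; last first.
      by rewrite (le_trans _ (pos_part_mass_ge1 (i_fn n w) (fn1 n w n0))).
    rewrite mulrC EFinM /Rintegral fineK; last exact: (integrable_fin_num mU' ip).
    rewrite -(integralZl mU' ip); apply: eq_integral => x _.
    by rewrite -EFinM mulrC.
  by exists (mfun_Sub (mem_set mF)).
have [mustar hmu] := choice dens; exists mustar; first by move=> n w n0; exact: hmu.
have [M hM] := risk; exists (2 * M); near=> n.
have n0 : (0 < n)%N by near: n; exists 1%N.
have : (Lp_risk Pr 1 f fn n <= (M * v n)%:E)%E by near: n.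
rewrite L1_riskE => hn; rewrite -mulrA [leRHS]EFinM.
apply: le_trans; last first.
  by apply: lee_wpmul2l hn; rewrite lee_fin.
have m2 : measurable_fun [set: (T * measurableTypeR R)%type]
    (fun z : T * measurableTypeR R => `|fn n z.1 z.2 - f z.2|%:E).
  apply/measurable_EFinP; apply: measurableT_comp => //; apply: measurable_funB; first exact: m_fn.
  by apply: (measurableT_comp mf); exact: measurable_snd.
have z0 (z : T * measurableTypeR R) : (0 <= `|fn n z.1 z.2 - f z.2|%:E)%E by rewrite lee_fin.
have mI := @measurable_fun_fubini_tonelli_F _ _ T (measurableTypeR R) R mu _ m2 z0.
rewrite -ge0_integralZl_EFin//; last first.
  by move=> w _; apply: integral_ge0 => x _; rewrite lee_fin.
apply: le_integral_nomeas => w; first exact: variation_norm_ge0.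
have Fd := hmu n n0 w.
apply: le_trans (normalized_error (i_fn n w) (fn1 n w n0) i_f f1 f_ge0).
have iN : mu.-integrable [set: R] (EFin \o normalized_pos_part (fn n w)).
  apply/integrableP; split; first by apply/measurable_EFinP; exact: measurable_normalized (i_fn n w).
  rewrite (_ : (\int[mu]_x _ = \int[mu]_x (normalized_pos_part (fn n w) x)%:E)%E).
    by rewrite (normalized_mass (i_fn n w) (fn1 n w n0)) ltry.
  apply: eq_integral => x _; rewrite /= ger0_norm//.
  exact: normalized_ge0 (i_fn n w) (fn1 n w n0) x.
apply: (variation_norm_density (g := fun x => normalized_pos_part (fn n w) x - f x)).
  exact: (integrableB measurableT iN i_f).
exact: has_densityB.
Unshelve. all: by end_near. Qed.

End total_variation_risk.

(** * The rates of convergence *)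

Lemma cvg_powRN_nat (R : realType) (a : R) : 0 < a ->
  (n%:R : R) `^ (- a) @[n --> \oo] --> (0 : R).
Proof.
move=> a0; rewrite -(cvg_shiftS (fun n => (n%:R : R) `^ (- a))) /=.
under eq_fun do rewrite -natr1 addrC.
exact: (cvg_comp _ _ cvgr_idn (cvg_powRN_pinfty a0)).
Qed.

Unset Implicit Arguments.
Set Strict Implicit.
Set Printing Implicit Defensive.

Theorem mainTheorem5 (R : realType) (d : measure_display) (T : measurableType d)
    (Pr : probability T R) (p : R) (hp : 1 <= p < 2)
    (Y : int -> {RV Pr >-> R}) (hY : strictly_stationary Y)
    (f : R -> R) (mf : measurable_fun [set: R] f) (f_ge0 : forall x, 0 <= f x)
    (hf : has_density (distribution Pr (Y 0)) f)
    (kappa : nat -> R.-pker (g_sigma_algebraType (past Y 0)) ~> R)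
    (hkappa : forall k : nat, cond_distribution (Y k%:Z) (kappa k))
    (K : R -> R) (intK : lebesgue_measure.-integrable [set: R] (EFin \o K))
    (bvK : bounded_variation_line K)
    (r : nat) (hr : (0 < r)%N) (hK : approximation_order K p r)
    (q eps : R) (hq : 1 < q) (heps : 0 < eps)
    (hmoment : ('E_Pr[(fun w => `|Y 0 w| `^ (q * (2 - p) / p + eps))%R] < +oo)%E)
    (s : R)
    (hs : [/\ 0 < s, r%:R - 1 <= s < r%:R & gen_lipschitz s p f] \/
          (s = r%:R /\ sobolev r p f))
    (C : R) (hC : 0 < C) :
  (forall delta : R, 0 <= delta < 1 ->
    is_bigO
      (fun n => (\sum_(0 <= k < n.+1)
         ((k.+1%:R `^ (1 / (q - 1)))%:E * dep_beta1 (kappa k)))%E)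
      (fun n => n%:R `^ (delta * q / (q - 1))) ->
    let fn := kernel_estimator K (bandwidth C delta s) Y in
    is_bigO (Lp_risk Pr p f fn)
      (fun n => n%:R `^ (- (p * s * (1 - delta)) / (2 * s + 1))) /\
    (p = 1 ->
      (exists2 muhat : nat -> T -> {charge set R -> \bar R},
        (forall n,
          random_charge (muhat n) /\
          (forall w, has_density (muhat n w) (fn n w))) &
        is_bigO (variation_risk Pr (distribution Pr (Y 0)) muhat)
          (fun n => n%:R `^ (- (s * (1 - delta)) / (2 * s + 1)))) /\
      (exists2 mustar : nat -> {RV Pr >-> pprobability R R},
        (forall n w, (0 < n)%N ->
          has_density (mustar n w) (normalized_pos_part (fn n w))) &
        is_bigO
          (variation_risk Pr (distribution Pr (Y 0))
            (fun n w => charge_of_finite_measure (mustar n w)))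
          (fun n => n%:R `^ (- (s * (1 - delta)) / (2 * s + 1)))))) /\
  ((\sum_(0 <= k <oo)
      ((k.+1%:R `^ (1 / (q - 1)))%:E * dep_beta1 (kappa k)) < +oo)%E ->
    is_bigO
      (Lp_risk Pr p f (kernel_estimator K (bandwidth C 0 s) Y))
      (fun n => n%:R `^ (- (p * s) / (2 * s + 1)))).
Proof.
have p1 : 1 <= p by case/andP: hp.
have s0 : 0 < s by case: hs => [[]//|[-> _]]; rewrite ltr0n.
have mass := density_mass mf f_ge0 hf.
have [M KM] := bvK; have [W KW] := bounded_variation_bounded KM.
have [B B0 hB] : exists2 B, 0 <= B & forall h, 0 < h ->
    (\int[lebesgue_measure]_x (`|smoothing_error (scaled_kernel K h) f x| `^ p)%:E
      <= (B * h `^ (p * s))%:E)%E.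
  case: hs => [[_ rs lip]|[-> sob]]; last exact: sobolev_bias p1 sob hK.
  exact: lipschitz_bias p1 s0 hr mass intK KW rs lip hK.
have rate delta : 0 <= delta < 1 -> _ := fun hd =>
  risk_rate hp hY mf f_ge0 hf hkappa intK bvK hq heps hmoment s0 hC (B := B) hd B0 hB.
split; last first.
  move=> summable.
  have d01 : 0 <= (0 : R) < 1 by rewrite lexx ltr01.
  have := rate 0 d01.
  rewrite subr0 mulr1; apply.
  set S := (\sum_(0 <= k <oo) _)%E in summable *.
  have t0 k : (0 <= (k.+1%:R `^ (1 / (q - 1)))%:E * dep_beta1 (kappa k))%E.
    rewrite mule_ge0 ?lee_fin ?powR_ge0//; apply: integral_ge0 => w _.
    by apply: le_trans (ereal_sup_ubound _); last by exists 0.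
  have S0 : (0 <= S)%E by apply: nneseries_ge0 => k _ _; exact: t0.
  have Sf : S \is a fin_num by rewrite ge0_fin_numE.
  exists (fine S); apply: nearW => n.
  rewrite !mul0r powRr0 mulr1 fineK//.
  by apply: nneseries_lim_ge => k _ _; exact: t0.
move=> delta hd hsum fn; have risk := rate delta hd hsum.
split=> // p_eq1; rewrite p_eq1 mul1r in risk.
have H0 n : (0 < n)%N -> 0 < bandwidth C delta s n.
  by move=> n0; rewrite mulr_gt0// powR_gt0// ltr0n.
have v0 : (n%:R : R) `^ (- (s * (1 - delta)) / (2 * s + 1)) @[n --> \oo] --> (0 : R).
  have -> : - (s * (1 - delta)) / (2 * s + 1) = - (s * (1 - delta) / (2 * s + 1)).
    by rewrite mulNr.
  apply: cvg_powRN_nat; case/andP: hd => _ hd.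
  by rewrite divr_gt0 ?mulr_gt0 ?subr_gt0//; lra.
split; first exact: estimator_charges mf f_ge0 hf intK H0 risk.
exact: estimator_probabilities mf f_ge0 hf intK H0 risk v0.
Qed.
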